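(* Let $G$ be a finite abelian group, let $n\geq 1$, let $S\in \mathcal F(G)$ be a sequence of terms from $G$ with $H=\mathsf H(\Sigma_n(S))$, and let $S'\mid S$ be a subsequence with $\mathsf h(S')\leq n\leq |S'|$. Suppose either $H$ is trivial, equal to $G$, or that one of the following holds: \begin{itemize} \item[1.] $n\geq \exp(G/H)+1$, \item[2.] $n\geq \exp(G/H)>|H|$, \item[3.] $n\geq \exp(G/H)$ and $G/H\cong C_2\times C_{\exp(G/H)}$, \item[4.] $n\geq \exp(G/H)-1$ and $G/H$ is cyclic. \end{itemize} Then there is a setpartition $\mathscr A=A_1\cdot\ldots\cdot A_n\in \mathscr P(G)$ with $\mathsf S(\mathscr A)\mid S$ and $|\mathsf S(\mathscr A)|=|S'|$ such that \begin{itemize} \item[(i)] $|\Sigma_n(S)|\geq |\sum_{i=1}^{n}A_i|\geq \min\{|G|,\, |S'|-n+1\}$, or \item[(ii)] there exists a nontrivial subgroup $K\leq H<G$ and $\alpha\in G$ such that the following hold: \begin{itemize} \item[(a)] $\Sigma_n(S)=\sum_{i=1}^{n}A_i$ and $\operatorname{supp}(\mathsf S(\mathscr A)^{[-1]}\cdot S)\subseteq \alpha+K$, \item[(b)] $|\Sigma_n(S)|\geq (e_H+1)|H|$, where $e_H\leq \min\{|G/H|-2,\, \frac{|S'|-n}{|H|}-1\}$ is the number of terms of $S$ lying outside the coset $\alpha+H$, and $|\Sigma_n(S)|\geq (e_K+1)|K|$, where $e_K\leq \min\{|G/K|-2,\, \frac{|S'|-n}{|K|}-1\}$ is the number of terms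 of $S$ lying outside $\alpha+K$. \item[(c)] $(\alpha+K)\cap A_i\neq \emptyset$ for all $i\in [1,n]$, \ $A_i\subseteq \alpha+K$ for all $i\in [1,n-e_K]$, and $|A_i\setminus (\alpha+K)|=1$ for all $i\in [n-e_K+1,n]$, \item[(d)] $\sum_{i=1}^{n-e_K} A_i=(n-e_K)\alpha+K$. \end{itemize} \end{itemize}
   Context: Notation: $\mathcal F(G)$ is the free abelian monoid of sequences over $G$; a sequence is written $S=g_1\cdot\ldots\cdot g_\ell$ with $\cdot$ the concatenation operation, $|S|=\ell$ its length, $T\mid S$ means $T$ is a subsequence of $S$, and $T^{[-1]}\cdot S$ is the sequence obtained by removing the terms of $T$ from $S$. $\mathsf h(S)$ is the maximum multiplicity of a term of $S$, $\operatorname{supp}(S)$ the set of its terms, and $\Sigma_n(S)$ the set of sums of $n$-term subsequences of $S$. For $A\subseteq G$, $\mathsf H(A)=\{x\in G: x+A=A\}$ is the stabilizer. A setpartition $\mathscr A=A_1\cdot\ldots\cdot A_n\in\mathscr P(G)$ is a sequence of finite nonempty subsets of $G$, and $\mathsf S(\mathscr A)$ is the sequence obtained by concatenating the elements of all the $A_i$. $C_m$ denotes a cyclic group of order $m$, $[a,b]$ is a discrete interval of integers. *)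

(* Defs.v *)
From HB Require Import structures.
From mathcomp Require Import all_boot all_order all_algebra all_fingroup all_solvable.
From mathcomp Require Import finmap multiset.

Set Implicit Arguments.
Unset Strict Implicit.
Unset Printing Implicit Defensive.

Import GRing.Theory.
Local Open Scope ring_scope.
Local Open Scope mset_scope.

(* A sequence over G, i.e. an element of the free abelian monoid F(G), is a
   finite multiset {mset G}: concatenation is `+`, T | S is T `<=` S, removal
   of the terms of T is S `\` T, the length is size, and S x is the
   multiplicity of x in S. The group-theoretic notions (subgroups, quotients,
   exponent, isomorphism) apply to the finGroupType underlying a finZmodType,
   whose group law is +. *)

Section Sequences.
Variable G : finZmodType.
Implicit Types (S : {mset G}) (A B : {set G}) (x a : G).

Definition max_mult S : nat := (\max_(x : G) S x)%N.

Definition subsums n S : {set G} :=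
  [set \sum_(x <- T) x | T : n.-tuple G & seq_mset T `<=` S].

Definition translate a A : {set G} := [set a + x | x in A].

Definition stab A : {set G} := [set x | translate x A == A].

Lemma translateD a b A : translate (a + b) A = translate a (translate b A).
Proof.
by rewrite /translate -imset_comp; apply: eq_imset => x /=; rewrite addrA.
Qed.

Lemma stab_group_set A : group_set (stab A).
Proof.
apply/group_setP; split=> [|x y]; rewrite !inE.
  rewrite /translate (eq_imset (g := id)) ?imset_id // => x.
  exact: add0r.
by move=> /eqP xA /eqP yA; rewrite translateD yA xA.
Qed.

Canonical stab_group A := Group (stab_group_set A).

Definition sumset A B : {set G} := [set a + b | a in A, b in B].

(* Counted with multiplicity. *)
Definition num_outside S A : nat := count (fun x => x \notin A) S.

(* A setpartition A_1 ... A_n is given by an indexed family of nonempty sets. *)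
Definition is_setpartition n (A : 'I_n -> {set G}) : Prop :=
  forall i, A i != set0.

Definition setpart_seq n (A : 'I_n -> {set G}) : {mset G} :=
  seq_mset (flatten [seq enum (A i) | i : 'I_n]).

End Sequences.

Notation "\sumset_ ( i < n ) F" := (\big[@sumset _/[set 0]]_(i < n) F)
  (at level 36, F at level 36, i, n at level 50,
   format "\sumset_ ( i  <  n )  F") : ring_scope.
Notation "\sumset_ ( i < n | P ) F" := (\big[@sumset _/[set 0]]_(i < n | P) F)
  (at level 36, F at level 36, i, n at level 50,
   format "\sumset_ ( i  <  n  |  P )  F") : ring_scope.

(* Zp e is trivial when e = 1, whereas 'Z_1 would have two elements. *)
Definition isog_C2_Ce (gT : finGroupType) (Q : {set gT}) (e : nat) : bool :=
  Q \isog setX [set: 'Z_2] (Zp e).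

(* Main.v *)
(* A sequence is handled through its multiplicity function v, and Sigma_n(S) is
   then sums n v. An exchange argument based on the Kemperman-Scherk theorem shows
   that a setpartition maximizing |A_1 + ... + A_n| either satisfies the bound in
   (i) or exhausts Sigma_n(S); with Kneser's theorem this gives the
   DeVos-Goddyn-Mohar bound for aperiodic Sigma_n. If (i) fails, pass to G/H,
   where Sigma_n becomes aperiodic, and let Z be the set of elements of
   multiplicity at least n.

   Z empty contradicts DeVos-Goddyn-Mohar. If Z has one element, choose a coset
   alpha + K with K <= H of minimal order such that (e_K + 1)|K| <= |Sigma_n(S)|:
   minimality forces n - e_K sets inside alpha + K to sum to a full coset, and
   the e_K outside terms are distributed over the other sets, which is (ii). If
   |Z| >= 2, counting gives |nZ| <= |Sigma_n| < n|Z|. By the isoperimetric method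
   this is impossible for n >= exp(G/H), unless n = exp(G/H) and, modulo its
   stabilizer, nZ is the group generated by Z less a point; the latter forces
   n <= |H|, and the numerical hypotheses exclude the remaining cases. *)

(* Of S' only the length l is kept, through n <= l <= sum of min(n, v g). If (i) fails then
   |Sigma_n(S)| + n <= l. Let X be the image of Sigma_n(S) modulo H, Z the set of classes of
   multiplicity at least n, and e the number of terms outside them. A class in Z accounts for at
   most n|H| in l, so |H||X| + n <= n|Z||H| + e, while DeVos-Goddyn-Mohar gives n|Z| + e < |X| + n.
   Together they yield |X| < n|Z| and also e <= n - 2: every choice of n terms has at least two in
   Z, and this lets periodicity of 2Z pass to X. The obstacle is the sharp case n = E, with E =
   exp(G/H). For n > E no aperiodic nZ has fewer than n|Z| elements, but for n = E the sets called
   [exotic] below do occur, and sumset arguments alone cannot remove them: only the comparison of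
   |X| with the counting bound does, by forcing n <= |H|. The hypotheses accordingly enter only
   through the numbers n, E, |H| and |G|, together with the fact that E kills G/H. *)
From HB Require Import structures.
Require Import Defs.
From mathcomp Require Import all_boot all_order all_algebra all_fingroup all_solvable.
From mathcomp Require Import finmap multiset zify.
From Stdlib Require Import Classical.

Set Implicit Arguments.
Unset Strict Implicit.
Unset Printing Implicit Defensive.

Import Order.TTheory GRing.Theory Num.Theory FinRing.Theory.
Local Open Scope ring_scope.
Local Open Scope mset_scope.

(* Equality in abelian groups is decided by comparing integer coefficients
   of the reified atoms. *)
Inductive zexpr :=
  | ZVar of nat | ZZero | ZAdd of zexpr & zexpr | ZOpp of zexpr.

Fixpoint zcoef (e : zexpr) (i : nat) : int :=
  match e with
  | ZVar j => (i == j)%:Z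
  | ZZero => 0
  | ZAdd e1 e2 => zcoef e1 i + zcoef e2 i
  | ZOpp e1 => - zcoef e1 i
  end.

Fixpoint zbound (e : zexpr) (k : nat) : bool :=
  match e with
  | ZVar j => (j < k)%N
  | ZZero => true
  | ZAdd e1 e2 => zbound e1 k && zbound e2 k
  | ZOpp e1 => zbound e1 k
  end.

Fixpoint zeval (V : zmodType) (env : seq V) (e : zexpr) : V :=
  match e with
  | ZVar j => nth 0 env j
  | ZZero => 0
  | ZAdd e1 e2 => zeval env e1 + zeval env e2
  | ZOpp e1 => - zeval env e1
  end.

Lemma zevalE (V : zmodType) (env : seq V) (e : zexpr) :
  zbound e (size env) -> zeval env e = \sum_(i < size env) nth 0 env i *~ zcoef e i.
Proof.
elim: e => [j|_|e1 IH1 e2 IH2|e IH] /=.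
- move=> lt_j; rewrite (bigD1 (Ordinal lt_j)) //= eqxx big1 ?addr0 // => i.
  by rewrite -val_eqE /= => /negPf ->.
- by rewrite big1.
- case/andP => b1 b2; rewrite IH1 // IH2 // -big_split /=.
  by apply: eq_bigr => i _; rewrite mulrzDr.
- by move=> b; rewrite IH // -sumrN; apply: eq_bigr => i _; rewrite mulrNz.
Qed.

Lemma zeval_eq (V : zmodType) (env : seq V) (e1 e2 : zexpr) :
  [&& zbound e1 (size env), zbound e2 (size env) &
    all (fun i => zcoef e1 i == zcoef e2 i) (iota 0 (size env))] ->
  zeval env e1 = zeval env e2.
Proof.
case/and3P => b1 b2 /allP E; rewrite !zevalE //; apply: eq_bigr => i _.
by rewrite (eqP (E i _)) ?mem_iota ?ltn_ord.
Qed.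

(** The nested match turns success or failure of unification into a boolean term, so that atoms
    equal up to canonical instances share one index. *)
Ltac zunify x y :=
  match constr:(tt) with
  | _ => let _ := match constr:(tt) with _ => unify x y end in constr:(true)
  | _ => constr:(false)
  end.
Ltac zmem x l :=
  lazymatch l with
  | nil => constr:(false)
  | cons x _ => constr:(true)
  | cons ?y ?l' =>
    lazymatch zunify x y with true => constr:(true) | false => zmem x l' end
  end.
Ltac zatoms t l :=
  lazymatch t with
  | @GRing.zero _ => l
  | @GRing.add _ ?a ?b => let l1 := zatoms a l in zatoms b l1
  | @GRing.opp _ ?a => zatoms a l
  | @GRing.natmul _ ?a 0 => l
  | @GRing.natmul _ ?a 1 => zatoms a l
  | @GRing.natmul _ ?a 2 => zatoms a l
  | _ => lazymatch zmem t l with true => l | false => constr:(cons t l) end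
  end.
Ltac zindex x l :=
  lazymatch l with
  | cons x _ => constr:(0%N)
  | cons ?y ?l' =>
    lazymatch zunify x y with
    | true => constr:(0%N)
    | false => let i := zindex x l' in constr:(i.+1)
    end
  end.
Ltac zreify t l :=
  lazymatch t with
  | @GRing.zero _ => constr:(ZZero)
  | @GRing.add _ ?a ?b =>
      let ea := zreify a l in let eb := zreify b l in constr:(ZAdd ea eb)
  | @GRing.opp _ ?a => let ea := zreify a l in constr:(ZOpp ea)
  | @GRing.natmul _ ?a 0 => constr:(ZZero)
  | @GRing.natmul _ ?a 1 => zreify a l
  | @GRing.natmul _ ?a 2 => let ea := zreify a l in constr:(ZAdd ea ea)
  | _ => let i := zindex t l in constr:(ZVar i)
  end.
Ltac zmod :=
  intros;
  lazymatch goal with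
  | |- @eq ?T ?s ?t =>
    let l0 := zatoms s (@nil T) in
    let l := zatoms t l0 in
    let es := zreify s l in let et := zreify t l in
    exact (@zeval_eq _ l es et isT)
  end.

Ltac zmem_from H :=
  lazymatch type of H with
  | is_true (in_mem ?u _) =>
    lazymatch goal with
    | |- is_true (in_mem ?v _) =>
      let E := fresh in assert (E : v = u) by zmod; rewrite E; exact H
    end
  end.

Definition card_zmod (G : finZmodType) (A : {set G}) : nat := #|A|.

Lemma card_zmodE (G : finZmodType) (A : {set G}) : #|A| = card_zmod A.
Proof. by []. Qed.

(* Cardinals of sets over a finZmodType are elaborated along several
   inheritance paths; lia only sees them as equal once these are unified. *)
Ltac clia :=
  intros;
  repeat match goal with
  | H : is_true (in_mem _ _) |- _ => clear H
  | H : is_true (fintype.subset _ _) |- _ => clear H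
  | H : is_true (fintype.proper _ _) |- _ => clear H
  | H : is_true (negb (in_mem _ _)) |- _ => clear H
  | H : is_true (negb (@eq_op (set_of _) _ _)) |- _ => clear H
  | H : @eq (set_of _) _ _ |- _ => clear H
  | H : forall x, _ |- _ =>
    lazymatch type of H with ?P -> False => fail | _ => clear H end
  end;
  rewrite ?card_zmodE;
  repeat match goal with
  | H : ?P |- _ =>
    lazymatch type of P with Prop =>
      lazymatch P with context [@card.body] => rewrite !card_zmodE in H end
    end
  end; lia.

(** * Sumsets and subgroups *)

Notation "A :+: B" := (sumset A B) (at level 50, left associativity).
Notation "x +: A" := (translate x A) (at level 45, right associativity).

Section Extrema.

(** Classical, because extrema are later taken for [Prop] predicates over types such as
    ['I_n -> {set G}]. *)
Lemma ex_min_nat (T : Type) (P : T -> Prop) (f : T -> nat) :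
  (exists x, P x) -> exists x, P x /\ forall y, P y -> (f x <= f y)%N.
Proof.
move=> [x Px]; have [k] := ubnP (f x); elim: k x Px => // k IHk x Px le_k.
have [[y [Py lt_yx]]|no_y] := classic (exists y, P y /\ (f y < f x)%N).
  by apply: (IHk y) => //; lia.
exists x; split=> // y Py; rewrite leqNgt; apply/negP => lt_yx.
by apply: no_y; exists y.
Qed.

Lemma ex_max_nat (T : Type) (P : T -> Prop) (f : T -> nat) (b : nat) :
    (exists x, P x) -> (forall x, P x -> (f x <= b)%N) ->
  exists x, P x /\ forall y, P y -> (f y <= f x)%N.
Proof.
move=> /(ex_min_nat (fun x => b - f x)%N) [x [Px x_min]] f_le.
by exists x; split=> // y Py; have := x_min y Py; have := f_le y Py; have := f_le x Px; lia.
Qed.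

End Extrema.

Section Sumsets.
Variable G : finZmodType.
Implicit Types (A B C H K : {set G}) (x y a b : G).

(** Closure under addition suffices in a finite group; [grpN] recovers opposites as multiples, by
    the order of the element. *)
Definition subgrp (A : {set G}) : bool :=
  (0 \in A) && [forall x in A, forall y in A, x + y \in A].

Lemma subgrpP A :
  reflect (0 \in A /\ {in A &, forall x y, x + y \in A}) (subgrp A).
Proof.
apply: (iffP andP) => -[A0 AD]; split=> //.
  by move=> x y Ax Ay; move/forall_inP: AD => /(_ x Ax) /forall_inP; apply.
by apply/forall_inP => x Ax; apply/forall_inP => y Ay; apply: AD.
Qed.

Section SubgrpTheory.
Variables (H : {set G}) (gH : subgrp H).

Lemma grp0 : 0 \in H. Proof. by case/subgrpP: gH. Qed.
Lemma grpD x y : x \in H -> y \in H -> x + y \in H.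
Proof. by case/subgrpP: gH => _; apply. Qed.
Lemma grpMn x k : x \in H -> x *+ k \in H.
Proof. by move=> Hx; elim: k => [|k IH]; rewrite ?mulr0n ?grp0 // mulrS grpD. Qed.
Lemma grpN x : (- x \in H) = (x \in H).
Proof.
suff N z : z \in H -> - z \in H by apply/idP/idP => /N; rewrite ?opprK.
move=> Hz; have z0 := zmodXgE #[z]%g.-1.+1 z.
rewrite prednK ?order_gt0 // expg_order zmod1gE in z0.
have -> : - z = z *+ #[z]%g.-1 
  by apply/eqP; rewrite eq_sym -subr_eq0 opprK -mulrSr prednK ?order_gt0 // -z0.
exact: grpMn.
Qed.
Lemma grpB x y : x \in H -> y \in H -> x - y \in H.
Proof. by move=> Hx Hy; apply: grpD => //; rewrite grpN. Qed.
Lemma grpDl x y : x \in H -> (x + y \in H) = (y \in H).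
Proof.
move=> Hx; apply/idP/idP => [Hxy|]; last exact: grpD.
by have Hd := grpB Hxy Hx; zmem_from Hd.
Qed.
Lemma grpDr x y : x \in H -> (y + x \in H) = (y \in H).
Proof. by rewrite addrC; apply: grpDl. Qed.
Lemma grp_sum (I : Type) (r : seq I) (P : pred I) (F : I -> G) :
  (forall i, P i -> F i \in H) -> \sum_(i <- r | P i) F i \in H.
Proof.
move=> HF; elim/big_ind: _ => //; [exact: grp0|by move=> x y; apply: grpD].
Qed.

End SubgrpTheory.

Lemma sumsetP A B c :
  reflect (exists a b, [/\ a \in A, b \in B & c = a + b]) (c \in A :+: B).
Proof.
apply: (iffP imset2P) => [[a b Aa Bb ->]|[a [b [Aa Bb ->]]]].
  by exists a, b.
by exists a b.
Qed.

Lemma mem_sumset A B a b : a \in A -> b \in B -> a + b \in A :+: B.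
Proof. by move=> Aa Bb; apply/sumsetP; exists a, b. Qed.

Lemma sumsetC : commutative (@sumset G).
Proof.
by move=> A B; apply/setP => c; apply/sumsetP/sumsetP => -[a [b [Aa Bb ->]]];
  exists b, a; rewrite addrC.
Qed.

Lemma sumsetA : associative (@sumset G).
Proof.
move=> A B C; apply/setP => c; apply/sumsetP/sumsetP.
  move=> [a [_ [Aa /sumsetP [b [d [Bb Cd ->]]] ->]]].
  by exists (a + b), d; rewrite addrA mem_sumset.
move=> [_ [d [/sumsetP [a [b [Aa Bb ->]]] Cd ->]]].
by exists a, (b + d); rewrite addrA mem_sumset.
Qed.

Lemma sum0set : left_id [set 0] (@sumset G).
Proof.
move=> A; apply/setP => c; apply/sumsetP/idP => [[a [b []]]|Ac].
  by move/set1P => -> Ab ->; rewrite add0r.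
by exists 0, c; rewrite set11 add0r.
Qed.

Lemma mem_translate a A x : (x \in a +: A) = (x - a \in A).
Proof.
apply/imsetP/idP => [[y Ay ->]|Axa]; first by rewrite addrC addrA addNr add0r.
by exists (x - a) => //; rewrite addrC subrK.
Qed.

Lemma translateE a A : a +: A = [set a] :+: A.
Proof.
apply/setP => x; rewrite mem_translate; apply/idP/sumsetP => [Ax|[_ [b [/set1P -> Ab ->]]]].
  by exists a, (x - a); rewrite set11 [a + _]addrC subrK.
by rewrite addrC addrA addNr add0r.
Qed.

Lemma translate0 A : 0 +: A = A.
Proof. by apply/setP => x; rewrite mem_translate subr0. Qed.

Lemma card_translate a A : #|a +: A| = #|A|.
Proof. by apply: card_imset; exact: addrI. Qed.

Lemma sumset_translate a A B : (a +: A) :+: B = a +: (A :+: B).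
Proof. by rewrite !translateE sumsetA. Qed.

Lemma translate_sumset a A B : A :+: (a +: B) = a +: (A :+: B).
Proof. by rewrite sumsetC sumset_translate sumsetC. Qed.

Lemma translateS a A B : (a +: A \subset a +: B) = (A \subset B).
Proof.
apply/subsetP/subsetP => sAB x.
  by move=> Ax; have := sAB (a + x); rewrite !mem_translate addrC addKr; apply.
by rewrite !mem_translate; apply: sAB.
Qed.

Lemma sumsetSS A A' B B' :
  A \subset A' -> B \subset B' -> A :+: B \subset A' :+: B'.
Proof.
move=> /subsetP sA /subsetP sB; apply/subsetP => _ /sumsetP [a [b [Aa Bb ->]]].
by rewrite mem_sumset ?sA ?sB.
Qed.

Lemma sumsetS A B B' : B \subset B' -> A :+: B \subset A :+: B'.
Proof. exact: sumsetSS. Qed.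

Lemma sumsetSl A A' B : A \subset A' -> A :+: B \subset A' :+: B.
Proof. by move=> sA; apply: sumsetSS. Qed.

Lemma sumsetUl A B C : (A :|: B) :+: C = (A :+: C) :|: (B :+: C).
Proof.
apply/eqP; rewrite eqEsubset subUset !sumsetSl ?subsetUl ?subsetUr ?andbT //.
apply/subsetP => _ /sumsetP [a [c [/setUP [] Aa Cc ->]]]; apply/setUP;
  by [left; apply: mem_sumset | right; apply: mem_sumset].
Qed.

Lemma sumsetUr A B C : C :+: (A :|: B) = (C :+: A) :|: (C :+: B).
Proof. by rewrite sumsetC sumsetUl ![_ :+: C]sumsetC. Qed.

Lemma subset_sumsetl A B a : a \in A -> a +: B \subset A :+: B.
Proof. by move=> Aa; rewrite translateE sumsetSl // sub1set. Qed.

Lemma subset_sumsetr A B : 0 \in B -> A \subset A :+: B.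
Proof. by move=> B0; apply/subsetP => a Aa; rewrite -[a]addr0 mem_sumset. Qed.

Lemma sumset_neq0 A B : A != set0 -> B != set0 -> A :+: B != set0.
Proof.
by move=> /set0Pn [a Aa] /set0Pn [b Bb]; apply/set0Pn; exists (a + b); apply: mem_sumset.
Qed.

Lemma sum0set_eq0 A : set0 :+: A = set0.
Proof. by apply/setP => x; rewrite inE; apply/negP => /sumsetP [a [b []]]; rewrite inE. Qed.

Lemma leq_card_sumset A B : B != set0 -> (#|A| <= #|A :+: B|)%N.
Proof.
by move=> /set0Pn [b Bb]; rewrite -(card_translate b A) sumsetC subset_leq_card // subset_sumsetl.
Qed.

Lemma leq_card_sumsetr A B : A != set0 -> (#|B| <= #|A :+: B|)%N.
Proof. by move=> A0; rewrite sumsetC leq_card_sumset. Qed.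

Lemma in_stab x A : (x \in stab A) = (x +: A == A). Proof. by rewrite inE. Qed.

Lemma stabP x A : (forall a, a \in A -> x + a \in A) -> x \in stab A.
Proof.
move=> xA; rewrite in_stab eqEcard card_translate leqnn andbT.
by apply/subsetP => _ /imsetP [a Aa ->]; apply: xA.
Qed.

Lemma subgrp_stab A : subgrp (stab A).
Proof.
apply/subgrpP; split; first by rewrite in_stab translate0.
by move=> x y; rewrite !in_stab => /eqP xA /eqP yA; rewrite translateD yA xA.
Qed.

Lemma stabD x A a : x \in stab A -> (x + a \in A) = (a \in A).
Proof. by rewrite in_stab => /eqP {1}<-; rewrite mem_translate addrAC subrr add0r. Qed.

Lemma sumset_stab A : A :+: stab A = A.
Proof.
apply/eqP; rewrite eqEsubset subset_sumsetr ?andbT; last exact: grp0 (subgrp_stab A).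
by apply/subsetP => _ /sumsetP [a [x [Aa xA ->]]]; rewrite addrC stabD.
Qed.

Lemma sub_stab B A : (B \subset stab A) = (A :+: B \subset A).
Proof.
apply/subsetP/subsetP => [sB _ /sumsetP [a [x [Aa Bx ->]]]|sB x Bx].
  by rewrite addrC stabD // sB.
by apply: stabP => a Aa; rewrite addrC; apply: sB; apply: mem_sumset.
Qed.

Lemma sub_stab_grp H A (gH : subgrp H) : (H \subset stab A) = (A :+: H == A).
Proof. by rewrite sub_stab eqEsubset [A \subset _]subset_sumsetr ?(grp0 gH) ?andbT. Qed.

Lemma grp_sumset H (gH : subgrp H) : H :+: H = H.
Proof.
apply/eqP; rewrite -(sub_stab_grp _ gH); apply/subsetP => x Hx.
by apply: stabP => a Ha; apply: (grpD gH).
Qed.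

Lemma stab_sumsetl A B : stab A \subset stab (A :+: B).
Proof. by rewrite sub_stab -sumsetA [B :+: _]sumsetC sumsetA sumset_stab. Qed.

Lemma stab_sumsetr A B : stab B \subset stab (A :+: B).
Proof. by rewrite sumsetC stab_sumsetl. Qed.

Lemma card_stab_le A : A != set0 -> (#|stab A| <= #|A|)%N.
Proof.
move=> A0; have := leq_card_sumsetr (stab A) A0; by rewrite sumset_stab.
Qed.

Lemma stab_translate a A : stab (a +: A) = stab A.
Proof.
apply/eqP; rewrite eqEsubset !sub_stab sumset_translate sumset_stab subxx andbT.
by have := sumset_stab (a +: A); rewrite sumset_translate => /eqP; rewrite eqEsubset => /andP [];
  rewrite translateS.
Qed.

Lemma stab_grp H (gH : subgrp H) : stab H = H.
Proof.
apply/eqP; rewrite eqEsubset (sub_stab_grp _ gH) (grp_sumset gH) eqxx andbT.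
apply/subsetP => x xH; rewrite -[x]addr0 stabD //; exact: grp0 gH.
Qed.

Lemma coset_eq H (gH : subgrp H) a b : (a +: H == b +: H) = (a - b \in H).
Proof.
apply/eqP/idP => [E|Hab].
  by rewrite -mem_translate -E mem_translate subrr (grp0 gH).
apply/setP => x; rewrite !mem_translate -[x - b](subrK (x - a)).
have ->: x - b - (x - a) = a - b by zmod.
by rewrite [RHS](grpDl gH).
Qed.

Lemma mem_coset_eq H (gH : subgrp H) a b : a \in b +: H -> a +: H = b +: H.
Proof. by rewrite mem_translate -(coset_eq gH) => /eqP. Qed.

(** Pigeonhole: for [c] in the coset of [a + b], the sets [A] and [c - B] lie in the same coset of
    [H] and are too large to be disjoint. *)
Lemma sumset_full H A B (gH : subgrp H) a b : A \subset a +: H -> B \subset b +: H ->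
  (#|H| < #|A| + #|B|)%N -> A :+: B = (a + b) +: H.
Proof.
move=> sA sB lt_H; apply/eqP; rewrite eqEsubset; apply/andP; split.
  apply: subset_trans (sumsetSS sA sB) _.
  by rewrite sumset_translate translate_sumset (grp_sumset gH) -translateD.
apply/subsetP => c; rewrite mem_translate => Hc.
pose B' : {set G} := [set c - x | x in B].
have cB' : #|B'| = #|B| by rewrite card_imset // => x y /addrI /oppr_inj.
have sB' : B' \subset a +: H.
  apply/subsetP => _ /imsetP [x Bx ->]; have := subsetP sB x Bx.
  rewrite !mem_translate => Hx; have Hcx := grpB gH Hc Hx.
  by zmem_from Hcx.
have : A :&: B' != set0.
  apply/negP => /eqP AB0; have := cardsUI A B'; rewrite AB0 cards0 addn0 cB'.
  have : (#|A :|: B'| <= #|a +: H|)%N by rewrite subset_leq_card // subUset sA.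
  by rewrite card_translate; lia.
case/set0Pn => x /setIP [Ax /imsetP [y By xE]].
by rewrite -(subrK y c) -xE mem_sumset.
Qed.

End Sumsets.

HB.instance Definition _ (G : finZmodType) :=
  Monoid.isComLaw.Build {set G} [set 0] (@sumset G)
    (@sumsetA G) (@sumsetC G) (@sum0set G).

(** * Kneser's theorem *)

Section Kneser.
Variable G : finZmodType.
Implicit Types (A B C H K : {set G}) (x y a b : G).

(* Each fibre of the sum map on X x Y embeds in H :&: K. *)
Lemma leq_card_sumset_grp H K (X Y : {set G}) :
    subgrp H -> subgrp K -> X \subset H -> Y \subset K ->
  (#|X| * #|Y| <= #|H :&: K| * #|X :+: Y|)%N.
Proof.
move=> gH gK /subsetP sX /subsetP sY.
pose r c := odflt (0, 0) [pick p : G * G | [&& p.1 \in X, p.2 \in Y & p.1 + p.2 == c]].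
have rP x y : x \in X -> y \in Y ->
    [/\ (r (x + y)).1 \in X, (r (x + y)).2 \in Y & (r (x + y)).1 + (r (x + y)).2 = x + y].
  rewrite /r => Xx Yy; case: pickP => [p /and3P [-> -> /eqP]|/(_ (x, y))] //=.
  by rewrite Xx Yy eqxx.
pose phi (p : G * G) := (p.1 - (r (p.1 + p.2)).1, p.1 + p.2).
rewrite -!cardsX -(card_in_imset (f := phi)).
  apply: subset_leq_card; apply/subsetP => _ /imsetP [[x y] /setXP /= [Xx Yy] ->].
  have [X1 Y1 E] := rP x y Xx Yy.
  rewrite inE /= inE mem_sumset // andbT grpB ?sX //=.
  have -> : x - (r (x + y)).1 = (r (x + y)).2 - y.
    by apply/eqP; rewrite subr_eq addrAC eq_sym subr_eq addrC E.
  by rewrite grpB ?sY.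
move=> [x y] [x' y'] _ _ [/= E1 E2].
rewrite E2 in E1; move/addIr: E1 => E1; move: E2; rewrite E1 => /addrI ->.
by [].
Qed.

Lemma card_subset_sub (A B : {set G}) : A \subset B -> #|B :\: A| = (#|B| - #|A|)%N.
Proof. by move=> sAB; rewrite cardsD (setIidPr sAB). Qed.

(* The rows and columns of the grid cut out by the two stabilizers in a coset
   of their sum: H-periodic C1 misses x, K-periodic C2 contains x. *)
Lemma grid_bound (C1 C2 H K : {set G}) x
    (V := [set h in H | x + h \in C2]) (U := [set k in K | x + k \in C1]) :
    subgrp H -> subgrp K -> {in H, forall h a, (h + a \in C1) = (a \in C1)} ->
    {in K, forall h a, (h + a \in C2) = (a \in C2)} ->
  [/\ (#|V| * (#|K| - #|U|) <= #|H :&: K| * #|C2 :\: C1|)%N,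
      ((#|H| - #|V|) * #|U| <= #|H :&: K| * #|C1 :\: C2|)%N,
      U = set0 \/ (#|H :&: K| <= #|U|)%N &
      [/\ (#|V| <= #|H|)%N, (#|U| <= #|K|)%N,
          x \in C2 -> (#|H :&: K| <= #|V|)%N &
          x \notin C1 -> (#|H :&: K| <= #|K| - #|U|)%N]].
Proof.
move=> gH gK HC1 KC2.
have sV : V \subset H by apply/subsetP => h; rewrite inE => /andP [].
have sU : U \subset K by apply/subsetP => h; rewrite inE => /andP [].
split.
- rewrite -(card_subset_sub sU).
  apply: leq_trans (leq_card_sumset_grp gH gK sV (subsetDl _ _)) _.
  rewrite leq_mul2l; apply/orP; right.
  rewrite -(card_translate x) subset_leq_card //; apply/subsetP => z1 /imsetP [z0 /sumsetP [h [k []]]].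
  rewrite !inE => /andP [Hh xh] /andP [xk Kk] -> ->.
  rewrite Kk /= in xk; rewrite addrA; apply/andP; split.
    by rewrite addrAC [x + k + h]addrC HC1.
  by rewrite addrC KC2.
- rewrite -(card_subset_sub sV).
  apply: leq_trans (leq_card_sumset_grp gH gK (subsetDl _ _) sU) _.
  rewrite leq_mul2l; apply/orP; right.
  rewrite -(card_translate x) subset_leq_card //; apply/subsetP => z1 /imsetP [z0 /sumsetP [h [k []]]].
  rewrite !inE => /andP [xh Hh] /andP [Kk xk] -> ->.
  rewrite Hh /= in xh; rewrite addrA; apply/andP; split.
    by rewrite addrC KC2.
  by rewrite addrAC [x + k + h]addrC HC1.
- have [->|/set0Pn [u]] := eqVneq U set0; first by left.
  rewrite inE => /andP [Ku xu]; right.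
  rewrite -(card_translate u) subset_leq_card //; apply/subsetP => _ /imsetP [m /setIP [Hm Km] ->].
  by rewrite inE (grpD gK Ku Km) addrA addrC HC1.
split; [exact: subset_leq_card|exact: subset_leq_card| |].
  move=> xC; apply: subset_leq_card; apply/subsetP => m /setIP [Hm Km].
  by rewrite inE Hm addrC KC2.
move=> xC; rewrite -(card_subset_sub sU); apply: subset_leq_card.
apply/subsetP => m /setIP [Hm Km]; rewrite !inE Km /= andbT.
by rewrite addrC HC1.
Qed.

(** Write h = v + p and k = u + u'. If both conclusions failed, the first product bound with m <= v
    would give u' < p, hence m < p, and the second with m <= u would give p < u'. *)
Lemma grid_arith (m h k v u d1 d2 : nat) :
    (0 < m)%N -> (v * (k - u) <= m * d1)%N -> ((h - v) * u <= m * d2)%N ->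
    (m <= v)%N -> (m <= k - u)%N -> (m <= u)%N -> (v <= h)%N -> (u <= k)%N ->
  (h <= d1 + m)%N \/ (k <= d2 + m)%N.
Proof.
move=> m0 I1 I2 mv mu' mu vh uk.
have [|lt1] := leqP h (d1 + m); first by left.
have [|lt2] := leqP k (d2 + m); first by right.
exfalso; have [p hE] : exists p, h = (v + p)%N by exists (h - v)%N; lia.
have [u' kE] : exists u', k = (u + u')%N by exists (k - u)%N; lia.
subst h k; rewrite !addKn in I1 I2 mu'.
have : (m * (d1 + m) < m * (v + p))%N by rewrite ltn_pmul2l.
have : (m * (d2 + m) < m * (u + u'))%N by rewrite ltn_pmul2l.
rewrite !(mulnDr m d1) !(mulnDr m d2) => J2' J1'.
have J1 : (v * u' + m * m < m * (v + p))%N by lia.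
have J2 : (p * u + m * m < m * (u + u'))%N by lia.
have [u'' u'E] : exists u'', u' = (m + u'')%N by exists (u' - m)%N; lia.
have [lt_p|le_p] := ltnP m p; last nia.
have [p'' pE] : exists p'', p = (m + p'')%N by exists (p - m)%N; lia.
have K1 : (m * u'' <= v * u'')%N by rewrite leq_mul2r mv orbT.
have K2 : (m * p'' <= u * p'')%N by rewrite leq_mul2r mu orbT.
rewrite u'E pE in J1 J2; clear - J1 J2 K1 K2; lia.
Qed.

(** Let m be the order of the intersection of the two stabilizers, which stabilizes the union. A
    violation of the bound would give |C2 \ C1| + m < |stab C1| and |C1 \ C2| + m < |stab C2|; the
    grids through a point of each difference contradict this. *)
Lemma card_stab_setU (C1 C2 : {set G}) k :
    (k <= #|C1| + #|stab C1|)%N -> (k <= #|C2| + #|stab C2|)%N ->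
  (k <= #|C1 :|: C2| + #|stab (C1 :|: C2)|)%N.
Proof.
move=> k1 k2.
have [/setUidPl -> //|/subsetPn [x xC2 xC1]] := boolP (C2 \subset C1).
have [/setUidPr -> //|/subsetPn [y yC1 yC2]] := boolP (C1 \subset C2).
have sM : stab C1 :&: stab C2 \subset stab (C1 :|: C2).
  apply/subsetP => m /setIP [m1 m2]; apply: stabP => a.
  by rewrite !inE !stabD.
have M0 : (0 < #|stab C1 :&: stab C2|)%N.
  by apply/card_gt0P; exists 0; rewrite inE !grp0 ?subgrp_stab.
have := subset_leq_card sM; set m := #|_ :&: _| in M0 *; move=> le_m.
have P C : {in stab C, forall h a, (h + a \in C) = (a \in C)}.
  by move=> h hC a; apply: stabD.
have [V1 V2 V3 [V4 V5 V6 V7]] :=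
  grid_bound x (subgrp_stab C1) (subgrp_stab C2) (P C1) (P C2).
have [W1 W2 W3 [W4 W5 W6 W7]] :=
  grid_bound y (subgrp_stab C2) (subgrp_stab C1) (P C2) (P C1).
have {V6}V6 := V6 xC2; have {V7}V7 := V7 xC1.
have {W6}W6 := W6 yC1; have {W7}W7 := W7 yC2.
rewrite -/m in V1 V2 V3 V6 V7.
rewrite [stab C2 :&: _]setIC -/m in W1 W2 W3 W6 W7.
have U1 : #|C1 :|: C2| = (#|C1| + #|C2 :\: C1|)%N.
  by rewrite -(cardsID C1) setUK setDUl setDv set0U.
have U2 : #|C1 :|: C2| = (#|C2| + #|C1 :\: C2|)%N.
  by rewrite setUC -(cardsID C2) setUK setDUl setDv set0U.
rewrite leqNgt; apply/negP => lt_k.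
(* [V0] and [W0] say that [C1] misses x + stab C2 and [C2] misses y + stab C1; the differences then
   have at least |stab C2| and |stab C1| elements. Otherwise one of the grids is nondegenerate and
   [grid_arith] applies to it. *)
case: V3 W3 => [V0|Vm] [W0|Wm].
- rewrite V0 cards0 subn0 in V1; rewrite W0 cards0 subn0 in W1.
  have : (#|stab C2| * m <= m * #|C2 :\: C1|)%N.
    by apply: leq_trans V1; rewrite mulnC leq_mul2r V6 orbT.
  have : (#|stab C1| * m <= m * #|C1 :\: C2|)%N.
    by apply: leq_trans W1; rewrite mulnC leq_mul2r W6 orbT.
  by rewrite ![(m * _)%N]mulnC !leq_mul2r; lia.
- by case: (@grid_arith m #|stab C2| #|stab C1| _ _ #|C1 :\: C2|
    #|C2 :\: C1| M0 W1 W2 W6 W7 Wm W4 W5); lia.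
- by case: (@grid_arith m #|stab C1| #|stab C2| _ _ #|C2 :\: C1|
    #|C1 :\: C2| M0 V1 V2 V6 V7 Vm V4 V5); lia.
- by case: (@grid_arith m #|stab C1| #|stab C2| _ _ #|C2 :\: C1|
    #|C1 :\: C2| M0 V1 V2 V6 V7 Vm V4 V5); lia.
Qed.

(* An e-transform (A', B') of (A, B) keeps a in A' and b in B', and shrinks B
   unless A is periodic modulo the group generated by B - b. *)
Lemma kneser_local A B a b : a \in A -> b \in B ->
  exists C : {set G}, [/\ a + b \in C, C \subset A :+: B &
    (#|A| + #|B| <= #|C| + #|stab C|)%N].
Proof.
have [k] := ubnP #|B|; elim: k A B => // k IHk A B le_k Aa Bb.
have [/forall_inP trB|/forall_inPn [a' Aa' /subsetPn [x]]] :=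
  boolP [forall a' in A, (a' - b) +: B \subset A].
  exists (A :+: B); split=> //; first exact: mem_sumset.
  rewrite leq_add //; first by rewrite leq_card_sumset //; apply/set0Pn; exists b.
  rewrite -(card_translate (- b) B) subset_leq_card //.
  apply: subset_trans (stab_sumsetl _ _); apply/subsetP => _ /imsetP [y By ->].
  apply: stabP => z Az; apply: (subsetP (trB z Az)).
  by rewrite mem_translate; zmem_from By.
rewrite mem_translate => Bx Ax; have {}Aa' : a' \in A := Aa'.
set e := a' - b in Bx; pose A' := A :|: (e +: B); pose B' := B :&: ((- e) +: A).
have Bb' : b \in B'.
  by rewrite inE Bb mem_translate /e /=; zmem_from Aa'.
have lt_B' : (#|B'| < #|B|)%N.
  apply: proper_card; rewrite properE subsetIl /=; apply/subsetPn.
  exists (x - e); rewrite // inE Bx mem_translate /=.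
  by apply: contra Ax => Axe; zmem_from Axe.
have Aa2 : a \in A' by rewrite inE Aa.
have [|C [abC sC le_C]] := IHk A' B' _ Aa2 Bb'; first lia.
exists C; split=> //.
  apply: subset_trans sC _; rewrite /A' sumsetUl subUset sumsetS ?subsetIl //=.
  apply/subsetP => _ /sumsetP [y [z [yB /setIP [Bz Az] ->]]].
  move: yB Az; rewrite !mem_translate => yB Az.
  have -> : y + z = (z - - e) + (y - e) by zmod.
  exact: mem_sumset.
apply: leq_trans le_C; rewrite /A' /B'.
have -> : #|B :&: ((- e) +: A)| = #|A :&: (e +: B)|.
  rewrite -(card_translate e); apply: eq_card => z.
  rewrite mem_translate !inE !mem_translate andbC.
  by have -> : z - e - - e = z by zmod.
by rewrite cardsUI card_translate.
Qed.

(** By [kneser_local] each point of the sumset lies in a subset satisfying the bound for the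
    saturations A + H and B + H, and by [card_stab_setU] such subsets are closed under union; a
    largest one is therefore the whole sumset. *)
Theorem kneser A B : A != set0 -> B != set0 ->
  (#|A :+: stab (A :+: B)| + #|B :+: stab (A :+: B)| <=
    #|A :+: B| + #|stab (A :+: B)|)%N.
Proof.
move=> A0 B0; set H := stab (A :+: B); set A1 := A :+: H; set B1 := B :+: H.
have gH : subgrp H := subgrp_stab _.
have E : A1 :+: B1 = A :+: B.
  rewrite /A1 /B1 sumsetA [A :+: H :+: B]sumsetC sumsetA -sumsetA (grp_sumset gH).
  by rewrite [B :+: A]sumsetC sumset_stab.
have H0 : H != set0 by apply/set0Pn; exists 0; apply: grp0.
have: A :+: B != set0 by apply: sumset_neq0.
rewrite /H -E.
pose k := (#|A1| + #|B1|)%N.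
have loc c : c \in A1 :+: B1 -> exists C : {set G}, [/\ c \in C, C \subset A1 :+: B1 &
    (k <= #|C| + #|stab C|)%N].
  by case/sumsetP => a [b [Aa Bb ->]]; apply: kneser_local.
move=> /set0Pn [c0 /loc [C0 [_ sC0 le_C0]]].
have [C [[sC le_C] max_C]] := ex_max_nat
  (P := fun C : {set G} => C \subset A1 :+: B1 /\ (k <= #|C| + #|stab C|)%N)
  (f := fun C : {set G} => #|C|) (b := #|A1 :+: B1|)
  (ex_intro _ C0 (conj sC0 le_C0)) (fun C P => subset_leq_card (proj1 P)).
suff <- : C = A1 :+: B1 by [].
apply/eqP; rewrite eqEsubset sC; apply/subsetP => c /loc [C' [cC' sC' le_C']].
have := max_C (C :|: C'); rewrite subUset sC sC' card_stab_setU // => /(_ (conj isT isT)).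
move=> le_U; have /setUidPl sC'C : C :|: C' = C.
  by apply/esym/eqP; rewrite eqEcard subsetUl.
exact: (subsetP sC'C).
Qed.

(* Kemperman-Scherk *)
Lemma uniq_rep_bound A B a b : a \in A -> b \in B ->
    (forall a' b', a' \in A -> b' \in B -> a' + b' = a + b -> a' = a) ->
  (#|A| + #|B| <= #|A :+: B| + 1)%N.
Proof.
move=> Aa Bb uniq_ab.
have A0 : A != set0 by apply/set0Pn; exists a.
have B0 : B != set0 by apply/set0Pn; exists b.
have := kneser A0 B0; set P := stab _.
have gP : subgrp P by exact: subgrp_stab.
have part C c : c \in C -> (#|C| + #|P| <= #|C :+: P| + #|C :&: (c +: P)|)%N.
  move=> Cc; rewrite -(cardsID (c +: P) C) -(cardsID (c +: P) (C :+: P)).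
  have /setIidPr -> : c +: P \subset C :+: P by apply: subset_sumsetl.
  have := subset_leq_card (setSD (c +: P) (subset_sumsetr C (grp0 gP))).
  by rewrite card_translate; lia.
have := part A a Aa; have := part B b Bb.
suff : (#|A :&: (a +: P)| + #|B :&: (b +: P)| <= #|P| + 1)%N by lia.
(* The reflection of the part of [B] in b + P lies in a + P, and it meets [A] at most in [a] because
   a + b has a single representation. *)
pose B' := [set a + b - y | y in B :&: (b +: P)].
have <- : #|B'| = #|B :&: (b +: P)| by rewrite card_imset // => x y /addrI /oppr_inj.
rewrite -cardsUI leq_add //.
  rewrite -(card_translate a P) subset_leq_card // subUset subsetIr /=.
  apply/subsetP => z /imsetP [y /setIP [_]]; rewrite !mem_translate => Py ->.
  by rewrite -(grpN gP); zmem_from Py.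
rewrite -(cards1 a) subset_leq_card //; apply/subsetP => x /setIP [/setIP [Ax _]].
case/imsetP => y /setIP [By _] xE; apply/set1P; apply: (uniq_ab _ _ Ax By).
by rewrite xE subrK.
Qed.

End Kneser.

(** * Sums of families of sets *)

Definition bigsumset (G : finZmodType) (I : Type) (r : seq I) (P : pred I)
  (A : I -> {set G}) : {set G} := \big[@sumset G/[set 0]]_(i <- r | P i) A i.

Notation "\Sum_ ( i | P ) F" :=
  (@bigsumset _ _ (index_enum _) (fun i => P%B) (fun i => F))
  (at level 36, F at level 36, i at level 50).
Notation "\Sum_ ( i : t | P ) F" :=
  (@bigsumset _ _ (index_enum _) (fun i : t => P%B) (fun i : t => F))
  (at level 36, F at level 36, i at level 50).
Notation "\Sum_ i F" := (@bigsumset _ _ (index_enum _) (fun i => true) (fun i => F))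
  (at level 36, F at level 36, i at level 0).
Notation "\Sum_ ( i <- r ) F" := (@bigsumset _ _ r (fun i => true) (fun i => F))
  (at level 36, F at level 36, i, r at level 50).

Section Counting.

(* The element of rank k in the fibre of f over g is sent to the element of
   rank k in the fibre of t over g. *)
Lemma count_injection (I J T : finType) (f : I -> T) (t : J -> T) :
    (forall g, (#|[set i | f i == g]| <= #|[set j | t j == g]|)%N) ->
  exists th : I -> J, injective th /\ forall i, t (th i) = f i.
Proof.
move=> le_ft; have [i0|I0] := pickP (@predT I); last first.
  by exists (fun i => False_rect _ (notF (esym (I0 i)))); split=> i; have := I0 i.
have [j0 _] : exists j0, t j0 == f i0.
  have : (0 < #|[set j | t j == f i0]|)%N.
    by apply: leq_trans (le_ft _); apply/card_gt0P; exists i0; rewrite inE.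
  by case/card_gt0P => j; rewrite inE; exists j.
pose th i := nth j0 (enum [set j | t j == f i]) (index i (enum [set k | f k == f i])).
have lt_th i : (index i (enum [set k | f k == f i]) < size (enum [set j | t j == f i]))%N.
  rewrite -cardE; apply: leq_trans (le_ft _).
  by rewrite cardE index_mem mem_enum inE.
have thP i : t (th i) = f i.
  by have := mem_nth j0 (lt_th i); rewrite mem_enum inE => /eqP.
exists th; split; last exact: thP.
move=> k k' E; have Ef : f k = f k' by rewrite -!thP E.
have lt_k := lt_th k; rewrite Ef in lt_k.
move: E; rewrite /th Ef => /eqP; rewrite nth_uniq ?enum_uniq ?lt_th //.
move=> /eqP Ek; have Ik : k \in enum [set l | f l == f k'] by rewrite mem_enum inE Ef.
have Ik' : k' \in enum [set l | f l == f k'] by rewrite mem_enum inE.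
by rewrite -[LHS](nth_index k Ik) Ek nth_index.
Qed.

Lemma sum_card_fibres (I T : finType) (f : I -> T) :
  (\sum_g #|[set i | f i == g]|)%N = #|I|.
Proof.
rewrite -sum1_card (partition_big f predT) //=; apply: eq_bigr => g _.
by rewrite -sum1_card; apply: eq_bigl => i; rewrite inE.
Qed.

Lemma sum_card_incidence (I T : finType) (A : I -> {set T}) :
  (\sum_i #|A i| = \sum_g #|[set i | g \in A i]|)%N.
Proof.
transitivity (\sum_i \sum_g (g \in A i))%N.
  by apply: eq_bigr => i _; rewrite -sum1_card big_mkcond; apply: eq_bigr => g _; case: ifP.
rewrite exchange_big /=; apply: eq_bigr => g _.
by rewrite -sum1_card [RHS]big_mkcond; apply: eq_bigr => i _; rewrite inE; case: ifP.
Qed.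

(** Labelled copies turn a multiplicity into the cardinal of a fibre, the form that
    [count_injection] handles. *)
Lemma count_family (T : finType) (v : T -> nat) :
  exists (J : finType) (t : J -> T),
    #|J| = (\sum_g v g)%N /\ forall g, #|[set j | t j == g]| = v g.
Proof.
pose J : finType := {g : T & 'I_(v g)}; exists J, (fun j : J => tag j); split.
  by rewrite card_tagged sumnE big_map big_enum /=; apply: eq_bigr => g _; rewrite card_ord.
move=> g; rewrite -[RHS]card_ord.
rewrite -(card_imset _ (f := fun k : 'I_(v g) => Tagged (fun g => 'I_(v g)) k)); last first.
  by move=> k k' /eqP; rewrite eq_Tagged => /eqP.
apply: eq_card => -[h k]; rewrite !inE /=; apply/eqP/imsetP => [E|[k' _ /(congr1 tag)] //].
by subst h; exists k.
Qed.

Lemma exists_bounded_count (T : finType) (v : T -> nat) n : (n <= \sum_g v g)%N ->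
  exists f : 'I_n -> T, forall g, (#|[set i | f i == g]| <= v g)%N.
Proof.
have [J [t [<- tE]]] := count_family v => le_n.
exists (fun i => t (enum_val (widen_ord le_n i))) => g.
rewrite -tE -(card_imset _ (f := fun i => enum_val (widen_ord le_n i))); last first.
  by move=> i j /enum_val_inj /(congr1 val) /= /val_inj.
by apply: subset_leq_card; apply/subsetP => j /imsetP [i]; rewrite !inE => ti ->.
Qed.

End Counting.

Section BigSumsets.
Variables (G : finZmodType) (I : finType).
Implicit Types (A B : I -> {set G}) (P : pred I) (x : G).

Lemma mem_bigsumset_seq (r : seq I) A x : uniq r ->
  x \in \Sum_(i <- r) A i ->
  exists f : I -> G, (forall i, i \in r -> f i \in A i) /\ x = \sum_(i <- r) f i.
Proof.
rewrite /bigsumset; elim: r x => [|i r IHr] x /= => [_|/andP [ir Ur]].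
  by rewrite big_nil => /set1P ->; exists (fun _ => 0); rewrite big_nil.
rewrite big_cons => /sumsetP [a [b [Aa /(IHr b Ur) [f [fA ->]] ->]]].
exists (fun j => if j == i then a else f j); split=> [j|].
  by rewrite inE; case: eqP => [->|_] //= /fA.
rewrite big_cons eqxx; congr (_ + _); apply: eq_big_seq => j jr.
by case: eqP => // ji; rewrite -ji jr in ir.
Qed.

Lemma mem_bigsumset P A x :
  reflect (exists f : I -> G, (forall i, P i -> f i \in A i) /\ x = \sum_(i | P i) f i)
    (x \in \Sum_(i | P i) A i).
Proof.
apply: (iffP idP); last first.
  case=> f [fA ->]; pose K (X : {set G}) y := y \in X.
  rewrite -/(K _ _) /bigsumset; elim/big_ind2: _ => //; first by rewrite /K set11.
  by move=> X y X' y' Xy Xy'; apply: mem_sumset.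
rewrite /bigsumset -big_filter => /mem_bigsumset_seq [|f [fA ->]].
  by rewrite filter_uniq ?index_enum_uniq.
exists f; split=> [i Pi|]; last by rewrite big_filter.
by apply: fA; rewrite mem_filter Pi mem_index_enum.
Qed.

Lemma bigsumset_neq0 P A : (forall i, P i -> A i != set0) -> \Sum_(i | P i) A i != set0.
Proof.
move=> A0; rewrite /bigsumset; apply: (big_ind (fun X : {set G} => X != set0)) => //.
  by apply/set0Pn; exists 0; rewrite set11.
exact: sumset_neq0.
Qed.

Lemma bigsumsetS P A B : (forall i, P i -> A i \subset B i) ->
  \Sum_(i | P i) A i \subset \Sum_(i | P i) B i.
Proof.
move=> sAB; apply/subsetP => x /mem_bigsumset [f [fA ->]]; apply/mem_bigsumset.
by exists f; split=> // i Pi; apply: (subsetP (sAB i Pi)); apply: fA.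
Qed.

Lemma bigsumset_cons i (r : seq I) A :
  \Sum_(j <- i :: r) A j = A i :+: \Sum_(j <- r) A j.
Proof. by rewrite /bigsumset big_cons. Qed.

Lemma bigsumset_seq_neq0 (r : seq I) A :
  (forall i, A i != set0) -> \Sum_(j <- r) A j != set0.
Proof.
move=> A0; rewrite /bigsumset; apply: (big_ind (fun X : {set G} => X != set0)) => //.
  by apply/set0Pn; exists 0; rewrite set11.
exact: sumset_neq0.
Qed.

Lemma bigsumset_kneser_seq (r : seq I) A : (forall i, A i != set0) ->
    stab (\Sum_(i <- r) A i) \subset [set 0] ->
  (\sum_(i <- r) #|A i| < #|\Sum_(i <- r) A i| + size r)%N.
Proof.
move=> A0; elim: r => [|i r IHr]; first by rewrite /bigsumset !big_nil cards1.
rewrite bigsumset_cons big_cons => stX.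
have := kneser (A0 i) (bigsumset_seq_neq0 r A0).
have -> : stab (A i :+: \Sum_(j <- r) A j) = [set 0].
  by apply/eqP; rewrite eqEsubset stX sub1set grp0 ?subgrp_stab.
rewrite cards1 ![_ :+: [set 0]]sumsetC !sum0set [size _]/=.
by have := IHr (subset_trans (stab_sumsetr _ _) stX); clia.
Qed.

End BigSumsets.

(** * Setpartitions *)

Section Families.
Variables (G : finZmodType) (I : finType).
Implicit Types (v : G -> nat) (A M : I -> {set G}) (g h x : G).

(** [occ A g] is the multiplicity of [g] in the sequence obtained by concatenating the sets [A i],
    and [tot A] is the length of that sequence. *)
Definition occ A g : nat := #|[set i | g \in A i]|.
Definition tot A : nat := (\sum_i #|A i|)%N.
Definition upd A i B : I -> {set G} := fun k => if k == i then B else A k.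
Definition rem A i x := upd A i (A i :\ x).
Definition add A i x := upd A i (x |: A i).

(* A i may be viewed as a setpartition of a subsequence of the sequence in
   which g has multiplicity v g. *)
Definition cfg v A : Prop := (forall i, A i != set0) /\ forall g, (occ A g <= v g)%N.

Lemma tot_occ A : tot A = (\sum_g occ A g)%N.
Proof. exact: sum_card_incidence. Qed.

Lemma occE A g : occ A g = (\sum_i (g \in A i))%N.
Proof. by rewrite /occ -sum1_card big_mkcond; apply: eq_bigr => i _; rewrite inE; case: ifP. Qed.

Lemma occ_upd A i B g : (occ (upd A i B) g + (g \in A i) = occ A g + (g \in B))%N.
Proof.
rewrite !occE (bigD1 i) //= [in RHS](bigD1 i) //= {1}/upd eqxx.
rewrite (eq_bigr (fun k => (g \in A k) : nat)); last by move=> k ki; rewrite /upd (negPf ki).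
by rewrite addnC addnCA addnC.
Qed.

Lemma occ_rem A i x g : x \in A i -> (occ (rem A i x) g + (g == x) = occ A g)%N.
Proof.
move=> Ax; have := occ_upd A i (A i :\ x) g; rewrite -/(rem A i x) !inE.
by case: eqP => [->|_] /=; rewrite ?Ax; lia.
Qed.

Lemma occ_add A i x g : x \notin A i -> (occ (add A i x) g = occ A g + (g == x))%N.
Proof.
move=> Ax; have := occ_upd A i (x |: A i) g; rewrite -/(add A i x) !inE.
by case: eqP => [->|_] /=; rewrite ?(negPf Ax); lia.
Qed.

Lemma sum_eq1 x : (\sum_g (g == x))%N = 1%N.
Proof. by rewrite (bigD1 x) //= eqxx big1 // => g /negPf ->. Qed.

Lemma tot_rem A i x : x \in A i -> (tot (rem A i x) + 1 = tot A)%N.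
Proof.
move=> Ax; rewrite !tot_occ -(sum_eq1 x) -big_split /=.
by apply: eq_bigr => g _; apply: occ_rem.
Qed.

Lemma tot_add A i x : x \notin A i -> (tot (add A i x) = tot A + 1)%N.
Proof.
move=> Ax; rewrite !tot_occ -(sum_eq1 x) -big_split /=.
by apply: eq_bigr => g _; apply: occ_add.
Qed.

Lemma updE A i B : upd A i B i = B. Proof. by rewrite /upd eqxx. Qed.
Lemma upd_neq A i B k : k != i -> upd A i B k = A k.
Proof. by rewrite /upd => /negPf ->. Qed.

Lemma mem_add A i x k y : (y \in add A i x k) = (k == i) && (y == x) || (y \in A k).
Proof. by rewrite /add /upd; case: (k =P i) => [->|_]; rewrite ?inE. Qed.

Lemma mem_rem A i x k y : (y \in rem A i x k) = ~~ ((k == i) && (y == x)) && (y \in A k).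
Proof. by rewrite /rem /upd; case: (k =P i) => [->|_]; rewrite ?inE. Qed.

Lemma bigsumsetD1 (P : pred I) A i : P i ->
  \Sum_(k | P k) A k = A i :+: \Sum_(k | P k && (k != i)) A k.
Proof. by move=> Pi; rewrite /bigsumset (bigD1 i). Qed.

Lemma bigsumset_upd A i B : \Sum_k upd A i B k = B :+: \Sum_(k | k != i) A k.
Proof.
rewrite (bigsumsetD1 _ (i := i)) // updE; congr (_ :+: _).
by apply: eq_bigr => k /= ki; rewrite upd_neq.
Qed.

Lemma sub_bigsumset_add A i x : \Sum_k A k \subset \Sum_k add A i x k.
Proof.
apply: bigsumsetS => k _; rewrite /add /upd; case: eqP => [->|_] //.
exact: subsetUr.
Qed.

Lemma cfg_add v A i x :
    (forall i, A i != set0) -> (forall g, (occ (add A i x) g <= v g)%N) ->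
  cfg v (add A i x).
Proof.
move=> A0 le_v; split=> // k; rewrite /add /upd; case: (k =P i) => _; last exact: A0.
by apply/set0Pn; exists x; rewrite setU11.
Qed.

Lemma rem_neq0 A i x : (forall i, A i != set0) -> A i :\ x != set0 ->
  forall k, rem A i x k != set0.
Proof. by move=> A0 Ai k; rewrite /rem /upd; case: (k =P i). Qed.

Lemma cfg_move v A i j x : cfg v A -> x \in A i -> x \notin rem A i x j ->
  A i :\ x != set0 -> cfg v (add (rem A i x) j x) /\ tot (add (rem A i x) j x) = tot A.
Proof.
move=> [A0 le_v] Ax Ax' Ai; split; last by rewrite tot_add // tot_rem.
apply: cfg_add; first exact: rem_neq0.
by move=> g; rewrite occ_add // occ_rem.
Qed.

(* If A j is contained in A i and misses x, every sum through x in A i survives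
   the move of x to A j. *)
Lemma sub_bigsumset_nested A i j x : i != j -> x \in A i -> A j \subset A i -> x \notin A j ->
  \Sum_k A k \subset \Sum_k add (rem A i x) j x k.
Proof.
move=> ij Ax sA xA; apply/subsetP => _ /mem_bigsumset [f [fA ->]].
apply/mem_bigsumset.
have ji : j != i by rewrite eq_sym.
have [fx|fx] := eqVneq (f i) x; last first.
  exists f; split=> // k _; rewrite mem_add mem_rem fA // andbT.
  by case: (k =P i) => [->|_]; rewrite ?(negPf fx) orbT.
exists (fun k => if k == i then f j else if k == j then x else f k); split.
  move=> k _; rewrite mem_add mem_rem; case: (eqVneq k i) => [->|ki] /=.
    rewrite (negPf ij) (subsetP sA _ (fA j isT)) andbT /=.
    by apply: contra xA => /eqP <-; apply: fA.
  by case: eqP => [_|_] /=; rewrite ?eqxx ?fA ?orbT.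
rewrite (bigD1 i) //= (bigD1 j) //= [RHS](bigD1 i) //= [in RHS](bigD1 j) //=.
rewrite !eqxx (negPf ji) fx addrCA; congr (_ + (_ + _)).
by apply: eq_bigr => k /andP [/negPf -> /negPf ->].
Qed.

Lemma removable_rem A i x : (A i :\ x) :+: \Sum_(k | k != i) A k = \Sum_k A k ->
  \Sum_k rem A i x k = \Sum_k A k.
Proof. by rewrite /rem bigsumset_upd. Qed.

End Families.

Section Partition.
Variables (G : finZmodType) (n : nat).
Implicit Types (v : G -> nat) (A M : 'I_n -> {set G}) (g h x : G).

Definition mult (I : finType) (T : eqType) (f : I -> T) (g : T) : nat := #|[set i | f i == g]|.

Definition sums v : {set G} :=
  [set x | [exists f : {ffun 'I_n -> G},
     [forall g, (mult f g <= v g)%N] && (x == \sum_i f i)]].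

Lemma sumsP v x : reflect
  (exists f : 'I_n -> G, (forall g, (mult f g <= v g)%N) /\ x = \sum_i f i) (x \in sums v).
Proof.
rewrite inE; apply: (iffP existsP) => [[f /andP [/forallP fv /eqP ->]]|[f [fv ->]]].
  by exists f.
exists (finfun f); apply/andP; split.
  apply/forallP => g; apply: leq_trans (fv g); rewrite leq_eqVlt; apply/orP; left.
  by apply/eqP; apply: eq_card => i; rewrite !inE ffunE.
by apply/eqP; apply: eq_bigr => i _; rewrite ffunE.
Qed.

Lemma cfg_sub_sums v A : cfg v A -> \Sum_i A i \subset sums v.
Proof.
move=> [A0 le_v]; apply/subsetP => _ /mem_bigsumset [f [fA ->]]; apply/sumsP.
exists f; split=> // g; apply: leq_trans (le_v g); apply: subset_leq_card.
by apply/subsetP => i; rewrite !inE => /eqP <-; apply: fA.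
Qed.

(* Minimality of an overfull J forces, via Kemperman-Scherk, each single
   element of each A j, j in J, to be superfluous. *)
Lemma overfull_removable A : (forall i, A i != set0) ->
    (#|\Sum_i A i| + n <= tot A)%N ->
  exists J : {set 'I_n}, J != set0 /\ forall j x, j \in J -> x \in A j ->
    A j :\ x != set0 /\ \Sum_k rem A j x k = \Sum_k A k.
Proof.
move=> A0 over.
pose ov (J : {set 'I_n}) := (#|\Sum_(k | k \in J) A k| + #|J| <= \sum_(k in J) #|A k|)%N.
have [|J [ovJ minJ]] := @ex_min_nat {set 'I_n} ov (fun J => #|J|).
  exists setT; rewrite /ov cardsT card_ord.
  have -> : \Sum_(k | k \in setT) A k = \Sum_k A k by apply: eq_bigl => k; rewrite inE.
  by rewrite (eq_bigl xpredT (fun k => #|A k|)) => [|k]; [exact: over|rewrite inE].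
exists J; split.
  (* The empty family is not overfull: its sum is {0}, of cardinal 1. *)
  apply/eqP => J0; move: ovJ; rewrite /ov J0 cards0 addn0 /bigsumset !big_pred0 ?cards1 //;
    by move=> i; rewrite inE.
move=> j x Jj Ax.
pose B := \Sum_(k | k \in J :\ j) A k.
have JE : \Sum_(k | k \in J) A k = A j :+: B.
  rewrite (bigsumsetD1 _ (i := j)) //; congr (_ :+: _).
  by apply: eq_bigl => k; rewrite !inE andbC.
have B0 : B != set0 by apply: bigsumset_neq0.
have remB : (A j :\ x) :+: B = A j :+: B.
  apply/eqP; rewrite eqEsubset sumsetSl ?subD1set //=; apply/subsetP => c cAB.
  (* If [c] is lost with [x], all its representations go through [x]; Kemperman-Scherk then bounds
     |A j| + |B|, and [J] without [j] would still be overfull. *)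
  apply/negPn/negP => c_no.
  have only a b : a \in A j -> b \in B -> a + b = c -> a = x.
    move=> Aa Bb E; apply/eqP/negPn/negP => ax; case/negP: c_no.
    by rewrite -E mem_sumset // !inE ax.
  case/sumsetP: cAB => a [b [Aa Bb cE]].
  have ax := only a b Aa Bb (esym cE); rewrite ax in cE Aa.
  have bound : (#|A j| + #|B| <= #|A j :+: B| + 1)%N.
    by apply: (uniq_rep_bound Aa Bb) => a' b' Aa' Bb' E; apply: (only a' b') => //; rewrite E -cE.
  have := minJ (J :\ j); rewrite /ov -/B (cardsD1 j J) Jj.
  suff ovB : (#|B| + #|J :\ j| <= \sum_(k in J :\ j) #|A k|)%N by move=> /(_ ovB); lia.
  move: ovJ; rewrite /ov JE (cardsD1 j J) Jj (bigD1 j) //=.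
  have -> : (\sum_(k in J | k != j) #|A k| = \sum_(k in J :\ j) #|A k|)%N.
    by apply: eq_bigl => k; rewrite !inE andbC.
  by move: bound; clear; move: (\sum_(k in _) _)%N => s; clia.
split.
  apply: contra_neq (sumset_neq0 (A0 j) B0) => E; by rewrite -remB E sum0set_eq0.
apply: removable_rem.
rewrite [RHS](bigsumsetD1 _ (i := j)) //.
have -> : \Sum_(k | k != j) A k = B :+: \Sum_(k | k \notin J) A k.
  rewrite /bigsumset (bigID [in J]) /=; congr (_ :+: _); apply: eq_bigl => k; rewrite ?inE //.
  by case: eqP => [->|_] //; rewrite Jj.
by rewrite !sumsetA remB.
Qed.

End Partition.

(** * Completeness of a setpartition with maximal sum *)

Section Completeness.
Variables (G : finZmodType) (n : nat) (v : G -> nat) (l : nat) (Sg : {set G}).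
Implicit Types (A M : 'I_n -> {set G}) (g h x : G).

Hypothesis maxS : forall A, cfg v A -> tot A = l -> (#|\Sum_k A k| <= #|Sg|)%N.
Hypothesis over : (#|Sg| + n <= l)%N.

Let Cl A := [/\ cfg v A, tot A = l & Sg \subset \Sum_k A k].

Let Cl_sum A : Cl A -> \Sum_k A k = Sg.
Proof. by case=> cA tA sA; apply/esym/eqP; rewrite eqEcard sA maxS. Qed.

Let Cl_move A i j x : Cl A -> x \in A i -> x \notin rem A i x j -> A i :\ x != set0 ->
  \Sum_k rem A i x k = \Sum_k A k -> Cl (add (rem A i x) j x).
Proof.
case=> cA tA sA Ax Ax' Ai E; have [cA' tA'] := cfg_move cA Ax Ax' Ai.
by split; rewrite ?tA' // (subset_trans sA) // -E sub_bigsumset_add.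
Qed.

Let Cl_nested A i j x : Cl A -> i != j -> x \in A i -> A j \subset A i -> x \notin A j ->
  A i :\ x != set0 -> Cl (add (rem A i x) j x).
Proof.
case=> cA tA sA ij Ax sAj xAj Ai.
have Ax' : x \notin rem A i x j by rewrite mem_rem eq_sym (negPf ij).
have [cA' tA'] := cfg_move cA Ax Ax' Ai.
by split; rewrite ?tA' // (subset_trans sA) // sub_bigsumset_nested.
Qed.

Let Cl_removable A : Cl A -> exists J : {set 'I_n}, J != set0 /\ forall j x, j \in J ->
  x \in A j -> A j :\ x != set0 /\ \Sum_k rem A j x k = \Sum_k A k.
Proof.
by move=> cA; case: (cA) => -[A0 _] tA _; apply: overfull_removable; rewrite // (Cl_sum cA) tA.
Qed.

Variable f : 'I_n -> G.
Hypothesis f_le : forall g, (mult f g <= v g)%N.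

(* M matches the terms of f with distinct sets A k containing them. *)
Let mv A M := [/\ forall k, M k \subset A k, forall k, (#|M k| <= 1)%N &
  forall g, (occ M g <= mult f g)%N].

Let mv_add A M i x : mv A M -> mv (add A i x) M.
Proof.
case=> sM M1 Mf; split=> // k; apply: subset_trans (sM k) _.
by apply/subsetP => y Ay; rewrite mem_add Ay orbT.
Qed.

Let mv_rem A M i x : mv A M -> x \notin M i -> mv (rem A i x) M.
Proof.
case=> sM M1 Mf xM; split=> // k; apply/subsetP => y My; rewrite mem_rem (subsetP (sM k)) //.
by rewrite andbT; apply: contra xM => /andP [/eqP <- /eqP <-].
Qed.

Let mv_extend A M k g : mv A M -> M k = set0 -> g \in A k -> (occ M g < mult f g)%N ->
  mv A (add M k g) /\ tot (add M k g) = (tot M + 1)%N.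
Proof.
case=> sM M1 Mf Mk Ag lt_g; have gM : g \notin M k by rewrite Mk inE.
split; last exact: tot_add.
split=> [i|i|h].
- apply/subsetP => y; rewrite mem_add => /orP [/andP [/eqP -> /eqP ->] //|].
  exact: subsetP (sM i) y.
- by rewrite /add /upd; case: (i =P k) => // _; rewrite Mk setU0 cards1.
- by rewrite occ_add //; case: eqP => [->|_]; rewrite ?addn1 ?addn0.
Qed.

Let mv_tot A M : mv A M -> (tot M <= n)%N.
Proof.
by case=> _ M1 _; rewrite -[X in (_ <= X)%N]card_ord -sum1_card; apply: leq_sum => k _.
Qed.

Let sum_mult : (\sum_g mult f g = n)%N.
Proof. by rewrite /mult sum_card_fibres card_ord. Qed.

Let mv_total A M : mv A M -> tot M = n -> \sum_i f i \in \Sum_i A i.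
Proof.
case=> sM M1 Mf tM.
have card1 k : #|M k| = 1%N.
  apply/eqP; rewrite eqn_leq M1 /= lt0n; apply/negP => /eqP Mk.
  have : (tot M < n)%N.
    rewrite /tot (bigD1 k) //= Mk add0n.
    apply: (@leq_ltn_trans (\sum_(i | i != k) 1)); first by apply: leq_sum.
    by rewrite sum1_card cardC1 card_ord prednK // (leq_ltn_trans _ (ltn_ord k)).
  by rewrite tM ltnn.
have M_f k : exists y, M k == [set y] by have /cards1P [y ->] := introT eqP (card1 k); exists y.
pose m k := xchoose (M_f k); have mE k : M k = [set m k] by apply/eqP; exact: (xchooseP (M_f k)).
have [th [inj_th thE]] : exists th : 'I_n -> 'I_n, injective th /\ forall i, f (th i) = m i.
  apply: count_injection => g; apply: leq_trans (Mf g); apply: subset_leq_card.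
  by apply/subsetP => i; rewrite !inE => /eqP <-; rewrite mE set11.
apply/mem_bigsumset; exists m; split=> [i _|].
  by apply: (subsetP (sM i)); rewrite mE set11.
rewrite (reindex_inj inj_th) /=; exact: eq_bigr.
Qed.

Lemma sum_mem_max : (exists A, cfg v A /\ tot A = l /\ \Sum_k A k = Sg) -> \sum_i f i \in Sg.
Proof.
case=> A0 [cA0 [tA0 sA0]].
pose st (AM : ('I_n -> {set G}) * ('I_n -> {set G})) := Cl AM.1 /\ mv AM.1 AM.2.
have [|[A M] /=|[A1 M1] [/= [cA1 mA1] maxp]] := @ex_max_nat _ st (fun AM => tot AM.2) n.
- exists (A0, fun _ => set0); split; first by split; rewrite //= sA0.
  split=> /= [k|k|g]; rewrite ?sub0set ?cards0 //.
  by rewrite /occ (eq_card0 (A := mem [set _ | _])) // => i; rewrite !inE.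
- by case=> _; apply: mv_tot.
rewrite /fst /snd in cA1 mA1 maxp.
have {}maxp A M : Cl A -> mv A M -> (tot M <= tot M1)%N.
  by move=> cA mA; apply: (maxp (A, M)).
have [eq_n|neq_n] := eqVneq (tot M1) n.
  by rewrite -(Cl_sum cA1); apply: mv_total mA1 eq_n.
exfalso.
have noext A M k g : Cl A -> mv A M -> tot M = tot M1 -> M k = set0 ->
    (occ M g < mult f g)%N -> g \notin A k.
  move=> cA mA tM Mk lt_g; apply/negP => Ag.
  have [mA' tM'] := mv_extend mA Mk Ag lt_g.
  by have := maxp _ _ cA mA'; rewrite tM' tM addn1 ltnn.
have ex_free A M : mv A M -> tot M = tot M1 -> exists k, M k = set0.
  move=> mA tM; have lt_n : (tot M < n)%N by rewrite ltn_neqAle tM neq_n -tM (mv_tot mA).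
  case: (pickP (fun k => M k == set0)) => [k /eqP|no_k]; first by exists k.
  move: lt_n; rewrite /tot ltnNge; case/negP.
  rewrite -[X in (X <= _)%N]card_ord -sum1_card; apply: leq_sum => k _.
  by rewrite card_gt0 no_k.
have moveJ A M (J : {set 'I_n}) j x k : Cl A -> mv A M -> (forall j x, j \in J ->
    x \in A j -> A j :\ x != set0 /\ \Sum_k rem A j x k = \Sum_k A k) ->
    j \in J -> x \in A j -> x \notin M j -> x \notin A k ->
    Cl (add (rem A j x) k x) /\ mv (add (rem A j x) k x) M.
  move=> cA mA remJ Jj Ax xM xk; have [Aj E] := remJ j x Jj Ax.
  split; last by apply: mv_add; apply: mv_rem.
  by apply: Cl_move => //; rewrite mem_rem (negPf xk) andbF.
have [g lt_g] : exists g, (occ M1 g < mult f g)%N.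
  case: (pickP (fun g => (occ M1 g < mult f g)%N)) => [g ?|no_g]; first by exists g.
  have : (tot M1 < n)%N by rewrite ltn_neqAle neq_n (mv_tot mA1).
  rewrite tot_occ ltnNge; case/negP; apply: leq_trans (_ : \sum_g mult f g <= _)%N.
    by rewrite sum_mult.
  by apply: leq_sum => g _; rewrite leqNgt no_g.
pose bad (q : ('I_n -> {set G}) * ('I_n -> {set G}) * 'I_n * G) :=
  let: (A, M, i, g) := q in
  [/\ Cl A, mv A M, tot M = tot M1 & [/\ (occ M g < mult f g)%N, g \in A i & g \notin M i]].
have bad_nonempty A M i g' : bad (A, M, i, g') -> exists s, [/\ s \in M i, s \in A i & s != g'].
  case=> cA mA tM [lt Ag gM]; have [/eqP M0|/set0Pn [s Ms]] := boolP (M i == set0).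
    by have := noext _ _ _ _ cA mA tM M0 lt; rewrite Ag.
  exists s; split=> //; last by apply: contraNneq gM => <-.
  by case: mA => sM _ _; apply: (subsetP (sM i)).
have ex_bad : exists q, bad q.
  have [J [/set0Pn [j Jj] remJ]] := Cl_removable cA1.
  have [k Mk] := ex_free _ _ mA1 (erefl _).
  have gk := noext _ _ _ _ cA1 mA1 (erefl _) Mk lt_g.
  have [lt_v|ge_v] := ltnP (occ A1 g) (v g); last first.
    have lt_occ : (occ M1 g < occ A1 g)%N.
      by apply: leq_trans lt_g _; apply: leq_trans (f_le g) _.
    case: (pickP (fun i => (g \in A1 i) && (g \notin M1 i))) => [i /andP [gA gM]|no_i].
      by exists (A1, M1, i, g).
    suff sub : [set i | g \in A1 i] \subset [set i | g \in M1 i].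
      by have := subset_leq_card sub; rewrite leqNgt -/(occ A1 g) lt_occ.
    apply/subsetP => i; rewrite !inE => gA; apply/negPn/negP => gM.
    by have := no_i i; rewrite gA gM.
  exfalso; have [[A1_0 le_v] tA1 sA1] := cA1.
  have [x [Ax xM]] : exists x, x \in A1 j /\ x \notin M1 j.
    have /set0Pn [x0 Ax0] := A1_0 j.
    have [xM|xM] := boolP (x0 \in M1 j); last by exists x0.
    have [/set0Pn [x]] := remJ j x0 Jj Ax0; rewrite !inE => /andP [xx0 Ax] _.
    exists x; split=> //; case: (mA1) => _ M11 _; apply/negP => xM'.
    have := M11 j; rewrite (cardsD1 x0) xM (cardsD1 x) !inE xx0 xM'; lia.
  have [Aj E] := remJ j x Jj Ax.
  have gk' : g \notin rem A1 j x k by rewrite mem_rem (negPf gk) andbF.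
  have cA' : Cl (add (rem A1 j x) k g).
    split; last by rewrite (subset_trans sA1) // -E sub_bigsumset_add.
      apply: cfg_add; first exact: rem_neq0.
      move=> h; rewrite occ_add //.
      have le_h : (occ (rem A1 j x) h <= occ A1 h)%N by rewrite -(occ_rem h Ax) leq_addr.
      case: (h =P g) le_h => [-> le_h|_ le_h].
        by rewrite addn1 (leq_ltn_trans le_h).
      by rewrite addn0 (leq_trans le_h).
    by rewrite tot_add // tot_rem.
  have mA' : mv (add (rem A1 j x) k g) M1 by apply: mv_add; apply: mv_rem.
  by have := noext _ _ _ _ cA' mA' (erefl _) Mk lt_g; rewrite mem_add !eqxx.
(* With [A i] as large as possible, no unmatched element of a set indexed by [J] can be new to
   [A i]; this is [claim4]. *)
have [|[[[A M] i] g'] [bad_q max_q]] := @ex_max_nat _ bad (fun q => #|q.1.1.1 q.1.2|) #|G| ex_bad.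
  by move=> q _; apply: max_card.
move: {g lt_g} g' bad_q max_q => g bad_q max_q.
have max_i A' M' : bad (A', M', i, g) -> (#|A' i| <= #|A i|)%N.
  by move=> b; apply: (max_q (A', M', i, g)).
case: (bad_q) => cA mA tM [lt_g gi gMi].
have [s [Ms As sg]] := bad_nonempty _ _ _ _ bad_q.
have [J [/set0Pn [j Jj] remJ]] := Cl_removable cA.
have claim5 M' j' : bad (A, M', i, g) -> j' \in J -> g \in A j' -> g \in M' j'.
  case=> _ mA' tM' [lt_g' _ _] Jj' gj'; apply/negPn/negP => gM'.
  have [k Mk] := ex_free _ _ mA' tM'.
  have gk := noext _ _ _ _ cA mA' tM' Mk lt_g'.
  have [cA2 mA2] := moveJ _ _ _ _ _ _ cA mA' remJ Jj' gj' gM' gk.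
  by have := noext _ _ _ _ cA2 mA2 tM' Mk lt_g'; rewrite mem_add !eqxx.
have claim3 M' : bad (A, M', i, g) -> i \notin J.
  move=> b; apply/negP => Ji; have [_ _ _ [_ _]] := b.
  by rewrite (claim5 _ _ b Ji gi).
have iJ := claim3 M bad_q.
have ij : i != j by apply: contraNneq iJ => ->.
have ji : j != i by rewrite eq_sym.
have claim4 M' x : bad (A, M', i, g) -> x \in A j -> x \notin M' j -> x \in A i.
  move=> b Ax xM; apply/negPn/negP => xi; have [_ mA' tM' [lt_g' _ gMi']] := b.
  have [cA2 mA2] := moveJ _ _ _ _ _ _ cA mA' remJ Jj Ax xM xi.
  have xi' : x \notin rem A j x i by rewrite mem_rem (negPf xi) andbF.
  have b2 : bad (add (rem A j x) i x, M', i, g).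
    by split=> //; split=> //; rewrite mem_add mem_rem gi (negPf ij) orbT.
  have := max_i _ _ b2.
  by rewrite /add updE cardsU1 xi' /rem upd_neq // ltnn.
(* When [A' j] is free and contained in [A' i], the element [g] can move from [A' i] to [A' j]
   without loss of sums and be matched there. *)
have finish A' M' : Cl A' -> mv A' M' -> tot M' = tot M1 -> (occ M' g < mult f g)%N ->
    g \in A' i -> g \notin M' i -> A' i :\ g != set0 -> M' j = set0 -> A' j \subset A' i ->
    g \notin A' j -> False.
  move=> cA' mA' tM' lt_g' gi' gM' Ai' Mj sA' gj'.
  have cA2 := Cl_nested cA' ij gi' sA' gj' Ai'.
  have mA2 : mv (add (rem A' i g) j g) M' by apply: mv_add; apply: mv_rem.
  by have := noext _ _ _ _ cA2 mA2 tM' Mj lt_g'; rewrite mem_add !eqxx.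
have Ai : A i :\ g != set0 by apply/set0Pn; exists s; rewrite !inE sg.
have caseNone M' : bad (A, M', i, g) -> M' j = set0 -> False.
  move=> b Mj; have [_ mA' tM' [lt_g' _ gMi']] := b.
  apply: (finish A M') => //.
    by apply/subsetP => x Ax; apply: (claim4 _ _ b Ax); rewrite Mj inE.
  by apply/negP => /(claim5 _ _ b Jj); rewrite Mj inE.
have [/eqP Mj|/set0Pn [h Mh]] := boolP (M j == set0); first exact: caseNone bad_q Mj.
have [k Mk] := ex_free _ _ mA tM.
have hk0 : h \notin rem M j h k by rewrite mem_rem Mk inE andbF.
case: (mA) => sM M_1 Mf.
have Ah : h \in A j by apply: (subsetP (sM j)).
have Mj1 : M j = [set h].
  by apply/eqP; rewrite eq_sym eqEcard sub1set Mh cards1 M_1.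
have kj : k != j by apply: contraTneq Mh => <-; rewrite Mk inE.
have ki : k != i by apply: contraTneq Ms => <-; rewrite Mk inE.
(* To free [A j], its matched element [h] is rematched in the free set [A k], after being moved
   there if [A k] does not contain it. *)
pose M2 := add (rem M j h) k h.
have tM2 : tot M2 = tot M1 by rewrite tot_add // tot_rem.
have occM2 y : occ M2 y = occ M y by rewrite occ_add // occ_rem.
have M2k : M2 k = [set h] by rewrite /M2 /add updE /rem upd_neq // Mk setU0.
have M2j : M2 j = set0 by rewrite /M2 /add upd_neq 1?eq_sym // /rem updE Mj1 setDv.
have M2x c : c != k -> c != j -> M2 c = M c.
  by move=> ck cj; rewrite /M2 /add upd_neq // /rem upd_neq.
have mv2 A' : (forall c, c != k -> c != j -> A c \subset A' c) -> h \in A' k -> mv A' M2.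
  move=> sA' hk; split=> [c|c|y]; last by rewrite occM2.
    have [->|ck] := eqVneq c k; first by rewrite M2k sub1set.
    have [->|cj] := eqVneq c j; first by rewrite M2j sub0set.
    by rewrite M2x // (subset_trans (sM c)) ?sA'.
  have [->|ck] := eqVneq c k; first by rewrite M2k cards1.
  have [->|cj] := eqVneq c j; first by rewrite M2j cards0.
  by rewrite M2x.
have gM2 : g \notin M2 i by rewrite M2x // eq_sym.
have [hk|hk] := boolP (h \in A k).
  apply: (caseNone M2) => //; split=> //; first exact: mv2.
  by split; rewrite ?occM2.
have [Aj E] := remJ j h Jj Ah.
have cA2 : Cl (add (rem A j h) k h) by apply: Cl_move; rewrite // mem_rem (negPf hk) andbF.
have A2i : add (rem A j h) k h i = A i by rewrite /add upd_neq 1?eq_sym // /rem upd_neq.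
have A2j : add (rem A j h) k h j = A j :\ h by rewrite /add upd_neq 1?eq_sym // /rem updE.
apply: (finish _ M2 cA2) => //; rewrite ?A2i ?A2j ?occM2 //.
- apply: mv2; last by rewrite mem_add !eqxx.
  by move=> c ck cj; rewrite /add upd_neq // /rem upd_neq.
- apply/subsetP => x; rewrite !inE => /andP [xh Ax]; apply: (claim4 _ _ bad_q Ax).
  by rewrite Mj1 inE.
- rewrite !inE; apply/negP => /andP [gh gj]; have := claim5 _ _ bad_q Jj gj.
  by rewrite Mj1 inE (negPf gh).
Qed.

End Completeness.

Theorem partition_theorem (G : finZmodType) (n l : nat) (v : G -> nat) :
    (exists A : 'I_n -> {set G}, cfg v A /\ tot A = l) ->
  exists A : 'I_n -> {set G}, [/\ cfg v A, tot A = l &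
    (l < #|\Sum_k A k| + n)%N \/ \Sum_k A k = sums n v].
Proof.
move=> exA.
have [|A [[cA tA] maxA]] := @ex_max_nat _ _ (fun A : 'I_n -> {set G} => #|\Sum_k A k|) #|G| exA.
  by move=> A _; apply: max_card.
exists A; split=> //; have [lt_l|over] := ltnP l (#|\Sum_k A k| + n); first by left.
right; apply/eqP; rewrite eqEsubset cfg_sub_sums //=; apply/subsetP => _ /sumsP [f [f_le ->]].
apply: (sum_mem_max (v := v) (l := l)) => //; first by move=> A' cA' tA'; apply: maxA.
by exists A.
Qed.

(** * Sums of aperiodic sequences *)

Section Extension.
Variables (G : finZmodType) (n : nat).
Implicit Types (v : G -> nat) (A : 'I_n -> {set G}).

Lemma family_extend v A l :
    (forall g, (occ A g <= v g)%N) -> (tot A <= l)%N -> (l <= \sum_g minn n (v g))%N ->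
  exists A' : 'I_n -> {set G}, [/\ forall i, A i \subset A' i,
    forall g, (occ A' g <= v g)%N & tot A' = l].
Proof.
have [k] := ubnP (l - tot A)%N; elim: k A => // k IHk A le_k le_v le_l l_le.
have [tA|neq_l] := eqVneq (tot A) l; first by exists A.
have [g lt_g] : exists g, (occ A g < minn n (v g))%N.
  case: (pickP (fun g => (occ A g < minn n (v g))%N)) => [g|no_g]; first by exists g.
  have : (\sum_g minn n (v g) <= tot A)%N.
    by rewrite tot_occ; apply: leq_sum => g _; rewrite leqNgt no_g.
  by move: le_l neq_l l_le; rewrite leq_eqVlt => /orP [-> //|]; lia.
have [i gi] : exists i, g \notin A i.
  case: (pickP (fun i => g \notin A i)) => [i|all_g]; first by exists i.
  have : (n <= occ A g)%N.
    rewrite -[X in (X <= _)%N]card_ord -cardsT; apply: subset_leq_card.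
    by apply/subsetP => i _; rewrite inE; have := all_g i => /negbFE.
  by move: lt_g; lia.
have [||||A' [sA' le_v' tA']] := IHk (add A i g); rewrite ?tot_add //.
- by move: le_l neq_l le_k; rewrite leq_eqVlt => /orP [-> //|]; lia.
- by move=> h; rewrite occ_add //; case: eqP => [->|_]; have := le_v h; move: lt_g; lia.
- by move: le_l neq_l; rewrite leq_eqVlt => /orP [-> //|]; lia.
exists A'; split=> // j; apply: subset_trans (sA' j).
by apply/subsetP => y Ay; rewrite mem_add Ay orbT.
Qed.

Lemma cfg_exists v l : (n <= l)%N -> (l <= \sum_g minn n (v g))%N ->
  exists A : 'I_n -> {set G}, cfg v A /\ tot A = l.
Proof.
move=> le_n le_l.
have [f f_le] : exists f : 'I_n -> G, forall g, (#|[set i | f i == g]| <= v g)%N.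
  apply: exists_bounded_count; apply: leq_trans le_n (leq_trans le_l _).
  by apply: leq_sum => g _; apply: geq_minr.
have [g||A [sA le_v tA]] := @family_extend v (fun i => [set f i]) l _ _ le_l.
- apply: leq_trans (f_le g); apply: subset_leq_card; apply/subsetP => i.
  by rewrite !inE eq_sym.
- by rewrite /tot (eq_bigr (fun=> 1%N)) ?sum1_card ?card_ord // => i _; rewrite cards1.
exists A; do 2!split=> //; move=> i; apply/set0Pn; exists (f i).
by rewrite (subsetP (sA i)) ?set11.
Qed.

Lemma sums_neq0 v : (n <= \sum_g v g)%N -> sums n v != set0.
Proof.
move=> /exists_bounded_count [f f_le]; apply/set0Pn; exists (\sum_i f i).
by apply/sumsP; exists f.
Qed.

Lemma min_sum_ge v : (n <= \sum_g v g)%N -> (n <= \sum_g minn n (v g))%N.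
Proof.
move=> le_n; have [/forall_inP all_le|/forall_inPn [g _ lt_g]] :=
  boolP [forall g in predT, (v g <= n)%N].
  by rewrite (eq_bigr v) // => g _; apply/minn_idPr; apply: all_le.
rewrite (bigD1 g) //=; have : (n <= v g)%N by rewrite ltnW // ltnNge.
by move=> /minn_idPl ->; apply: leq_addr.
Qed.

(* DeVos-Goddyn-Mohar for sequences, aperiodic case *)
Lemma card_sums_aperiodic v : (n <= \sum_g v g)%N -> stab (sums n v) \subset [set 0] ->
  (\sum_g minn n (v g) < #|sums n v| + n)%N.
Proof.
move=> le_n ap.
have [A [[A0 le_v] tA [//|E]]] := partition_theorem (cfg_exists (min_sum_ge le_n) (leqnn _)).
  by move=> lt; apply: leq_trans lt _; rewrite leq_add2r subset_leq_card // cfg_sub_sums.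
rewrite -tA -E; rewrite -E in ap.
have sz : size (index_enum 'I_n) = n by rewrite -[RHS](card_ord n) -sum1_size sum1_card.
by have := bigsumset_kneser_seq A0 ap; rewrite /tot sz.
Qed.

End Extension.

(** * The quotient by a subgroup as an additive group *)

Section QuotientType.
Variables (G : finZmodType) (Hg : {group G}).

(** An alias of the coset type, on which the group law of cosets is declared as an addition. *)
Definition quo : Type := coset_of Hg.
HB.instance Definition _ := Finite.on quo.

Let norm_all (x : G) : x \in 'N(Hg)%g.
Proof. by rewrite (subsetP (sub_abelian_norm (zmod_abelian setT) (subsetT Hg))) ?inE. Qed.

Let quo_mulC (x y : coset_of Hg) : (x * y)%g = (y * x)%g.
Proof.
have [a Na ->] := cosetP x; have [b Nb ->] := cosetP y.
by rewrite -!coset_morphM // !zmodMgE addrC.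
Qed.

HB.instance Definition _ := GRing.isZmodule.Build quo
  (@mulgA (coset_of Hg)) quo_mulC (@mul1g (coset_of Hg)) (@mulVg (coset_of Hg)).

Definition quo_map (x : G) : quo := coset Hg x.

Lemma quo_map_is_additive : zmod_morphism quo_map.
Proof.
move=> x y; have E : coset Hg (x * y^-1)%g = (coset Hg x * (coset Hg y)^-1)%g.
  by rewrite coset_morphM ?groupV // morphV.
exact: E.
Qed.

HB.instance Definition _ := GRing.isZmodMorphism.Build G quo quo_map quo_map_is_additive.

Lemma quo_map_surj (q : quo) : exists x, quo_map x = q.
Proof. by have [x _ ->] := cosetP q; exists x. Qed.

Lemma quo_map_eq0 x : (quo_map x == 0) = (x \in Hg).
Proof.
apply/eqP/idP => [E|Hx]; last exact: coset_id.
exact: coset_idr (norm_all x) E.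
Qed.

End QuotientType.

(** * Quotients *)

(** Hides the construction: from here on a quotient is a surjective additive map with kernel [H]. *)
Lemma quotient_exists (G : finZmodType) (H : {set G}) : subgrp H ->
  exists (Q : finZmodType) (p : {additive G -> Q}),
    (forall q, exists x, p x = q) /\ forall x, (p x == 0) = (x \in H).
Proof.
move=> /subgrpP [H0 HD]; have gsH : group_set H by apply/group_setP; split.
exists (quo (Group gsH)), (@quo_map G (Group gsH)); split; first exact: quo_map_surj.
by move=> x; rewrite quo_map_eq0.
Qed.

Section QuotientMap.
Variables (G Q : finZmodType) (p : {additive G -> Q}) (H : {set G}).
Hypotheses (gH : subgrp H) (p_surj : forall q, exists x, p x = q).
Hypothesis p_ker : forall x, (p x == 0) = (x \in H).
Implicit Types (A B : {set G}) (v : G -> nat).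

Lemma quo_eq x y : (p x == p y) = (x - y \in H).
Proof. by rewrite -p_ker raddfB subr_eq0. Qed.

Lemma quo_sumset A B : p @: (A :+: B) = (p @: A) :+: (p @: B).
Proof.
apply/setP => q; apply/imsetP/sumsetP => [[_ /sumsetP [a [b [Aa Bb ->]]] ->]|].
  by exists (p a), (p b); rewrite raddfD !imset_f.
move=> [_ [_ [/imsetP [a Aa ->] /imsetP [b Bb ->] ->]]].
by exists (a + b); rewrite ?raddfD // mem_sumset.
Qed.

Lemma mem_sumset_quo A x : (x \in A :+: H) = (p x \in p @: A).
Proof.
apply/sumsetP/imsetP => [[a [h [Aa Hh ->]]]|[a Aa /eqP]].
  by exists a => //; apply/eqP; rewrite quo_eq addrAC subrr add0r.
by rewrite quo_eq => Hxa; exists a, (x - a); split=> //; zmod.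
Qed.

Lemma card_fibre q : #|[set x | p x == q]| = #|H|.
Proof.
have [x <-] := p_surj q; rewrite -(card_translate x H); apply: eq_card => y.
by rewrite inE quo_eq mem_translate.
Qed.

Lemma card_preim_quo (B : {set Q}) : #|[set x | p x \in B]| = (#|H| * #|B|)%N.
Proof.
rewrite -sum1_card (partition_big p [in B]) /= => [|x]; last by rewrite inE.
rewrite mulnC -sum_nat_const; apply: eq_bigr => q Bq.
rewrite -(card_fibre q) -sum1_card; apply: eq_bigl => x; rewrite !inE.
by case: eqP => [->|_]; rewrite ?andbF ?Bq.
Qed.

Lemma card_sumset_quo A : #|A :+: H| = (#|H| * #|p @: A|)%N.
Proof.
by rewrite -card_preim_quo; apply: eq_card => x; rewrite inE mem_sumset_quo.
Qed.

Definition vmap v (q : Q) : nat := (\sum_(g | p g == q) v g)%N.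

Lemma sum_vmap v : (\sum_q vmap v q = \sum_g v g)%N.
Proof. by rewrite [RHS](partition_big p predT). Qed.

(** Lifting a choice of classes to a choice of terms amounts to sending positions injectively to
    labelled copies of the terms, class by class. *)
Lemma sums_vmap n v : sums n (vmap v) = p @: sums n v.
Proof.
apply/setP => q; apply/sumsP/imsetP => [[f [f_le ->]]|[_ /sumsP [f [f_le ->]] ->]].
  have [J [t [cardJ tE]]] := count_family v.
  have [g|th [inj_th thE]] := @count_injection 'I_n J Q f (p \o t).
    apply: leq_trans (f_le g) _; rewrite /vmap.
    rewrite -sum1_card (partition_big t (fun h => p h == g)) /= => [|j]; last by rewrite inE.
    apply: leq_sum => h ph; rewrite -tE -sum1_card leq_eqVlt; apply/orP; left; apply/eqP.
    by apply: eq_bigl => j; rewrite !inE; case: (t j =P h) => [->|_]; rewrite ?ph ?andbF.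
  exists (\sum_i t (th i)); last by rewrite raddf_sum; apply: eq_bigr => i _; rewrite -thE.
  apply/sumsP; exists (t \o th); split=> // g; rewrite -tE.
  rewrite /mult -(card_imset _ inj_th); apply: subset_leq_card.
  by apply/subsetP => j /imsetP [i]; rewrite !inE => ti ->.
exists (p \o f); split; last by rewrite raddf_sum.
move=> h; rewrite /mult /vmap -sum1_card (partition_big f (fun g => p g == h)) /=.
  apply: leq_sum => g ph; apply: leq_trans (f_le g); rewrite /mult -sum1_card.
  by rewrite leq_eqVlt; apply/orP; left; apply/eqP; apply: eq_bigl => i; rewrite !inE;
    case: (f i =P g) => [->|_]; rewrite ?ph ?andbF.
by move=> i; rewrite inE.
Qed.

Lemma stab_quo A : H = stab A -> stab (p @: A) = [set 0].
Proof.
move=> HA; apply/eqP; rewrite eqEsubset sub1set grp0 ?subgrp_stab // andbT.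
apply/subsetP => q qS; have [x xE] := p_surj q; apply/set1P; rewrite -xE.
apply/eqP; rewrite p_ker HA; apply: stabP => a Aa.
have : p (x + a) \in p @: A by rewrite raddfD xE stabD // imset_f.
by rewrite -mem_sumset_quo HA sumset_stab.
Qed.

Lemma card_periodic A : A :+: H = A -> #|A| = (#|H| * #|p @: A|)%N.
Proof. by move=> E; rewrite -card_sumset_quo E. Qed.

Lemma card_vmap_fibre v n (X : {set Q}) :
  (\sum_(g | p g \in X) minn n (v g) <= #|X| * (n * #|H|))%N.
Proof.
rewrite (partition_big p [in X]) //= -sum_nat_const; apply: leq_sum => q Xq.
apply: leq_trans (_ : \sum_(g in [set g | p g == q]) n <= _)%N.
  rewrite big_mkcond [X in (_ <= X)%N]big_mkcond; apply: leq_sum => g _; rewrite inE.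
  by case: eqP => [->|_]; rewrite ?andbF // Xq geq_minl.
by rewrite sum_nat_const card_fibre mulnC.
Qed.

Lemma sum_vmap_cond v (X : {set Q}) :
  (\sum_(q in X) vmap v q = \sum_(g | p g \in X) v g)%N.
Proof.
rewrite [RHS](partition_big p [in X]) //=; apply: eq_bigr => q Xq.
apply: eq_bigl => g; case: (p g =P q) => [->|_]; rewrite ?andbF ?Xq //.
Qed.

End QuotientMap.

Section MinSum.
Variables (T : finType) (n : nat) (w : T -> nat).

Lemma sum_minn_split (Z := [set q | (n <= w q)%N]) :
  (\sum_q minn n (w q) = #|Z| * n + \sum_(q | q \notin Z) w q)%N.
Proof.
rewrite (bigID [in Z]) /= -sum_nat_const; congr (_ + _)%N; apply: eq_bigr => q.
  by rewrite inE => /minn_idPl.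
by rewrite inE -ltnNge => /ltnW /minn_idPr.
Qed.

End MinSum.

(** * Sequences concentrated in a coset *)

Section CosetStructure.
Variable G : finZmodType.
Implicit Types (v : G -> nat) (H K X Y : {set G}) (a g : G).

(** For [X] the coset alpha + K this is the e_K of the theorem. *)
Definition eout v X : nat := (\sum_(g | g \notin X) v g)%N.
Definition vres v X g : nat := if g \in X then v g else 0%N.

Lemma sum_vres v X : (\sum_g vres v X g = \sum_(g in X) v g)%N.
Proof. by rewrite [RHS]big_mkcond. Qed.

Lemma min_vres v X n :
  (\sum_g minn n (vres v X g) = \sum_(g in X) minn n (v g))%N.
Proof.
rewrite [RHS]big_mkcond; apply: eq_bigr => g _; rewrite /vres; by case: ifP => // _; rewrite minn0.
Qed.

Lemma min_sum_coset v X n :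
  (\sum_g minn n (v g) <= \sum_(g in X) minn n (v g) + eout v X)%N.
Proof.
rewrite (bigID [in X]) /= leq_add2l /eout; apply: leq_sum => g _; exact: geq_minr.
Qed.

Lemma bigsumset_coset (I : finType) (A : I -> {set G}) K a : subgrp K ->
  (forall i, A i \subset a +: K) -> \Sum_i A i \subset (a *+ #|I|) +: K.
Proof.
move=> gK sA; apply/subsetP => _ /mem_bigsumset [f [fA ->]].
rewrite mem_translate -sumr_const -sumrB; apply: (grp_sum gK) => i _.
by have := subsetP (sA i) _ (fA i isT); rewrite mem_translate.
Qed.

Lemma vres_cfg_sub (I : finType) v X (A : I -> {set G}) :
  (forall g, (occ A g <= vres v X g)%N) -> forall i, A i \subset X.
Proof.
move=> le_v i; apply/subsetP => g Ag; have := le_v g; rewrite /vres; case: ifP => // _.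
by rewrite leqn0 cards_eq0 => /eqP E; have := in_set0 i; rewrite -E inE Ag.
Qed.

Lemma sums_ext n v v' : v =1 v' -> sums n v = sums n v'.
Proof.
move=> E; apply/setP => x; apply/sumsP/sumsP => -[f [f_le ->]]; exists f; split=> // g.
  by rewrite -E.
by rewrite E.
Qed.

(** The case of N >= 2 frequent classes in [core_full], with [c] and [k] the orders of [K] and of a
    stabilizer [H1]. The lower bound on [c] is DeVos-Goddyn-Mohar modulo [H1]; taken e + 1 times it
    exceeds what N classes of capacity (nu + e)k and [e1] further terms can hold. *)
Lemma coset_arith e N k nu e1 c :
  (0 < e)%N -> (1 < N)%N -> (0 < k)%N -> (1 < nu)%N ->
  (k * ((N - 1) * nu + e1 + 2) <= c)%N ->
  ((e + 1) * c + (nu + e) <= e + (N * ((nu + e) * k) + e1))%N -> False.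
Proof.
case: N => [|[|N]] // e0 _ k0 nu1; rewrite subSS subn0.
case: e e0 => // e _; case: k k0 => // k _; case: nu nu1 => [|[|nu]] // _ I1 I2.
have : ((e.+1 + 1) * (k.+1 * (N.+1 * nu.+2 + e1 + 2)) <= (e.+1 + 1) * c)%N by rewrite leq_mul2l I1 orbT.
nia.
Qed.

Section Core.
Variables (n l : nat) (v : G -> nat) (K : {set G}) (a : G).
Hypothesis gK : subgrp K.
Let e := eout v (a +: K).
Hypothesis K_le : ((e + 1) * #|K| <= #|sums n v|)%N.
Hypothesis l_big : (#|sums n v| + n <= l)%N.
Hypothesis l_le : (l <= \sum_g minn n (v g))%N.
Hypothesis minK : forall (K1 : {set G}) a1, subgrp K1 -> K1 \subset K -> a1 \in a +: K ->
  ((eout v (a1 +: K1) + 1) * #|K1| <= #|sums n v|)%N -> (#|K| <= #|K1|)%N.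

Lemma core_cap : (l <= \sum_(g in a +: K) minn n (v g) + e)%N.
Proof. exact: leq_trans l_le (min_sum_coset _ _ _). Qed.

(** The coset has capacity at most n|K|, so (e + 1)|K| + n <= n|K| + e, that is |K| <= (|K| - 1)(n -
    e). *)
Lemma core_bounds : (1 < #|K|)%N /\ (e + 2 <= n)%N.
Proof.
have le_nK : (\sum_(g in a +: K) minn n (v g) <= #|K| * n)%N.
  rewrite -(card_translate a K) -sum_nat_const; apply: leq_sum => g _; exact: geq_minl.
have K0 : (0 < #|K|)%N by apply/card_gt0P; exists 0; apply: grp0.
have := core_cap; move: K_le l_big le_nK K0.
move: (\sum_(g in _) _)%N #|K| #|sums n v| => s k c H1 H2 H3 H4 H5.
have H6 : ((e + 1) * k + n <= k * n + e)%N by lia.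
have k1 : (1 < k)%N by case: k H1 H3 H4 H6 {H5} => [|[|k]] //; lia.
split=> //; rewrite leqNgt; apply/negP => lt_n.
have : exists d, (e + 1)%N = (n + d)%N by exists (e + 1 - n)%N; lia.
case=> d dE; rewrite dE in H6; nia.
Qed.

Let nu := (n - e)%N.

(** Lowering the cap from n to n - e loses at most e at each of the |K| elements of the coset, and
    the outside terms account for e more; [K_le] and [l_big] leave room for both. *)
Lemma core_min : (#|K| + nu <= \sum_(g in a +: K) minn nu (v g))%N.
Proof.
have [K1 en] := core_bounds.
have : (\sum_(g in a +: K) minn n (v g) <= \sum_(g in a +: K) minn nu (v g) + #|K| * e)%N.
  rewrite -(card_translate a K) -sum_nat_const -big_split /=; apply: leq_sum => g _.
  by rewrite /nu; lia.
have arith (s s' k c : nat) : (s <= s' + k * e)%N -> ((e + 1) * k <= c)%N ->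
    (c + n <= l)%N -> (l <= s + e)%N -> (e + 2 <= n)%N -> (k + (n - e) <= s')%N.
  by move=> H1 H2 H3 H4 H5; lia.
by move/arith; apply; [exact: K_le|exact: l_big|exact: core_cap|exact: en].
Qed.

(** With total nu + |K| - 1 the first alternative of [partition_theorem] already fills the coset.
    Otherwise the sums of nu terms from the coset form a set [Y] smaller than [K], and the proof
    counts the classes modulo its stabilizer [H1] of multiplicity at least nu. *)
Lemma core_full : exists B : 'I_nu -> {set G},
  [/\ cfg (vres v (a +: K)) B, tot B = (nu + #|K| - 1)%N &
      \Sum_i B i = (a *+ nu) +: K].
Proof.
have [K1 en] := core_bounds; have := core_min => cmin.
set u := vres v (a +: K).
have le_u : (nu + #|K| - 1 <= \sum_g minn nu (u g))%N.
  by rewrite min_vres; move: cmin; move: (\sum_(g in _) _)%N => s; lia.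
have nu_le : (nu <= nu + #|K| - 1)%N by lia.
have [B [cB tB PT]] := partition_theorem (cfg_exists nu_le le_u).
exists B; split=> //.
have sB : forall i, B i \subset a +: K by apply: (@vres_cfg_sub _ v); case: cB.
have sY := bigsumset_coset gK sB; rewrite card_ord in sY.
suff le_K : (#|K| <= #|\Sum_i B i|)%N by apply/eqP; rewrite eqEcard sY card_translate.
rewrite leqNgt; apply/negP => lt_K; case: PT => [|YE]; first by lia.
(* Without outside terms [Y] would be all of the n-term sums, and [K_le] says |K| <= |Y|. *)
have [e0|e_gt0] := posnP e.
  have E : v =1 u.
    move=> g; rewrite /u /vres; case: ifP => // ga; apply/eqP; rewrite -leqn0 -e0.
    by rewrite /e /eout (bigD1 g) ?ga //= leq_addr.
  have := K_le; rewrite (sums_ext n E) e0 mul1n.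
  have nuE : nu = n by rewrite /nu e0 subn0.
  by move: lt_K; rewrite YE nuE; clia.
set Y := sums nu u in YE; rewrite YE in sY lt_K.
set H1 := stab Y; have gH1 : subgrp H1 := subgrp_stab Y.
have sum_u : (nu <= \sum_g u g)%N.
  apply: leq_trans (_ : \sum_g minn nu (u g) <= _)%N; first by lia.
  by apply: leq_sum => g _; apply: geq_minr.
have /set0Pn [y Yy] : Y != set0 := sums_neq0 sum_u.
have sH1 : H1 \subset K.
  apply/subsetP => x xY; have Yxy : x + y \in Y by rewrite stabD.
  have := subsetP sY _ Yxy; have := subsetP sY _ Yy; rewrite !mem_translate => Ky Kxy.
  by have Kd := grpB gK Kxy Ky; zmem_from Kd.
have [Q [p [p_surj p_ker]]] := quotient_exists gH1.
pose w := vmap p u.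
have YQ : sums nu w = p @: Y by apply: sums_vmap.
have ap : stab (sums nu w) \subset [set 0] by rewrite YQ (stab_quo p_surj p_ker) //.
have sum_w : (nu <= \sum_q w q)%N by rewrite sum_vmap.
have := card_sums_aperiodic sum_w ap; rewrite sum_minn_split YQ.
set Z := [set q | _]; set e1 := (\sum_(q | q \notin Z) w q)%N => dgm.
have cY : #|Y| = (#|H1| * #|p @: Y|)%N by apply: (card_periodic p_surj p_ker); apply: sumset_stab.
have KH1 : K :+: H1 = K.
  apply/eqP; rewrite eqEsubset subset_sumsetr ?(grp0 gH1) // andbT.
  by apply: subset_trans (sumsetS K sH1) _; rewrite (grp_sumset gK).
have cK : #|K| = (#|H1| * #|p @: K|)%N by apply: (card_periodic p_surj p_ker).
have H1_gt0 : (0 < #|H1|)%N by apply/card_gt0P; exists 0; apply: grp0.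
have lt_Q : (#|p @: Y| < #|p @: K|)%N by rewrite -(ltn_pmul2l H1_gt0) -cY -cK.
have cap : (l <= e + (#|Z| * (n * #|H1|) + e1))%N.
  apply: leq_trans core_cap _; rewrite addnC leq_add2l -min_vres -/u.
  rewrite (bigID (fun g => p g \in Z)) /= leq_add ?(card_vmap_fibre p_surj p_ker) //.
  rewrite /e1 (eq_bigl [in ~: Z]) => [|q]; last by rewrite in_setC.
  rewrite sum_vmap_cond.
  have -> : (\sum_(g | p g \in ~: Z) u g = \sum_(g | p g \notin Z) u g)%N.
    by apply: eq_bigl => g; rewrite in_setC.
  by apply: leq_sum => g _; apply: geq_minr.
have l_ge : ((e + 1) * #|K| + n <= l)%N by apply: leq_trans l_big; rewrite leq_add2r.
have [N0|[N1|N2]] : #|Z| = 0%N \/ #|Z| = 1%N \/ (1 < #|Z|)%N by case: #|Z| => [|[|N]]; auto.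
- have YlK : (#|p @: Y| <= #|Y|)%N by rewrite cY leq_pmull.
  move: dgm cap l_ge lt_K YlK; rewrite N0 /nu; move: #|p @: Y| #|Y| #|K| => a1 a2 a3.
  nia.
- move/eqP/cards1P: N1 => [q ZE].
  have wq : (nu <= w q)%N by have := set11 q; rewrite -ZE inE.
  have [a1 [pa1 a1K]] : exists a1, p a1 = q /\ a1 \in a +: K.
    case: (pickP (fun g => (p g == q) && (g \in a +: K))) => [g /andP [/eqP pg gK']|no_g].
      by exists g.
    have : w q = 0%N.
      rewrite /w /vmap big1 // => g pg; rewrite /u /vres; case: ifP => // ga.
      by have := no_g g; rewrite pg ga.
    by rewrite /nu in wq *; lia.
  have ZP g : (p g \in Z) = (g \in a1 +: H1).
    by rewrite ZE inE -pa1 (quo_eq p_ker) mem_translate.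
  have a1s : a1 +: H1 \subset a +: K by rewrite -(mem_coset_eq gK a1K) translateS.
  have eE : eout v (a1 +: H1) = (e + e1)%N.
    rewrite /eout (bigID [in a +: K]) /= addnC; congr (_ + _)%N.
      apply: eq_bigl => g; case: (boolP (g \in a +: K)) => ga; rewrite ?andbF ?andbT //.
      by apply: contra ga; apply: (subsetP a1s).
    rewrite /e1 (eq_bigl [in ~: Z]) => [|r]; last by rewrite in_setC.
    rewrite sum_vmap_cond big_mkcond [RHS]big_mkcond; apply: eq_bigr => g _.
    by rewrite in_setC ZP /u /vres; case: (g \in a +: K); rewrite ?andbF ?andbT //; case: ifP.
  (* The single frequent class a1 + H1 satisfies the inequality imposed on a + K, so minimality
     gives |K| <= |H1| <= |Y|, against |Y| < |K|. *)
  have := minK gH1 sH1 a1K; rewrite eE.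
  have -> : ((e + e1 + 1) * #|H1| <= #|sums n v|)%N.
    apply: leq_trans K_le; move: dgm lt_Q; rewrite ZE cards1 cK.
    move: #|p @: Y| #|p @: K| #|H1| H1_gt0 => c1 c2 c3 c3_gt0; rewrite /nu mul1n => D1 D2.
    have D3 : (e1 + 2 <= c2)%N by lia.
    rewrite mulnCA mulnC leq_mul2l; apply/orP; right.
    apply: (@leq_trans ((e + 1) * (e1 + 2))); last by rewrite leq_mul2l D3 orbT.
    nia.
  move=> /(_ isT) K_le1; have := card_stab_le (sums_neq0 sum_u); rewrite -/Y -/H1.
  by move: lt_K K_le1; clia.
apply: (@coset_arith e #|Z| #|H1| nu e1 #|K|) => //; first by rewrite /nu; lia.
  rewrite cK leq_mul2l; apply/orP; right.
  move: dgm lt_Q N2; move: #|p @: Y| #|p @: K| #|Z| => c1 c2 c3.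
  case: c3 => // c3; rewrite subSS subn0 mulSn; lia.
have -> : (nu + e = n)%N by rewrite /nu; lia.
by apply: leq_trans cap; move: l_ge; lia.
Qed.

End Core.
End CosetStructure.

Section SplitOrd.
Variables (G : finZmodType) (m k : nat).

Definition cat_fam (T : Type) (B : 'I_m -> T) (D : 'I_k -> T) (i : 'I_(m + k)) : T :=
  match split i with inl j => B j | inr j => D j end.

Lemma cat_lshift T (B : 'I_m -> T) (D : 'I_k -> T) j : cat_fam B D (lshift k j) = B j.
Proof. by rewrite /cat_fam (unsplitK (inl j)). Qed.

Lemma cat_rshift T (B : 'I_m -> T) (D : 'I_k -> T) j : cat_fam B D (rshift m j) = D j.
Proof. by rewrite /cat_fam (unsplitK (inr j)). Qed.

Lemma occ_split (A : 'I_(m + k) -> {set G}) g :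
  occ A g = (occ (fun j => A (lshift k j)) g + occ (fun j => A (rshift m j)) g)%N.
Proof. by rewrite !occE big_split_ord. Qed.

Lemma tot_split (A : 'I_(m + k) -> {set G}) :
  tot A = (tot (fun j => A (lshift k j)) + tot (fun j => A (rshift m j)))%N.
Proof. by rewrite /tot big_split_ord. Qed.

Lemma bigsumset_split (A : 'I_(m + k) -> {set G}) :
  \Sum_i A i = (\Sum_j A (lshift k j)) :+: (\Sum_j A (rshift m j)).
Proof. by rewrite /bigsumset big_split_ord. Qed.

End SplitOrd.

(** * Distributing the terms outside the coset *)

Section Construction.
Variable G : finZmodType.
Implicit Types (v : G -> nat) (g h : G).

Lemma occ_set1 (I : finType) (d : I -> G) g : occ (fun i => [set d i]) g = #|[set i | d i == g]|.
Proof. by apply: eq_card => i; rewrite !inE eq_sym. Qed.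

Lemma tot_set1 (I : finType) (d : I -> G) : tot (fun i => [set d i]) = #|I|.
Proof. by rewrite /tot -sum1_card; apply: eq_bigr => i _; rewrite cards1. Qed.

Lemma count_eq_of_sum (I : finType) (t : I -> G) v :
    (forall g, #|[set i | t i == g]| <= v g)%N -> (\sum_g v g = #|I|)%N ->
  forall g, #|[set i | t i == g]| = v g.
Proof.
move=> t_le sv g; apply/eqP; rewrite eqn_leq t_le /= leqNgt; apply/negP => lt_g.
have : (\sum_h #|[set i | t i == h]| < \sum_h v h)%N.
  by rewrite (bigD1 g) //= [X in (_ < X)%N](bigD1 g) //= -addSn leq_add // leq_sum.
by rewrite sv sum_card_fibres ltnn.
Qed.

(* The first nu sets fill the coset nu a + K; each of the last e sets contains
   one of the e terms outside a + K. *)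
Lemma structured_setpartition (nu e l : nat) v (K : {set G}) (a : G)
    (B : 'I_nu -> {set G}) :
    subgrp K -> eout v (a +: K) = e -> (1 < #|K|)%N ->
    cfg (vres v (a +: K)) B -> tot B = (nu + #|K| - 1)%N -> \Sum_i B i = (a *+ nu) +: K ->
    ((e + 1) * #|K| + (nu + e) <= l)%N ->
    (l <= \sum_g minn (nu + e) (v g))%N ->
  exists A : 'I_(nu + e) -> {set G},
    [/\ cfg v A, tot A = l, \Sum_i A i = sums (nu + e) v,
        forall g, g \notin a +: K -> occ A g = v g &
      [/\ forall i, (a +: K) :&: A i != set0,
          forall i : 'I_(nu + e), (i < nu)%N -> A i \subset a +: K,
          forall i : 'I_(nu + e), (nu <= i)%N -> #|A i :\: (a +: K)| = 1%N &
          \Sum_(i : 'I_(nu + e) | (i < nu)%N) A i = (a *+ nu) +: K]].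
Proof.
move=> gK eE K1 [B0 B_le] tB BK l_ge l_le; set X := a +: K in eE B_le *.
set u := vres v X in B_le.
have cap : (l <= \sum_g minn (nu + e) (u g) + e)%N.
  by rewrite min_vres; apply: leq_trans l_le _; rewrite -[X in (_ <= _ + X)%N]eE; apply: min_sum_coset.
have cap_u : (\sum_g minn (nu + e) (u g) <= \sum_g u g)%N.
  by apply: leq_sum => g _; apply: geq_minr.
(* [d] makes each of the last e sets meet the coset. The outside terms, listed by [t], are added
   only after the sets have been filled with coset terms up to a total of [l - e]. *)
have [d d_le] : exists d : 'I_e -> G, forall g, (#|[set i | d i == g]| <= u g - occ B g)%N.
  apply: exists_bounded_count; rewrite sumnB => [|g _]; last exact: B_le.
  rewrite -tot_occ tB; move: l_ge cap cap_u; clear - K1.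
  move: (\sum_g minn _ _)%N (\sum_g u g)%N #|K| K1 => s1 s2 k k1 H1 H2 H3; nia.
have [t t_le] : exists t : 'I_e -> G, forall g, (#|[set i | t i == g]| <= vres v (~: X) g)%N.
  apply: exists_bounded_count; rewrite sum_vres -[X in (X <= _)%N]eE /eout leq_eqVlt.
  by apply/orP; left; apply/eqP; apply: eq_bigl => g; rewrite in_setC.
have tE := count_eq_of_sum t_le.
have {t_le}tE g : #|[set i | t i == g]| = vres v (~: X) g.
  apply: tE; rewrite card_ord sum_vres -[RHS]eE /eout.
  by apply: eq_bigl => h; rewrite in_setC.
have tX j : t j \notin X.
  apply/negP => tjX; have := tE (t j); rewrite /vres in_setC tjX /= => /eqP.
  by rewrite cards_eq0 => /eqP E; have := in_set0 j; rewrite -E inE eqxx.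
pose A0 := cat_fam B (fun j => [set d j]).
have occA0 g : occ A0 g = (occ B g + #|[set i | d i == g]|)%N.
  rewrite occ_split -occ_set1; congr (_ + _)%N; rewrite !occE; apply: eq_bigr => j _.
    by rewrite /A0 cat_lshift.
  by rewrite /A0 cat_rshift.
have totA0 : tot A0 = (nu + #|K| - 1 + e)%N.
  rewrite tot_split -tB; congr (_ + _)%N.
    by apply: eq_bigr => j _; rewrite /A0 cat_lshift.
  by rewrite -[RHS]card_ord -(tot_set1 d); apply: eq_bigr => j _; rewrite /A0 cat_rshift.
have [g|||C [sC C_le tC]] := @family_extend G (nu + e) u A0 (l - e).
- by rewrite occA0; have := d_le g; have := B_le g; lia.
- by rewrite totA0; move: l_ge K1; move: #|K| => k; nia.
- by move: cap; move: (\sum_g _)%N => s; lia.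
have sCX := vres_cfg_sub C_le.
have C0 i : C i != set0.
  suff /set0Pn [g Ag] : A0 i != set0 by apply/set0Pn; exists g; apply: (subsetP (sC i)).
  rewrite /A0 /cat_fam; case: split => j; first exact: B0.
  by apply/set0Pn; exists (d j); rewrite set11.
pose A i := C i :|: cat_fam (fun _ => set0) (fun j => [set t j]) i.
have Al j : A (lshift e j) = C (lshift e j) by rewrite /A cat_lshift setU0.
have Ar j : A (rshift nu j) = t j |: C (rshift nu j) by rewrite /A cat_rshift setUC.
have occA g : occ A g = (occ C g + vres v (~: X) g)%N.
  rewrite -tE -occ_set1 !occE [LHS]big_split_ord [X in (_ = X + _)%N]big_split_ord /= -addnA.
  congr (_ + _)%N; first by apply: eq_bigr => j _; rewrite Al.
  rewrite -big_split /=; apply: eq_bigr => j _.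
  rewrite Ar !inE; case: (g =P t j) => [->|_] //=; rewrite ?addn0 //.
  have /negPf -> // : t j \notin C (rshift nu j).
  by apply: contra (tX j); apply: (subsetP (sCX _)).
have occAX g : g \in X -> occ A g = occ C g by move=> gX; rewrite occA /vres in_setC gX addn0.
have occAnX g : g \notin X -> occ A g = v g.
  move=> gX; rewrite occA /vres in_setC gX; suff -> : occ C g = 0%N by [].
  by apply/eqP; rewrite -leqn0; have := C_le g; rewrite /u /vres (negPf gX).
have split_cases (i : 'I_(nu + e)) :
    (exists j, i = lshift e j) \/ (exists j, i = rshift nu j).
  by rewrite -(splitK i); case: (split i) => j; [left|right]; exists j.
have cA : cfg v A.
  split=> [i|g].
    by apply/set0Pn; have /set0Pn [g Cg] := C0 i; exists g; rewrite inE Cg.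
  have [gX|gX] := boolP (g \in X); last by rewrite occAnX.
  by rewrite occAX //; have := C_le g; rewrite /u /vres gX.
have tA : tot A = l.
  have -> : tot A = (tot C + e)%N.
    rewrite !tot_occ (eq_bigr _ (fun g _ => occA g)) big_split /=; congr (_ + _)%N.
    rewrite sum_vres -[RHS]eE /eout; by apply: eq_bigl => h; rewrite in_setC.
  by rewrite tC subnK //; move: l_ge; lia.
have lowE : \Sum_j A (lshift e j) = (a *+ nu) +: K.
  apply/eqP; rewrite eqEsubset; apply/andP; split.
    have := @bigsumset_coset _ 'I_nu (fun j => A (lshift e j)) K a gK.
    by rewrite card_ord; apply=> j; rewrite Al.
  rewrite -BK; apply: bigsumsetS => j _; rewrite Al; apply: subset_trans (sC _).
  by rewrite /A0 cat_lshift.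
exists A; split=> //; last first.
  split.
  - move=> i; have /set0Pn [g Cg] := C0 i; apply/set0Pn; exists g.
    by rewrite !inE Cg (subsetP (sCX i)).
  - move=> i lt_i; have [[j ->]|[j iE]] := split_cases i; first by rewrite Al.
    by move: lt_i; rewrite iE /= ltnNge leq_addr.
  - move=> i le_i; have [[j iE]|[j ->]] := split_cases i.
      by move: le_i; rewrite iE /= leqNgt ltn_ord.
    rewrite Ar; have -> : (t j |: C (rshift nu j)) :\: X = [set t j]; last by rewrite cards1.
    apply/setP => g; rewrite !inE; case: (g =P t j) => [->|_] /=; first by rewrite tX.
    by apply/negP => /andP [gX /(subsetP (sCX _))]; rewrite (negPf gX).
  - rewrite -lowE /bigsumset big_split_ord /= [X in _ :+: X]big_pred0 => [|j]; last first.
      by rewrite ltnNge leq_addr.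
    rewrite sumsetC sum0set; apply: eq_bigl => j; exact: ltn_ord.
apply/eqP; rewrite eqEsubset cfg_sub_sums //=; apply/subsetP => _ /sumsP [f [f_le ->]].
(* The outside terms of [f] are among the [t j]. Below, [b] selects these same terms and arbitrary
   coset elements elsewhere, so the sums of [f] and [b] differ by an element of [K], which the first
   nu sets absorb. *)
pose O := [pred i : 'I_(nu + e) | f i \notin X]; pose F := {i : 'I_(nu + e) | i \in O}.
have [g|th [inj_th thE]] := @count_injection F 'I_e G (fun i => f (val i)) t.
  rewrite tE /vres in_setC; have [gX|gX] := boolP (g \in X); last first.
    apply: leq_trans (f_le g); rewrite /mult -(card_imset _ val_inj); apply: subset_leq_card.
    by apply/subsetP => i /imsetP [j]; rewrite !inE => fj ->.
  rewrite leqn0 cards_eq0; apply/eqP/setP => i; rewrite !inE; apply/negP => /eqP E.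
  by have := valP i; rewrite inE /= E gX.
have /set0Pn [x0 /mem_bigsumset [b0 [b0C _]]] : \Sum_i C i != set0 by apply: bigsumset_neq0.
pose U := [set th i | i : F].
pose b (i : 'I_(nu + e)) :=
  match split i with inl _ => b0 i | inr j => if j \in U then t j else b0 i end.
have bl j : b (lshift e j) = b0 (lshift e j) by rewrite /b (unsplitK (inl j)).
have br j : b (rshift nu j) = if j \in U then t j else b0 (rshift nu j).
  by rewrite /b (unsplitK (inr j)).
have bA i : b i \in A i.
  have [[j ->]|[j ->]] := split_cases i; first by rewrite bl Al b0C.
  by rewrite br Ar; case: ifP => _; rewrite !inE ?eqxx // b0C ?orbT.
have b0X i : b0 i - a \in K by rewrite -mem_translate (subsetP (sCX i)) ?b0C.
have sf : \sum_i (f i - a) - \sum_(j in U) (t j - a) \in K.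
  rewrite (bigID (fun i => f i \in X)) /=.
  have -> : \sum_(i | f i \notin X) (f i - a) = \sum_(j in U) (t j - a).
    rewrite big_imset /=; last by move=> i j _ _; apply: inj_th.
    rewrite (eq_bigr (fun i : F => f (val i) - a)) => [|i _]; last by rewrite thE.
    rewrite -(big_sub O (fun i => f i - a)).
    by apply: eq_bigl => i; rewrite inE.
  rewrite addrK; apply: (grp_sum gK) => i fX; by rewrite -mem_translate.
have sb : \sum_i (b i - a) - \sum_(j in U) (t j - a) \in K.
  rewrite big_split_ord /= [X in _ + X - _](bigID [in U]) /=.
  have -> : \sum_(j in U) (b (rshift nu j) - a) = \sum_(j in U) (t j - a).
    by apply: eq_bigr => j jU; rewrite br jU.
  set s1 := \sum_(_ < _) _; set s2 := \sum_(_ in _) _; set s3 := \sum_(_ | _) _.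
  have -> : s1 + (s2 + s3) - s2 = s1 + s3 by zmod.
  apply: (grpD gK); apply: (grp_sum gK) => j; first by rewrite bl.
  by move=> jU; rewrite br (negPf jU).
have Kfb : \sum_i f i - \sum_i b i \in K.
  have := grpB gK sf sb; rewrite !sumrB.
  set s1 := \sum_i f i; set s2 := \sum_i b i; set s3 := \sum_(_ in U) t _.
  set s4 := \sum_i a; set s5 := \sum_(_ in U) a => Hs.
  by zmem_from Hs.
rewrite -(subrK (\sum_i b i) (\sum_i f i)) addrC.
have <- : \Sum_i A i :+: K = \Sum_i A i.
  rewrite bigsumset_split lowE -sumsetA [X in _ :+: X]sumsetC sumsetA.
  by rewrite sumset_translate (grp_sumset gK).
by apply: mem_sumset => //; apply/mem_bigsumset; exists b.
Qed.

End Construction.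

(** * Iterated sums *)

Section IteratedSums.
Variable G : finZmodType.
Implicit Types (A B H K M P X Z : {set G}) (a b g x y z : G).

Definition nsum (j : nat) Z : {set G} := iter j (sumset Z) [set 0].

Lemma nsumS j Z : nsum j.+1 Z = Z :+: nsum j Z. Proof. by []. Qed.
Lemma nsum0 Z : nsum 0 Z = [set 0]. Proof. by []. Qed.
Lemma nsum1 Z : nsum 1 Z = Z. Proof. by rewrite nsumS nsum0 sumsetC sum0set. Qed.
Lemma nsumD i j Z : nsum (i + j) Z = nsum i Z :+: nsum j Z.
Proof. by elim: i => [|i IH]; rewrite ?sum0set // addSn !nsumS IH sumsetA. Qed.
Lemma nsumSr j Z : nsum j.+1 Z = nsum j Z :+: Z.
Proof. by rewrite nsumS sumsetC. Qed.

Lemma nsum_neq0 j Z : Z != set0 -> nsum j Z != set0.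
Proof.
move=> Z0; elim: j => [|j IH]; last by rewrite nsumS sumset_neq0.
by apply/set0Pn; exists 0; rewrite set11.
Qed.

Lemma nsum_0in j Z : 0 \in Z -> 0 \in nsum j Z.
Proof.
move=> Z0; elim: j => [|j IH]; first by rewrite set11.
by rewrite nsumS -[0]addr0 mem_sumset.
Qed.

Lemma nsum_subset i j Z : 0 \in Z -> (i <= j)%N -> nsum i Z \subset nsum j Z.
Proof. by move=> Z0 /subnKC <-; rewrite nsumD subset_sumsetr // nsum_0in. Qed.

Lemma sumset_sub_grp A B H : subgrp H -> A \subset H -> B \subset H -> A :+: B \subset H.
Proof. by move=> gH sA sB; have := sumsetSS sA sB; rewrite (grp_sumset gH). Qed.

Lemma nsum_sub_grp j Z H : subgrp H -> Z \subset H -> nsum j Z \subset H.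
Proof.
move=> gH sZ; elim: j => [|j IH]; first by rewrite sub1set grp0.
by rewrite nsumS sumset_sub_grp.
Qed.

Lemma nsum_mono j Z Z' : Z \subset Z' -> nsum j Z \subset nsum j Z'.
Proof. by move=> sZ; elim: j => [|j IH] //; rewrite !nsumS sumsetSS. Qed.

Lemma mulrn_nsum j Z z : z \in Z -> z *+ j \in nsum j Z.
Proof.
move=> Zz; elim: j => [|j IH]; first by rewrite mulr0n set11.
by rewrite mulrS nsumS mem_sumset.
Qed.

Lemma nsum_bigsumset (I : finType) (Pi : pred I) Z :
  \Sum_(i | Pi i) Z = nsum #|Pi| Z.
Proof. by rewrite /bigsumset big_const. Qed.

Lemma mem_nsum (I : finType) (Pi : pred I) Z x :
  reflect (exists f : I -> G, (forall i, Pi i -> f i \in Z) /\ x = \sum_(i | Pi i) f i)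
    (x \in nsum #|Pi| Z).
Proof. by rewrite -nsum_bigsumset; apply: mem_bigsumset. Qed.

Lemma mem_nsum_ord j Z x :
  reflect (exists f : 'I_j -> G, (forall i, f i \in Z) /\ x = \sum_i f i) (x \in nsum j Z).
Proof.
rewrite -[j in nsum j Z](card_ord j).
apply: (iffP (mem_nsum predT Z x)) => -[f [fZ ->]]; exists f; split=> // i.
exact: fZ.
Qed.

Lemma stab_nsum i j Z : (i <= j)%N -> stab (nsum i Z) \subset stab (nsum j Z).
Proof. by move=> /subnKC <-; rewrite nsumD stab_sumsetl. Qed.

Definition gen Z : {set G} := \bigcap_(H : {set G} | subgrp H && (Z \subset H)) H.

Lemma subgrp_gen Z : subgrp (gen Z).
Proof.
apply/subgrpP; split; first by apply/bigcapP => H /andP [gH _]; apply: grp0.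
move=> x y /bigcapP Hx /bigcapP Hy; apply/bigcapP => H PH.
by apply: grpD; rewrite ?Hx ?Hy //; case/andP: PH.
Qed.

Lemma sub_gen Z : Z \subset gen Z.
Proof. by apply/bigcapsP => H /andP []. Qed.

Lemma gen_min Z H : subgrp H -> Z \subset H -> gen Z \subset H.
Proof. by move=> gH sZ; apply: bigcap_inf; rewrite gH. Qed.

Lemma gen_sub Z H : subgrp H -> (gen Z \subset H) = (Z \subset H).
Proof.
move=> gH; apply/idP/idP; last exact: gen_min.
exact: subset_trans (sub_gen Z).
Qed.

Lemma nsum_sub_gen j Z : nsum j Z \subset gen Z.
Proof. exact: nsum_sub_grp (subgrp_gen Z) (sub_gen Z). Qed.

Lemma subgrp_setT : subgrp [set: G].
Proof. by apply/subgrpP; split=> [|x y _ _]; rewrite inE. Qed.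

Lemma two_cosets P Z : subgrp P -> 0 \in Z -> ~~ (Z \subset P) ->
  (2 * #|P| <= #|Z :+: P|)%N.
Proof.
move=> gP Z0 /subsetPn [z Zz zP].
have sU : P :|: (z +: P) \subset Z :+: P.
  by rewrite subUset subset_sumsetl // andbT -{1}(translate0 P) subset_sumsetl.
apply: leq_trans (subset_leq_card sU); rewrite cardsU card_translate.
suff -> : P :&: (z +: P) = set0 by rewrite cards0; clia.
apply/setP => y; rewrite !inE mem_translate; apply/negP => /andP [Py Pyz].
by case/negP: zP; have Pd := grpB gP Py Pyz; zmem_from Pd.
Qed.

Lemma periodic_sub_eq H A : subgrp H -> A != set0 -> A \subset H -> H \subset stab A -> A = H.
Proof.
move=> gH /set0Pn [a Aa] sA; rewrite sub_stab => sH; apply/eqP; rewrite eqEsubset sA /=.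
apply: subset_trans sH; apply/subsetP => h Hh.
rewrite -(subrK a h) addrC mem_sumset //; apply: grpB => //; exact: (subsetP sA).
Qed.

(** If A + Z is not the whole group then [Z] is not contained in its stabilizer [P]. So |P| is at
    most half of |Z + P|, and Kneser gives |A + Z| >= |A| + |Z + P|/2. *)
Lemma olson A Z : A != set0 -> 0 \in Z -> A \subset gen Z -> A :+: Z != gen Z ->
  (2 * #|A| + #|Z| <= 2 * #|A :+: Z|)%N.
Proof.
move=> A0 Z0 sA neq; have Zn0 : Z != set0 by apply/set0Pn; exists 0.
have := kneser A0 Zn0; set P := stab _; have gP : subgrp P := subgrp_stab _.
have ZP : ~~ (Z \subset P).
  apply: contra neq => sZ; apply/eqP/periodic_sub_eq; rewrite ?subgrp_gen ?sumset_neq0 //.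
    by rewrite sumset_sub_grp ?subgrp_gen ?sub_gen.
  exact: gen_min.
have := two_cosets gP Z0 ZP.
have := leq_card_sumset A (_ : P != set0); have := leq_card_sumset Z (_ : P != set0).
have P0 : P != set0 by apply/set0Pn; exists 0; apply: grp0.
by move=> /(_ P0) H1 /(_ P0) H2; clia.
Qed.

Lemma sum_card_disjoint (I : finType) (U : I -> {set G}) X :
    (forall i, U i \subset X) -> (forall i j g, g \in U i -> g \in U j -> i = j) ->
  (\sum_i #|U i| <= #|X|)%N.
Proof.
move=> sU dU; rewrite sum_card_incidence -sum1_card [X in (_ <= X)%N]big_mkcond.
apply: leq_sum => g _; case: ifP => gX; last first.
  rewrite leqn0 cards_eq0; apply/eqP/setP => i; rewrite !inE; apply/negP => gU.
  by have := subsetP (sU i) _ gU; rewrite gX.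
apply/card_le1P => i; rewrite !inE => gi j; rewrite !inE.
by apply/idP/eqP => [gj|-> //]; apply: dU gi.
Qed.

End IteratedSums.

(** The count closing [full_nsum_bound]: N = |Z|, c = |L|, l + 3 is the least index with (l + 3)Z =
    L, [y] and [yy] are the sizes of (l + 2)Z and (l + 1)Z, and n = q + l + 2. *)
Lemma full_arith (q l N c y yy : nat) : (0 < q)%N ->
    ((l + 3) * N <= 2 * y)%N -> ((l + 2) * N <= 2 * yy)%N -> (N + yy <= c)%N ->
  (N * (q + (l + 2)) <= q * c + y)%N.
Proof.
case: q => // q _ H1 H2 H3.
have : (q.+1 * (N + yy) <= q.+1 * c)%N by rewrite leq_mul2l H3 orbT.
have : (q * N <= q * (N + yy))%N by rewrite leq_mul2l leq_addr orbT.
move: H1 H2; rewrite !mulnDr !mulnDl !mulSn; lia.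
Qed.

(** * Terms outside the group generated by the frequent elements *)

Section Outside.
Variables (G : finZmodType) (n : nat) (v : G -> nat).
Implicit Types (f : 'I_n -> G) (x g : G).
Let Z : {set G} := [set g | (n <= v g)%N].
Let X := sums n v.

(** An element of multiplicity at least n may fill any number of the n positions. *)
Lemma mult_mix f f' : (forall g, (mult f g <= v g)%N) ->
  (forall i, f' i = f i \/ f' i \in Z) -> forall g, (mult f' g <= v g)%N.
Proof.
move=> f_le ff' g; have [gZ|gZ] := boolP (g \in Z).
  move: gZ; rewrite inE; apply: leq_trans.
  by rewrite -[X in (_ <= X)%N]card_ord max_card.
apply: leq_trans (f_le g); apply: subset_leq_card; apply/subsetP => i; rewrite !inE => /eqP E.
by case: (ff' i) => [<-|]; rewrite E // (negPf gZ).
Qed.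

Lemma sums_mix f f' : (forall g, (mult f g <= v g)%N) ->
  (forall i, f' i = f i \/ f' i \in Z) -> \sum_i f' i \in X.
Proof. by move=> f_le ff'; apply/sumsP; exists f'; split=> //; apply: mult_mix ff'. Qed.

Lemma nsum_sub_sums : nsum n Z \subset X.
Proof.
apply/subsetP => _ /mem_nsum_ord [f [fZ ->]]; apply/sumsP; exists f; split=> // g.
have [gZ|gZ] := boolP (g \in Z).
  move: gZ; rewrite inE; apply: leq_trans.
  by rewrite -[X in (_ <= X)%N]card_ord max_card.
rewrite /mult (_ : [set i | f i == g] = set0) ?cards0 //.
apply/setP => i; rewrite !inE; apply/negP => /eqP E; by have := fZ i; rewrite E (negPf gZ).
Qed.

Lemma card_outside f (Y : {set G}) : (forall g, (mult f g <= v g)%N) -> Z \subset Y ->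
  (#|[set i | f i \notin Y]| <= eout v Z)%N.
Proof.
move=> f_le sZ; apply: (@leq_trans #|[set i | f i \notin Z]|).
  apply: subset_leq_card; apply/subsetP => i iY; rewrite in_set; move: iY; rewrite in_set.
  by apply: contra; apply: (subsetP sZ).
rewrite -sum1_card (partition_big f (fun g => g \notin Z)) /= => [|i]; last by rewrite in_set.
apply: leq_sum => g gZ; apply: leq_trans (f_le g); rewrite /mult -sum1_card leq_eqVlt.
apply/orP; left; apply/eqP; apply: eq_bigl => i.
rewrite [i \in [set _ | _]]in_set [RHS]in_set.
by case: (f i =P g) => [->|_]; rewrite ?andbF ?gZ.
Qed.

Hypotheses (Z0 : 0 \in Z) (Z1 : (1 < #|Z|)%N) (apX : stab X \subset [set 0]).
Hypotheses (e_le : (eout v Z + 2 <= n)%N).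

(* A coset x0 + L not contained in X needs many terms outside L; taking
   as few as possible, their partial sums lie in distinct cosets of L. *)
Lemma full_nsum_bound : nsum n Z = gen Z -> (#|Z| * n <= #|X|)%N.
Proof.
move=> nL; set L := gen Z in nL *; have gL : subgrp L := subgrp_gen Z.
have sZL : Z \subset L := sub_gen Z.
have [x0 Xx0 notX] : exists2 x0, x0 \in X & ~~ (x0 +: L \subset X).
  have [/exists_inP //|/exists_inPn all_sub] := boolP [exists x in X, ~~ (x +: L \subset X)].
  exfalso.
  have : L \subset stab X.
    rewrite sub_stab; apply/subsetP => _ /sumsetP [x [h [Xx Lh ->]]].
    by apply: (subsetP (negPn (all_sub x Xx))); rewrite mem_translate; zmem_from Lh.
  move=> /subset_trans /(_ apX) /subset_leq_card; rewrite cards1.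
  by have := subset_leq_card sZL; move: Z1; clia.
pose out f := #|[set i | f i \notin L]|.
pose ok f := (forall g, (mult f g <= v g)%N) /\ \sum_i f i \in x0 +: L.
have [|f [[f_le fx0] min_f]] := @ex_min_nat _ ok out.
  by case/sumsP: Xx0 => f [f_le E]; exists f; split=> //; rewrite -E mem_translate subrr grp0.
have x0L : x0 +: L = (\sum_i f i) +: L by rewrite (mem_coset_eq gL fx0).
have r_le : (out f <= eout v Z)%N by apply: card_outside.
have [|l [lP min_l]] := @ex_min_nat nat (fun j => nsum j Z = L) id; first by exists n.
have le_ln : (l <= n)%N by apply: min_l.
have nsum_full j : (l <= j)%N -> nsum j Z = L.
  move=> le_j; apply/eqP; rewrite eqEsubset nsum_sub_gen /= -lP; exact: nsum_subset.
have sumD (B : {set 'I_n}) y : y \in nsum (n - #|B|) Z -> \sum_(i in B) f i + y \in X.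
  have -> : (n - #|B| = #|[pred i | i \notin B]|)%N.
    have cE : #|[pred i | i \notin B]| = #|~: B| by apply: eq_card => i; rewrite inE in_setC.
    by have := cardsC B; rewrite card_ord cE => cBn; lia.
  case/mem_nsum => h [hZ ->].
  have -> : \sum_(i in B) f i + \sum_(i | [pred i | i \notin B] i) h i =
      \sum_i (if i \in B then f i else h i).
    rewrite [RHS](bigID [in B]) /=; congr (_ + _); apply: eq_bigr => i /=; first by move->.
    by move/negPf ->.
  apply: (sums_mix f_le) => i; case: ifP => iB; first by left.
  by right; apply: hZ; rewrite /= iB.
pose O := [set i | f i \notin L]; pose s := enum O.
have ss : size s = out f by rewrite /s -cardE.
pose B k : {set 'I_n} := [set i in take k s].
have cB k : (k <= out f)%N -> #|B k| = k.
  move=> le_k; rewrite cardsE; have /card_uniqP -> : uniq (take k s) by rewrite take_uniq ?enum_uniq.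
  by rewrite size_takel // ss.
have BO k : B k \subset O.
  by apply/subsetP => i; rewrite inE => /mem_take; rewrite mem_enum.
have BB j k : (j <= k)%N -> B j \subset B k.
  move=> le_jk; apply/subsetP => i; rewrite !inE -(subnKC le_jk) takeD mem_cat => ->.
  by [].
pose tau k := \sum_(i in B k) f i.
(* Otherwise the terms outside [L] leave at least [l] positions, whose sums over [Z] cover [L], and
   x0 + L would lie in [X]. *)
have lt_nl : (n < out f + l)%N.
  rewrite ltnNge; apply/negP => le_n; case/negP: notX; rewrite x0L; apply/subsetP => y.
  rewrite mem_translate => Ly.
  have cO : #|O| = out f by [].
  rewrite -(subrK (\sum_(i in O) f i) y) addrC; apply: sumD; rewrite cO nsum_full; last by lia.
  have -> : y - \sum_(i in O) f i = (y - \sum_i f i) + \sum_(i | i \notin O) f i.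
    rewrite [\sum_i f i](bigID [in O]) /=.
    set s1 := \sum_(i in O) f i; set s2 := \sum_(i | i \notin O) f i; zmod.
  by apply: (grpD gL) => //; apply: (grp_sum gL) => i; rewrite in_set negbK.
(* If two partial sums were congruent, the terms between them could be replaced by 0, an element of
   [Z]: same coset, fewer terms outside [L]. *)
have tau_inj j k : (j < k)%N -> (k <= out f)%N -> tau k - tau j \notin L.
  move=> lt_jk le_k; apply/negP => Ljk.
  pose D := B k :\: B j.
  have tauD : tau k - tau j = \sum_(i in D) f i.
    rewrite /tau (bigID [in B j]) /= [X in X + _ - _](_ : _ = tau j).
      rewrite addrC addKr; apply: eq_bigl => i; by rewrite !in_setD andbC.
    apply: eq_bigl => i; apply/andP/idP => [[]|iB] //.
    by rewrite iB (subsetP (BB j k (ltnW lt_jk))).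
  pose f' i := if i \in D then 0 else f i.
  have : ok f'.
    split.
      by apply: (mult_mix f_le) => i; rewrite /f'; case: ifP => _; [right|left].
    rewrite x0L mem_translate -(grpN gL).
    have -> : - (\sum_i f' i - \sum_i f i) = \sum_(i in D) f i.
      rewrite [\sum_i f i](bigID [in D]) [\sum_i f' i](bigID [in D]) /=.
      rewrite [\sum_(i in D) f' i]big1 => [|i iD]; last by rewrite /f' iD.
      rewrite [\sum_(i | i \notin D) f' i](eq_bigr f) => [|i iD]; last by rewrite /f' (negPf iD).
      by zmod.
    by rewrite -tauD.
  move/min_f; rewrite leqNgt /out; case/negP; apply: proper_card; rewrite properE.
  apply/andP; split.
    apply/subsetP => i; rewrite !in_set /f'; case: ifP => // _; by rewrite grp0.
  have [i iD] : exists i, i \in D.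
    apply/set0Pn; rewrite -cards_eq0 cardsD (setIidPr (BB j k (ltnW lt_jk))) !cB ?subn_eq0 -?ltnNge //.
    by lia.
  apply/subsetPn; exists i; last by rewrite in_set /f' iD grp0.
  by have := subsetP (BO k) i; rewrite in_set; apply; case/setDP: iD.
(* From n < out f + l and out f <= n - 2. *)
have l3 : (3 <= l)%N by lia.
pose q := (n - l + 1)%N.
have q_le : (q <= out f)%N by rewrite /q; lia.
(* For k < q at least [l] positions remain, so [U k] is a whole coset of [L]. The last one has only
   l - 1 positions left and is estimated by [olson]. *)
pose U (k : 'I_q.+1) := (tau k) +: nsum (n - k) Z.
have sUL (k : 'I_q.+1) g : g \in U k -> g - tau k \in L.
  by rewrite mem_translate; apply: (subsetP (nsum_sub_gen _ _)).
have bound : (\sum_k #|U k| <= #|X|)%N.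
  apply: sum_card_disjoint => [k|j k g].
    apply/subsetP => y; rewrite mem_translate => yn.
    rewrite -(subrK (tau k) y) addrC; apply: sumD; rewrite cB //.
    by have := ltn_ord k; lia.
  move=> /sUL Lj /sUL Lk; have Ljk := grpB gL Lj Lk; have Lkj := grpB gL Lk Lj.
  apply: val_inj => /=; case: (ltngtP (j : nat) (k : nat)) => // lt.
    have := tau_inj j k lt; have kq := ltn_ord k; rewrite (_ : (k <= out f)%N); last by lia.
    by move=> /(_ isT) /negP []; zmem_from Ljk.
  have := tau_inj k j lt; have jq := ltn_ord j; rewrite (_ : (j <= out f)%N); last by lia.
  by move=> /(_ isT) /negP []; zmem_from Lkj.
have cU : (\sum_k #|U k| = q * #|L| + #|nsum l.-1 Z|)%N.
  rewrite big_ord_recr /= card_translate; congr (_ + _)%N; last first.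
    by have -> : (n - @ord_max q = l.-1)%N by rewrite /= /q; lia.
  transitivity (\sum_(k < q) #|L|)%N; last by rewrite sum_nat_const card_ord.
  apply: eq_bigr => k _.
  by rewrite card_translate nsum_full //=; have := ltn_ord k; rewrite /q; lia.
have not_full j : (j < l)%N -> nsum j Z != L.
  by move=> lt_j; apply: contraTneq lt_j => /min_l; rewrite -leqNgt.
have ols j : (j.+1 < l)%N -> (j.+2 * #|Z| <= 2 * #|nsum j.+1 Z|)%N.
  elim: j => [|j IH] lt_j; first by rewrite nsum1.
  have neq := not_full _ lt_j; rewrite nsumSr in neq *.
  have Zn0 : Z != set0 by apply/set0Pn; exists 0.
  have := olson (nsum_neq0 j.+1 Zn0) Z0 (nsum_sub_gen _ _) neq.
  have := IH (ltnW lt_j); rewrite [in X in _ -> _ -> X]mulSn.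
  by clia.
(* Otherwise pigeonhole would already give (l - 1)Z = L. *)
have y2 : (#|Z| + #|nsum l.-2 Z| <= #|L|)%N.
  rewrite leqNgt; apply/negP => lt_L.
  have := not_full l.-1 _; rewrite (_ : l.-1 = l.-2.+1); last by lia.
  have -> : (l.-2.+1 < l)%N by lia.
  have s0 (A : {set G}) : A \subset L -> A \subset 0 +: L by rewrite translate0.
  rewrite nsumS (sumset_full gL (s0 Z sZL) (s0 _ (nsum_sub_gen l.-2 Z)) lt_L).
  by rewrite addr0 translate0 eqxx => /(_ isT).
move: bound; rewrite cU => bound; apply: leq_trans bound.
have [l' lE] : exists l', l = l'.+3 by exists (l - 3)%N; lia.
have o1 : (l * #|Z| <= 2 * #|nsum l.-1 Z|)%N by rewrite lE; apply: (ols l'.+1); lia.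
have o2 : (l.-1 * #|Z| <= 2 * #|nsum l.-2 Z|)%N by rewrite lE; apply: (ols l'); lia.
have nE : n = (q + l.-1)%N by rewrite /q; lia.
have q0 : (0 < q)%N by rewrite /q; lia.
rewrite [n in (_ * n)%N]nE [X in (q + X)%N](_ : _ = (l' + 2)%N); last by lia.
rewrite lE in o1 o2 y2 *; apply: full_arith q0 _ _ y2.
  by rewrite addn3.
by rewrite addn2.
Qed.

End Outside.

(** * Atoms and critical pairs *)

Section Atoms.
Variable G : finZmodType.
Implicit Types (A B D H L M P U V W X Z : {set G}) (a b g x y z : G).

Definition sidon U : Prop := forall g, g != 0 -> (#|U :&: (g +: U)| <= 1)%N.

Lemma sumset1 A g : A :+: [set g] = g +: A.
Proof. by rewrite sumsetC translateE. Qed.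

(* U is an atom: it minimizes |A + Z| - |A| over the admissible sets A, and is
   smallest among the minimizers. *)
Lemma atom_exists L Z B : subgrp L -> Z \subset L -> Z != set0 ->
    B \subset L -> (1 < #|B|)%N -> (#|B :+: Z| + 2 <= #|L|)%N ->
  exists U, [/\ U \subset L, 0 \in U, (1 < #|U|)%N, (#|U :+: Z| + 2 <= #|L|)%N &
    (#|U :+: Z| + #|B| <= #|U| + #|B :+: Z|)%N /\ (subgrp U \/ sidon U)].
Proof.
move=> gL sZL Z0 sBL B1 BZ.
(* Two points are required in [A] and also in the complement of A + Z; the second condition makes
   the dual set below admissible. *)
pose sep A := [/\ A \subset L, (1 < #|A|)%N & (#|A :+: Z| + 2 <= #|L|)%N].
have sepB : sep B by [].
have [|A0 [sepA0 min_k]] := @ex_min_nat _ sep (fun A => #|A :+: Z| - #|A|)%N.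
  by exists B.
pose k := (#|A0 :+: Z| - #|A0|)%N.
have k_le A : sep A -> (#|A| + k <= #|A :+: Z|)%N.
  by move=> sA; have := min_k A sA; have := leq_card_sumset A Z0; rewrite -/k; lia.
have [|U [[sepU kU] min_U]] :=
    @ex_min_nat _ (fun A => sep A /\ #|A :+: Z| = (#|A| + k)%N) (fun A => #|A|).
  by exists A0; split=> //; rewrite subnKC // leq_card_sumset.
have {}min_U A : sep A -> #|A :+: Z| = (#|A| + k)%N -> (#|U| <= #|A|)%N by move=> *; apply: min_U.
wlog U0 : U sepU kU min_U / 0 \in U.
  move=> W; have [sUL U1 UZ] := sepU.
  have /card_gt0P [u Uu] : (0 < #|U|)%N by lia.
  apply: (W ((- u) +: U)).
  - split; rewrite ?card_translate ?sumset_translate ?card_translate //.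
    apply/subsetP => x; rewrite mem_translate => Ux.
    have Lx := subsetP sUL _ Ux; have Lu := subsetP sUL _ Uu.
    by have Ld := grpB gL Lx Lu; zmem_from Ld.
  - by rewrite sumset_translate !card_translate.
  - by move=> A sA kA; rewrite card_translate; apply: min_U.
  - by rewrite mem_translate; zmem_from Uu.
have [sUL U1 UZ] := sepU.
exists U; split=> //; split.
  by rewrite kU; have := k_le B sepB; lia.
have sUZ : U :+: Z \subset L by apply: sumset_sub_grp.
(* The opposites [W] of the points outside U + Z form another minimizer, since W + Z avoids the
   opposites of [U]. As |W| = |L| - |U| - k, minimality of |U| gives the bound. *)
have dual : (2 * #|U| + k <= #|L|)%N.
  pose W : {set G} := [set - d | d in L :\: (U :+: Z)].
  have cW : #|W| = (#|L| - #|U :+: Z|)%N.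
    by rewrite card_imset; [rewrite card_subset_sub|exact: oppr_inj].
  have sWZ : W :+: Z \subset L :\: [set - u | u in U].
    apply/subsetP => _ /sumsetP [_ [z [/imsetP [d /setDP [Ld dUZ] ->] Zz ->]]].
    rewrite inE andbC; apply/andP; split.
      by apply: grpD; rewrite ?grpN // (subsetP sZL).
    apply/negP => /imsetP [u Uu E]; case/negP: dUZ.
    have -> : d = u + z; last exact: mem_sumset.
    by rewrite -[u]opprK -E opprD opprK subrK.
  have sNU : [set - u | u in U] \subset L.
    by apply/subsetP => _ /imsetP [u Uu ->]; rewrite grpN // (subsetP sUL).
  have cWZ := subset_leq_card sWZ; rewrite (card_subset_sub sNU) card_imset in cWZ;
    last exact: oppr_inj.
  have le_UL := subset_leq_card sUL.
  have sepW : sep W.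
    split; last by move: cWZ U1 le_UL; clia.
      apply/subsetP => _ /imsetP [d /setDP [Ld _] ->]; by rewrite grpN.
    by rewrite cW; move: UZ; clia.
  have kW : #|W :+: Z| = (#|W| + k)%N.
    apply/eqP; rewrite eqn_leq k_le // andbT; move: cWZ cW kU UZ le_UL; clia.
  by have := min_U W sepW kW; move: cW kU UZ; clia.
(* Submodularity: a proper intersection with two points is not a minimizer, by minimality of |U|, so
   the union, admissible by [dual], would beat the minimum [k]. *)
have inter g : g \in L -> (1 < #|U :&: (g +: U)|)%N -> U :&: (g +: U) = U.
  move=> Lg; set I := U :&: _ => I1; apply/eqP/negPn/negP => neq.
  have sIU : I \subset U by apply: subsetIl.
  have lt_I : (#|I| < #|U|)%N by apply: proper_card; rewrite properEneq neq.
  have sepI : sep I.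
    split=> //; first exact: subset_trans sIU sUL.
    by apply: leq_trans UZ; rewrite leq_add2r subset_leq_card // sumsetSl.
  have kI : (#|I| + k + 1 <= #|I :+: Z|)%N.
    have := k_le I sepI; rewrite leq_eqVlt => /orP [/eqP E|]; last by clia.
    by have := min_U I sepI (esym E); move: lt_I; clia.
  have cU : (#|U :|: (g +: U)| + #|I| = 2 * #|U|)%N.
    by rewrite cardsUI card_translate; clia.
  have cUZ : (#|(U :|: (g +: U)) :+: Z| + #|I :+: Z| <= 2 * #|U :+: Z|)%N.
    rewrite sumsetUl sumset_translate.
    have := cardsUI (U :+: Z) (g +: (U :+: Z)); rewrite card_translate.
    have : I :+: Z \subset (U :+: Z) :&: (g +: (U :+: Z)).
      rewrite subsetI sumsetSl //= -sumset_translate sumsetSl //; exact: subsetIr.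
    by move/subset_leq_card; clia.
  have sepW : sep (U :|: (g +: U)).
    split; last by move: cUZ kI I1 dual kU; clia.
      rewrite subUset sUL /=; apply/subsetP => x; rewrite mem_translate => /(subsetP sUL) Lx.
      by have Ls := grpD gL Lx Lg; zmem_from Ls.
    by apply: leq_trans U1 _; rewrite subset_leq_card // subsetUl.
  by have := k_le _ sepW; move: cUZ cU kI kU; clia.
have stabI g : g \in L -> (1 < #|U :&: (g +: U)|)%N -> g \in stab U.
  move=> Lg /(inter g Lg) /setIidPl sU.
  by rewrite in_stab eq_sym eqEcard card_translate leqnn sU.
have [[g [g0 Ug]]|no_g] := classic (exists g, g != 0 /\ (1 < #|U :&: (g +: U)|)%N); last first.
  by right=> g g0; rewrite leqNgt; apply/negP => Ug; apply: no_g; exists g.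
left; have Lg : g \in L.
  have /card_gt0P [y] : (0 < #|U :&: (g +: U)|)%N by apply: ltnW.
  rewrite inE mem_translate => /andP [/(subsetP sUL) Ly /(subsetP sUL) Lyg].
  by have Ld := grpB gL Ly Lyg; zmem_from Ld.
have gU := stabI g Lg Ug; set P := stab U in gU.
suff -> : U = P by apply: subgrp_stab.
have sPU : P \subset U.
  by apply/subsetP => x xP; rewrite -[x]addr0 stabD.
apply/eqP; rewrite eqEsubset sPU andbT; apply/subsetP => u Uu.
apply: stabI; first exact: (subsetP sUL).
have sub : u +: P \subset U :&: (u +: U).
  rewrite subsetI translateS sPU andbT; apply/subsetP => x; rewrite mem_translate => xP.
  by rewrite -(subrK u x) stabD.
apply: leq_trans (subset_leq_card sub); rewrite card_translate.
apply/card_gt1P; exists 0, g; split=> //; last by rewrite eq_sym.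
by apply: grp0; apply: subgrp_stab.
Qed.

Lemma sidon_two U V : sidon U -> (1 < #|V|)%N -> (2 * #|U| <= #|U :+: V| + 1)%N.
Proof.
move=> sU /card_gt1P [x [y [Vx Vy xy]]].
have sub : (x +: U) :|: (y +: U) \subset U :+: V.
  by rewrite [U :+: V]sumsetC subUset !subset_sumsetl.
have := subset_leq_card sub; rewrite cardsU !card_translate.
have : (#|(x +: U) :&: (y +: U)| <= 1)%N.
  apply: leq_trans (sU (y - x) _); last by rewrite subr_eq0 eq_sym.
  rewrite -(card_translate (- x)) subset_leq_card //; apply/subsetP => z.
  rewrite mem_translate !inE !mem_translate => /andP [H1 H2].
  by apply/andP; split; [zmem_from H1|zmem_from H2].
by clia.
Qed.

Lemma sidon_three U V : sidon U -> (2 < #|V|)%N -> (3 * #|U| <= #|U :+: V| + 3)%N.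
Proof.
move=> sU /card_gt2P [x [y [z [[Vx Vy Vz] [xy yz zx]]]]].
have int a b : a != b -> (#|(a +: U) :&: (b +: U)| <= 1)%N.
  move=> ab; apply: leq_trans (sU (b - a) _); last by rewrite subr_eq0 eq_sym.
  rewrite -(card_translate (- a)) subset_leq_card //; apply/subsetP => c.
  rewrite mem_translate !inE !mem_translate => /andP [H1 H2].
  by apply/andP; split; [zmem_from H1|zmem_from H2].
have sub : (x +: U) :|: (y +: U) :|: (z +: U) \subset U :+: V.
  by rewrite [U :+: V]sumsetC !subUset !subset_sumsetl.
have := subset_leq_card sub; rewrite cardsU cardsU !card_translate setIUl.
have := int x y xy; have := int y z yz; have := int z x zx; rewrite [(z +: U) :&: _]setIC.
move: (cardsU ((x +: U) :&: (z +: U)) ((y +: U) :&: (z +: U))).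
have := leq_card_setU ((x +: U) :&: (z +: U)) ((y +: U) :&: (z +: U)).
by clia.
Qed.

(** Only a nontrivial stabilizer [P] could lower the growth. But then |U + P| is at least 2|P|, as
    [U] is not inside [P], and at least 2|U| - 1 by [sidon_two], hence at least |U| + |P|, which
    makes up for the loss in Kneser. *)
Lemma sidon_growth A U : sidon U -> 0 \in U -> A != set0 ->
  (#|A :+: U| < #|gen U|)%N -> (#|A| + #|U| <= #|A :+: U| + 1)%N.
Proof.
move=> sU U0 A0 lt_W; have Un0 : U != set0 by apply/set0Pn; exists 0.
have := kneser A0 Un0; set P := stab _; have gP : subgrp P := subgrp_stab _.
have P0 : P != set0 by apply/set0Pn; exists 0; apply: grp0.
have HA := leq_card_sumset A P0; have HU := leq_card_sumset U P0 => HK.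
have [P1|P1] := leqP #|P| 1; first by move: HA HU HK P1; clia.
have UP : ~~ (U \subset P).
  apply/negP => sUP; have := subset_leq_card (gen_min gP sUP).
  by have := card_stab_le (sumset_neq0 A0 Un0); rewrite -/P; move: lt_W; clia.
have := two_cosets gP U0 UP; have := sidon_two sU P1; move: HA HU HK; clia.
Qed.

End Atoms.

Section CosetParts.
Variables (G Q : finZmodType) (p : {additive G -> Q}) (W : {set G}).
Hypotheses (gW : subgrp W) (p_surj : forall q, exists x, p x = q).
Hypothesis p_ker : forall x, (p x == 0) = (x \in W).
Implicit Types (A U Z : {set G}).

Definition part A (q : Q) : {set G} := [set x in A | p x == q].

Lemma part_coset A z : part A (p z) = A :&: (z +: W).
Proof. by apply/setP => x; rewrite !inE (quo_eq p_ker) mem_translate. Qed.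

Lemma card_parts A Z : A \subset Z :+: W -> #|A| = (\sum_(q in p @: Z) #|part A q|)%N.
Proof.
move=> sA; rewrite -sum1_card (partition_big p [in p @: Z]) /= => [|x Ax].
  by apply: eq_bigr => q _; rewrite -sum1_card; apply: eq_bigl => x; rewrite !inE.
by rewrite -(mem_sumset_quo p_ker) (subsetP sA).
Qed.

Lemma part_sumset A U q : U \subset W -> part (A :+: U) q = part A q :+: U.
Proof.
move=> sU; have pU u : u \in U -> p u = 0.
  by move=> Uu; apply/eqP; rewrite p_ker (subsetP sU).
apply/setP => x; apply/idP/idP.
  rewrite inE => /andP [/sumsetP [a [u [Aa Uu ->]]]]; rewrite raddfD (pU u Uu) addr0 => pa.
  by rewrite mem_sumset // inE Aa.
move=> /sumsetP [a [u [/setIdP [Aa pa] Uu ->]]].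
by rewrite inE mem_sumset //= raddfD (pU u Uu) addr0.
Qed.

Lemma part_neq0 Z q : q \in p @: Z -> part Z q != set0.
Proof. by case/imsetP => z Zz ->; apply/set0Pn; exists z; rewrite inE Zz /=. Qed.

Lemma card_part_le A q : (#|part A q| <= #|W|)%N.
Proof.
rewrite -(card_fibre p_surj p_ker q); apply: subset_leq_card.
by apply/subsetP => x; rewrite !inE => /andP [].
Qed.

End CosetParts.

Section Critical.
Variable G : finZmodType.
Implicit Types (A B D H L M P U V W X Z : {set G}) (a b g x y z : G).

(** The only way in which [holes_bound] leaves two cosets incomplete. For U = {0, x} the last clause
    makes the two incomplete parts of [Z] progressions of difference x. *)
Definition two_defects Z U W z1 z2 : Prop :=
  [/\ z1 \in Z, z2 \in Z, z2 - z1 \notin W,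
      forall z, z \in Z -> z \notin z1 +: W -> z \notin z2 +: W -> z +: W \subset Z &
   forall i, i = z1 \/ i = z2 -> (#|Z :&: (i +: W)| + 1 < #|W|)%N /\
     #|(Z :&: (i +: W)) :+: U| = (#|Z :&: (i +: W)| + 1)%N].

(** By [sidon_growth] a coset that Z + U does not fill gains at least |U| - 1 points. The total gain
    is at most |U| - 1 + mu, so there is at most one such coset, or two when |U| = 2 and mu = 1. *)
Lemma holes_bound Z U mu : sidon U -> 0 \in U -> (1 < #|U|)%N -> (mu <= 1)%N ->
    (#|Z :+: U| + 1 <= #|Z| + #|U| + mu)%N ->
  (#|Z :+: gen U| + 1 <= #|Z| + #|gen U| + mu)%N \/
  [/\ mu = 1%N, #|U| = 2%N & exists z1 z2, two_defects Z U (gen U) z1 z2].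
Proof.
move=> sU U0 U1 mu1 ZU; set W := gen U; have gW : subgrp W := subgrp_gen U.
have sUW : U \subset W := sub_gen U.
have [Q [p [p_surj p_ker]]] := quotient_exists gW.
pose R := p @: Z; pose z q := #|part p Z q|; pose c q := #|part p (Z :+: U) q|.
have W0 := grp0 gW.
have cZ : #|Z| = (\sum_(q in R) z q)%N.
  by apply: (card_parts p_ker); apply: subset_sumsetr.
have cZU : #|Z :+: U| = (\sum_(q in R) c q)%N.
  by apply: (card_parts p_ker); apply: sumsetS.
have cZW : #|Z :+: W| = (\sum_(q in R) #|W|)%N.
  by rewrite (card_sumset_quo p_surj p_ker) sum_nat_const mulnC.
have zc q : (z q <= c q)%N.
  rewrite /c (part_sumset p_ker) //; apply: leq_card_sumset.
  by apply/set0Pn; exists 0.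
have c_le q : (c q <= #|W|)%N := card_part_le p_surj p_ker _ _.
have grow q : q \in R -> (c q < #|W|)%N -> (z q + #|U| <= c q + 1)%N.
  move=> Rq; rewrite /c (part_sumset p_ker) // => lt_W.
  by apply: sidon_growth => //; apply: part_neq0.
have z_gt0 q : q \in R -> (0 < z q)%N by move=> Rq; rewrite card_gt0 part_neq0.
have U_le_W := subset_leq_card sUW.
have [[q1 [Rq1 F1]]|noF] := classic (exists q, q \in R /\ (c q < #|W|)%N); last first.
  left; have -> : #|Z :+: W| = #|Z :+: U|.
    rewrite cZW cZU; apply: eq_bigr => q Rq; apply/eqP; rewrite eqn_leq c_le andbT leqNgt.
    by apply/negP => F; apply: noF; exists q.
  by move: ZU U_le_W; clia.
have g1 := grow _ Rq1 F1.
have [[q2 [Rq2 F2 q21]]|noF] := classic (exists q, [/\ q \in R, (c q < #|W|)%N & q != q1]);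
    last first.
  left; have cR : (\sum_(q in R | q != q1) #|W| = \sum_(q in R | q != q1) c q)%N.
    apply: eq_bigr => q /andP [Rq qq1]; apply/eqP; rewrite eqn_leq c_le andbT leqNgt.
    by apply/negP => F; apply: noF; exists q.
  have cZU1 : #|Z :+: U| = (c q1 + \sum_(q in R | q != q1) c q)%N.
    by rewrite cZU (bigD1 q1).
  have cZW1 : #|Z :+: W| = (#|W| + \sum_(q in R | q != q1) c q)%N.
    by rewrite cZW (bigD1 q1) //= cR.
  rewrite cZW1; move: ZU (z_gt0 _ Rq1) g1; rewrite cZU1.
  by move: (\sum_(q in R | _) _)%N => s; clia.
right; have g2 := grow _ Rq2 F2.
have c2E : #|Z :+: U| = (c q1 + (c q2 + \sum_(q in R | (q != q1) && (q != q2)) c q))%N.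
  rewrite cZU (bigD1 q1) //= (bigD1 q2) /= ?Rq2 //; congr (_ + (_ + _))%N.
  by apply: eq_bigl => q; rewrite andbA.
have z2E : #|Z| = (z q1 + (z q2 + \sum_(q in R | (q != q1) && (q != q2)) z q))%N.
  rewrite cZ (bigD1 q1) //= (bigD1 q2) /= ?Rq2 //; congr (_ + (_ + _))%N.
  by apply: eq_bigl => q; rewrite andbA.
have rest : (\sum_(q in R | (q != q1) && (q != q2)) z q <=
    \sum_(q in R | (q != q1) && (q != q2)) c q)%N by apply: leq_sum => q _.
have mu_eq : mu = 1%N by move: ZU g1 g2 rest; rewrite c2E z2E; clia.
have U2 : #|U| = 2%N by move: ZU g1 g2 rest; rewrite c2E z2E; clia.
split=> //.
have rest_full q : q \in R -> q != q1 -> q != q2 -> z q = #|W|.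
  move=> Rq qq1 qq2.
  have zcE : c q = z q.
    apply/eqP; rewrite eqn_leq zc andbT leqNgt; apply/negP => lt_q.
    have Pq : [&& q \in R, q != q1 & q != q2] by rewrite Rq qq1.
    move: ZU g1 g2; rewrite c2E z2E (bigD1 q) //= [in X in (_ <= X)%N -> _](bigD1 q) //=.
    have : (\sum_(r | [&& r \in R, r != q1 & r != q2] && (r != q)) z r <=
      \sum_(r | [&& r \in R, r != q1 & r != q2] && (r != q)) c r)%N by apply: leq_sum => r _.
    move: lt_q U2 mu1; move: (\sum_(r | _) z r)%N (\sum_(r | _) c r)%N => s1 s2.
    by move: (c q) (c q1) (c q2) (z q) (z q1) (z q2); clia.
  apply/eqP; rewrite -zcE eqn_leq c_le leqNgt; apply/negP => lt_W.
  by have := grow _ Rq lt_W; rewrite zcE U2; clia.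
case/imsetP: (Rq1) => z1 Zz1 q1E; case/imsetP: (Rq2) => z2 Zz2 q2E.
exists z1, z2; split=> //.
- by rewrite -(quo_eq p_ker) -q1E -q2E.
- move=> y Zy; rewrite !mem_translate -!(quo_eq p_ker) -q1E -q2E => y1 y2.
  have := rest_full (p y) (imset_f p Zy) y1 y2.
  rewrite /z (part_coset p_ker) => E.
  have : Z :&: (y +: W) == y +: W.
    by rewrite eqEcard subsetIr card_translate E leqnn.
  by move/eqP => <-; apply: subsetIl.
have both q y : q \in R -> (c q < #|W|)%N -> q = p y -> (z q + 1 = c q)%N ->
    (#|Z :&: (y +: W)| + 1 < #|W|)%N /\
     #|(Z :&: (y +: W)) :+: U| = (#|Z :&: (y +: W)| + 1)%N.
  move=> Rq Fq qE; rewrite -(part_coset p_ker) -qE => E.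
  by rewrite -(part_sumset p_ker) // -/(z q) E.
have e1 : (z q1 + 1 = c q1)%N by move: ZU g1 g2 rest; rewrite c2E z2E; clia.
have e2 : (z q2 + 1 = c q2)%N by move: ZU g1 g2 rest; rewrite c2E z2E; clia.
by move=> i [->|->]; [apply: both q1E e1|apply: both q2E e2].
Qed.

Lemma gen_set2 x : gen [set 0; x] = gen [set x].
Proof.
apply/eqP; rewrite eqEsubset !gen_sub ?subgrp_gen //; apply/andP; split.
  by rewrite subUset !sub1set (grp0 (subgrp_gen _)) -sub1set sub_gen.
by apply: subset_trans (sub_gen _); rewrite subsetUr.
Qed.

(* A 2-atom U of Z is a subgroup or a Sidon set; in the latter case Z either
   has few holes modulo the group generated by U, or U generates the same group
   as Z and a 2-atom of U bounds |U|. *)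
Lemma critical_structure Z B mu : 0 \in Z -> (1 < #|Z|)%N -> (mu <= 1)%N ->
    B \subset gen Z -> (1 < #|B|)%N -> (#|B :+: Z| + 2 <= #|gen Z|)%N ->
    (#|B :+: Z| + 1 <= #|B| + #|Z| + mu)%N ->
  [\/ exists M, [/\ subgrp M, (1 < #|M|)%N, M \subset gen Z, M != gen Z &
        (#|Z :+: M| + 1 <= #|Z| + #|M| + mu)%N],
      exists x, gen Z = gen [set x] |
      mu = 1%N /\
      ((exists x z1 z2, [/\ gen [set x] \subset gen Z, gen [set x] != gen Z, x != 0 &
         two_defects Z [set 0; x] (gen [set x]) z1 z2]) \/
       (exists U, [/\ gen U = gen Z, #|U| = 3%N, 0 \in U & (#|Z :+: U| <= #|Z| + 3)%N]))].
Proof.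
move=> Z0 Z1 mu1 sB B1 BL BZ; set L := gen Z in sB BL *.
have gL : subgrp L := subgrp_gen Z; have sZL : Z \subset L := sub_gen Z.
have Zn0 : Z != set0 by apply/set0Pn; exists 0.
have [U [sUL U0 U1 UL [UB dich]]] := atom_exists gL sZL Zn0 sB B1 BL.
have ZU : (#|Z :+: U| + 1 <= #|Z| + #|U| + mu)%N.
  by rewrite sumsetC; move: UB BZ; clia.
have pairU : #|U| = 2%N -> exists2 x, x != 0 & U = [set 0; x].
  move/eqP/cards2P => [a [b [ab UE]]]; move: U0; rewrite UE !inE => /orP [] /eqP E.
    by exists b; rewrite E // eq_sym.
  by exists a; rewrite E // setUC.
case: dich => [gU|sU].
  constructor 1; exists U; split=> //.
  apply/negP => /eqP UE; have := leq_card_sumset U Zn0; move: UL; rewrite UE; clia.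
have [WL|WL] := eqVneq (gen U) L; last first.
  have sWL : gen U \subset L by apply: gen_min.
  have [holes|[mu_eq U2 [z1 [z2 defs]]]] := holes_bound sU U0 U1 mu1 ZU.
    constructor 1; exists (gen U); split=> //; first exact: subgrp_gen.
    by apply: leq_trans U1 (subset_leq_card (sub_gen U)).
  constructor 3; split=> //; left; have [x x0 UE] := pairU U2.
  by exists x, z1, z2; rewrite -gen_set2 -UE.
have Un0 : U != set0 by apply/set0Pn; exists 0.
have ZUL : (#|Z :+: U| + 2 <= #|L|)%N by rewrite sumsetC.
have [V [sVL V0 V1 VL [VB dichV]]] := atom_exists gL sUL Un0 sZL Z1 ZUL.
have VU : (#|U :+: V| + 1 <= #|V| + #|U| + mu)%N by rewrite sumsetC; move: VB ZU; clia.
have V2 := sidon_two sU V1.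
(* [V] is an atom for [U]. If it is a subgroup, [U] meets two of its cosets; if it is a Sidon set,
   [sidon_three] applies in both roles. Either way U + V grows too much for larger [U]. *)
have U_small : #|U| = 2%N \/ #|U| = 3%N /\ mu = 1%N.
  case: dichV => [gV|sV].
    have UV : ~~ (U \subset V).
      apply/negP => /(gen_min gV); rewrite WL => sLV.
      have := leq_trans (subset_leq_card sLV) (leq_card_sumset V Un0).
      by rewrite leqNgt (leq_trans _ VL) // addn2.
    have V3 := two_cosets gV U0 UV.
    have [V_3|V_2] := ltnP 2 #|V|.
      by have := sidon_three sU V_3; move: U1 mu1 VU V2 V3; clear; clia.
    by move: V_2 U1 mu1 VU V2 V3 V1; clear; clia.
  have U2 := sidon_two sV U1; rewrite sumsetC in U2.
  have [V_3|V_2] := ltnP 2 #|V|; last by move: V_2 U1 mu1 VU V2 V1; clear; clia.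
  have [U_3|U_2] := ltnP 2 #|U|; last by left; move: U_2 U1; clear; clia.
  have := sidon_three sU V_3; have := sidon_three sV U_3; rewrite [V :+: U]sumsetC.
  by move: U_3 V_3 mu1 VU V2 U2; clear; clia.
case: U_small => [U2|[U3 mu_eq]].
  have [x _ UE] := pairU U2; constructor 2; exists x.
  by rewrite -gen_set2 -UE.
constructor 3; split=> //; right; exists U; split=> //.
by move: ZU; rewrite U3 mu_eq; clia.
Qed.

End Critical.

(** * Iterated sums below a multiple of the exponent *)

Section Cyclic.
Variable G : finZmodType.
Implicit Types (A B M Z : {set G}) (x y : G).

Lemma gen1_exists x : exists o, [/\ (0 < o)%N, x *+ o = 0, #|gen [set x]| = o,
   forall y, y \in gen [set x] -> exists2 j, (j < o)%N & y = x *+ j &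
   forall i j, (i < o)%N -> (j < o)%N -> x *+ i = x *+ j -> i = j].
Proof.
have exo : exists o, (0 < o)%N && (x *+ o == 0).
  pose f (i : 'I_#|G|.+1) := x *+ i.
  have /injectivePn [i [j ij fij]] : ~~ injectiveb f.
    apply/negP => /injectiveP /leq_card; rewrite card_ord.
    by rewrite ltnNge leqnn.
  wlog lt_ij : i j ij fij / (i < j)%N => [wl|].
    have := ij; rewrite -val_eqE neq_ltn => /orP [] lt_ij; first exact: (wl i j).
    by apply: (wl j i); rewrite // eq_sym.
  exists (j - i)%N; rewrite subn_gt0 lt_ij /=.
  by rewrite mulrnBr 1?ltnW //; move: fij; rewrite /f => ->; rewrite subrr.
case: (ex_minnP exo) => o /andP [o0 /eqP xo] o_min.
have inj i j : (i < o)%N -> (j < o)%N -> x *+ i = x *+ j -> i = j.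
  wlog le_ij : i j / (i <= j)%N => [wl|] io jo E.
    by case/orP: (leq_total i j) => ij; [apply: wl|apply/esym; apply: wl].
  apply/eqP; rewrite eqn_leq le_ij /= -subn_eq0 -leqn0 leqNgt; apply/negP => ji.
  have := o_min (j - i)%N; rewrite ji /= mulrnBr // E subrr eqxx => /(_ isT).
  by rewrite leqNgt (leq_ltn_trans (leq_subr _ _) jo).
pose W := [set x *+ i | i : 'I_o].
have memW k : x *+ k \in W.
  have -> : x *+ k = x *+ (k %% o).
    by rewrite {1}(divn_eq k o) mulrnDr mulnC mulrnA xo mul0rn add0r.
  by apply/imsetP; exists (Ordinal (ltn_pmod k o0)).
have gW : subgrp W.
  apply/subgrpP; split=> [|u v]; first by rewrite -(mulr0n x).
  by move=> /imsetP [i _ ->] /imsetP [j _ ->]; rewrite -mulrnDr.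
have WE : gen [set x] = W.
  apply/eqP; rewrite eqEsubset gen_sub // sub1set -{1}[x]mulr1n memW /=.
  apply/subsetP => _ /imsetP [i _ ->]; apply: grpMn; first exact: subgrp_gen.
  by rewrite -sub1set sub_gen.
exists o; split=> //.
  rewrite WE card_imset ?card_ord // => i j E; apply: val_inj.
  exact: inj (ltn_ord i) (ltn_ord j) E.
by rewrite WE => y /imsetP [i _ ->]; exists i.
Qed.

Lemma card_gen1 x E : (0 < E)%N -> x *+ E = 0 -> (#|gen [set x]| <= E)%N.
Proof.
move=> E0 xE; have [o [o0 xo -> _ inj]] := gen1_exists x.
rewrite leqNgt; apply/negP => Eo.
by have := inj E 0%N Eo o0; rewrite xE mulr0n => /(_ erefl) E_0; rewrite E_0 in E0.
Qed.

Lemma card_nsum_pair x j : (minn #|gen [set x]| j.+1 <= #|nsum j [set 0%R; x]|)%N.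
Proof.
have [o [o0 xo -> _ inj]] := gen1_exists x.
have inj_f : injective (fun i : 'I_(minn o j.+1) => x *+ i).
  move=> i k /inj E; apply: val_inj; apply: E.
    exact: leq_trans (ltn_ord i) (geq_minl _ _).
  exact: leq_trans (ltn_ord k) (geq_minl _ _).
rewrite -[X in (X <= _)%N]card_ord -cardsT -(card_imset _ inj_f); apply: subset_leq_card.
apply/subsetP => _ /imsetP [i _ ->].
have ij : (i <= j)%N by rewrite -ltnS; apply: leq_trans (ltn_ord i) (geq_minr _ _).
apply: subsetP (nsum_subset _ ij) _ _; first by rewrite !inE eqxx.
by apply: mulrn_nsum; rewrite !inE eqxx orbT.
Qed.

Lemma nsum_pair_full x j : (#|gen [set x]| <= j.+1)%N -> nsum j [set 0%R; x] = gen [set x].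
Proof.
move=> le_j; apply/eqP; rewrite eqEcard; apply/andP; split.
  by rewrite -gen_set2 nsum_sub_gen.
by apply: leq_trans (card_nsum_pair x j); rewrite (minn_idPl le_j).
Qed.

Lemma nsum_kneser Z j : Z != set0 -> stab (nsum j Z) \subset [set 0%R] ->
  (j * #|Z| < #|nsum j Z| + j)%N.
Proof.
move=> Z0; have -> : nsum j Z = \Sum_(i <- index_enum 'I_j) Z.
  by rewrite -[\Sum_(i <- _) _]/(\Sum_(i : 'I_j | true) Z) nsum_bigsumset card_ord.
move=> /(bigsumset_kneser_seq (fun _ : 'I_j => Z0)).
by rewrite sum_nat_const card_ord -sum1_size sum1_card card_ord.
Qed.

Lemma stab_sub_grp A L : subgrp L -> A != set0 -> A \subset L -> stab A \subset L.
Proof.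
move=> gL /set0Pn [a Aa] sA; apply/subsetP => x xA.
by rewrite -(grpDr gL x (subsetP sA a Aa)) (subsetP sA) // stabD.
Qed.

(* The sums of n terms lying in at least two cosets are absorbed in pairs. *)
Lemma periodic_nsum M Z n : subgrp M -> 0 \in Z ->
    (forall y z, y \in Z -> z \in Z -> z - y \notin M -> (y + z) +: M \subset Z :+: Z) ->
    (forall y, y \in Z -> (y *+ n) +: M \subset nsum n Z) ->
  nsum n Z :+: M = nsum n Z.
Proof.
move=> gM Z0 pairs same; have M0 := grp0 gM.
(* Either two terms lie in different cosets and [pairs] provides a full coset, or all terms lie in a
   single coset y + M. *)
have key k u : u \in nsum k Z -> u +: M \subset nsum k Z \/ exists2 y, y \in Z & u - y *+ k \in M.
  elim: k u => [|k IH] u.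
    by rewrite nsum0 => /set1P ->; right; exists 0; rewrite // mulr0n subrr.
  rewrite nsumS => /sumsetP [z [u' [Zz u'k ->]]].
  have [sub|[y Zy u'y]] := IH _ u'k.
    left; apply: subset_trans (subset_sumsetl _ Zz).
    by rewrite translateD translateS.
  have [zy|zy] := boolP (z - y \in M).
    by right; exists y => //; have H := grpD gM zy u'y; rewrite mulrS; zmem_from H.
  case: k u'k u'y {IH} => [|k] u'k u'y.
    by right; exists z => //; move: u'k; rewrite nsum0 => /set1P ->; rewrite addr0 mulr1n subrr.
  left; have -> : (z + u') +: M = (y *+ k) +: ((y + z) +: M).
    apply/eqP; rewrite -translateD (coset_eq gM).
    by move: u'y; rewrite mulrSr => u'y; zmem_from u'y.
  rewrite -nsumS -[k.+2]addn2 nsumD.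
  apply: subset_trans (subset_sumsetl _ (mulrn_nsum k Zy)).
  by rewrite translateS nsumS nsum1; apply: pairs.
apply/eqP; rewrite eqEsubset [X in _ && X]subset_sumsetr // andbT.
apply/subsetP => _ /sumsetP [u [m [un Mm ->]]].
have sub : u +: M \subset nsum n Z.
  have [//|[y Zy uy]] := key _ _ un.
  by rewrite (eqP (_ : u +: M == (y *+ n) +: M)) ?same // (coset_eq gM).
by rewrite (subsetP sub) // mem_translate addrC addKr.
Qed.

End Cyclic.

Section ImageSums.
Variables (G Q : finZmodType) (p : {additive G -> Q}).
Implicit Types (Z : {set G}).

Lemma quo_nsum j Z : p @: nsum j Z = nsum j (p @: Z).
Proof.
elim: j => [|j IH]; last by rewrite !nsumS quo_sumset IH.
by rewrite !nsum0 imset_set1 raddf0.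
Qed.

Lemma quo_subgrp Z : subgrp Z -> subgrp (p @: Z).
Proof.
move=> gZ; apply/subgrpP; split=> [|u w].
  by rewrite -(raddf0 p) imset_f ?grp0.
by move=> /imsetP [a Za ->] /imsetP [b Zb ->]; rewrite -raddfD imset_f ?grpD.
Qed.

Lemma quo_gen Z : p @: gen Z = gen (p @: Z).
Proof.
apply/eqP; rewrite eqEsubset [X in _ && X]gen_sub ?quo_subgrp ?subgrp_gen //.
rewrite imsetS ?sub_gen // andbT.
have gY : subgrp [set x | p x \in gen (p @: Z)].
  apply/subgrpP; split=> [|u w]; first by rewrite inE raddf0 (grp0 (subgrp_gen _)).
  by rewrite !inE raddfD => pu pw; rewrite (grpD (subgrp_gen _)).
apply/subsetP => _ /imsetP [x Lx ->].
have : gen Z \subset [set x | p x \in gen (p @: Z)].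
  apply: gen_min => //; apply/subsetP => z Zz; rewrite inE.
  by rewrite (subsetP (sub_gen _)) // imset_f.
by move/subsetP/(_ x Lx); rewrite inE.
Qed.

End ImageSums.

Section Holes.
Variable G : finZmodType.
Implicit Types (A B M Z : {set G}) (x y z : G).

Lemma holes_sub M Z A : A \subset Z :+: M -> subgrp M ->
  (#|A| + #|Z| <= #|Z :+: M| + #|Z :&: A|)%N.
Proof.
move=> sA gM; rewrite addnC -cardsUI leq_add2r; apply: subset_leq_card.
by rewrite subUset sA subset_sumsetr // grp0.
Qed.

Lemma disjoint_cosets M y z : subgrp M -> z - y \notin M -> [disjoint y +: M & z +: M].
Proof.
move=> gM zy; rewrite -setI_eq0; apply/eqP/setP => x; rewrite in_setI in_set0 !mem_translate.
apply/negP => /andP [xy xz]; move/negP: zy; apply.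
by have H := grpB gM xy xz; zmem_from H.
Qed.

Lemma pair_holes M Z y z : subgrp M -> y \in Z -> z \in Z -> z - y \notin M ->
  (2 * #|M| + #|Z| <= #|Z :+: M| + (#|Z :&: (y +: M)| + #|Z :&: (z +: M)|))%N.
Proof.
move=> gM Zy Zz zy; have dis := disjoint_cosets gM zy.
have sA : (y +: M) :|: (z +: M) \subset Z :+: M by rewrite subUset !subset_sumsetl.
have := holes_sub sA gM; rewrite (cardsU (y +: M)) (disjoint_setI0 dis) cards0 subn0.
rewrite !card_translate mul2n -addnn => /leq_trans; apply; rewrite leq_add2l setIUr.
by rewrite cardsU leq_subr.
Qed.

Lemma pair_full M Z y z : subgrp M ->
    (#|M| < #|Z :&: (y +: M)| + #|Z :&: (z +: M)|)%N ->
  (y + z) +: M \subset nsum 2 Z.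
Proof.
move=> gM lt_M; rewrite nsumS nsum1.
by rewrite -(sumset_full gM (subsetIr Z _) (subsetIr Z _) lt_M) sumsetSS ?subsetIl.
Qed.

Lemma absorb M Z u w i j : u \in nsum i Z -> w +: M \subset nsum j Z ->
  (u + w) +: M \subset nsum (i + j) Z.
Proof.
move=> ui wj; rewrite nsumD; apply: subset_trans (subset_sumsetl _ ui).
by rewrite translateD translateS.
Qed.

End Holes.

Section Exponent.
Variables (G : finZmodType) (E : nat).
Hypotheses (E2 : (2 <= E)%N) (killE : forall x : G, x *+ E = 0).
Implicit Types (A B M P W Z : {set G}) (g x y z : G).

Lemma outer_coset M Z y : subgrp M -> 0 \in Z -> M \subset gen Z -> M != gen Z -> y \in Z ->
  exists2 b, b \in Z & b - y \notin M.
Proof.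
move=> gM Z0 sM ML Zy; apply: NNPP => no.
have all b : b \in Z -> b - y \in M.
  by move=> Zb; apply: contraT => nb; case: no; exists b.
have yM : y \in M by rewrite -(grpN gM) -[- y]add0r all.
move/negP: ML; apply; rewrite eqEsubset sM /= gen_sub //; apply/subsetP => b Zb.
by have H := grpD gM (all b Zb) yM; zmem_from H.
Qed.

(** With fewer than |M| holes, two different cosets hold together more than |M| points, so their sum
    is full. For n terms in one coset, either that coset is more than half full, or another coset b
    + M is, and E terms from the latter sum to all of [M] because [E] kills b. *)
Lemma few_holes_periodic M Z n : subgrp M -> 0 \in Z -> M \subset gen Z -> M != gen Z ->
    (#|Z :+: M| + 1 <= #|Z| + #|M|)%N -> (E <= n)%N ->
  nsum n Z :+: M = nsum n Z.
Proof.
move=> gM Z0 sM ML holes En.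
have big y z : y \in Z -> z \in Z -> z - y \notin M ->
    (#|M| < #|Z :&: (y +: M)| + #|Z :&: (z +: M)|)%N.
  by move=> Zy Zz zy; have := pair_holes gM Zy Zz zy; move: holes; clear; clia.
apply: periodic_nsum => // y => [z Zy Zz zy|Zy].
  by have := pair_full gM (big y z Zy Zz zy); rewrite nsumS nsum1.
have [b Zb by_M] := outer_coset gM Z0 sM ML Zy.
have [y_big|y_small] := ltnP #|M| (#|Z :&: (y +: M)| + #|Z :&: (y +: M)|).
  have := absorb (mulrn_nsum (n - 2) Zy) (pair_full gM y_big).
  by rewrite -mulr2n -mulrnDr subnK // (leq_trans E2).
have b_big : (#|M| < #|Z :&: (b +: M)| + #|Z :&: (b +: M)|)%N.
  by have := big y b Zy Zb by_M; move: y_small; clear; clia.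
have H := absorb (mulrn_nsum (E - 2) Zb) (pair_full gM b_big).
rewrite -mulr2n -mulrnDr subnK // killE in H.
have := absorb (mulrn_nsum (n - E) Zy) H.
by rewrite addr0 subnK // mulrnBr // killE subr0.
Qed.

(* This occurs for n = E only, for instance when n = E = 2 and Z is a generic
   system of representatives modulo {0, g}. *)
Definition exotic n Z : Prop :=
  [/\ #|gen Z| = (n * #|Z|)%N, stab (nsum n Z) \subset [set 0],
      forall j, (0 < j < n)%N -> #|nsum j Z| = (j * #|Z|)%N &
      exists2 g, g \in gen Z & nsum n Z = gen Z :\ g].

(** If every step from jZ to (j + 1)Z gains |Z|, the bound follows. A smaller gain makes (jZ, Z)
    critical with mu = 0. Unless (j + 1)Z misses a single point of [L], [critical_structure] makes
    nZ periodic or [L] cyclic of order at most E, both impossible. In the remaining case the next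
    step would fill [L], so j + 1 = n. *)
Lemma nsum_dichotomy Z n : 0 \in Z -> (1 < #|Z|)%N -> (E <= n)%N ->
    stab (nsum n Z) \subset [set 0] ->
  (n * #|Z| <= #|nsum n Z|)%N \/ exotic n Z.
Proof.
move=> Z0 Z1 En ap; set L := gen Z; have gL : subgrp L := subgrp_gen Z.
have n0 : (0 < n)%N by apply: leq_trans En; apply: leq_trans E2.
have Zn0 : Z != set0 by apply/set0Pn; exists 0.
have sub j : nsum j Z \subset L := nsum_sub_gen j Z.
have L1 : (1 < #|L|)%N := leq_trans Z1 (subset_leq_card (sub_gen Z)).
have notL j : (j <= n)%N -> nsum j Z != L.
  move=> jn; apply/eqP => jL; have := subset_trans (stab_nsum Z jn) ap.
  rewrite jL (stab_grp gL) => /subset_leq_card; rewrite cards1.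
  by rewrite leqNgt L1.
have near j : (0 < j < n)%N -> (#|nsum j.+1 Z| < #|nsum j Z| + #|Z|)%N ->
    j.+1 = n /\ #|nsum n Z|.+1 = #|L|.
  move=> /andP [j0 jn] small.
  have [BL|BL] := leqP (#|nsum j Z :+: Z| + 2) #|L|.
    have B1 : (1 < #|nsum j Z|)%N.
      by apply: leq_trans Z1 (subset_leq_card _); rewrite -{1}(nsum1 Z) nsum_subset.
    have small0 : (#|nsum j Z :+: Z| + 1 <= #|nsum j Z| + #|Z| + 0)%N.
      by rewrite -nsumSr addn1 addn0.
    case: (critical_structure Z0 Z1 (leq0n 1) (sub j) B1 BL small0).
    - move=> [M [gM M1 sM ML holes]]; exfalso.
      have := few_holes_periodic gM Z0 sM ML _ En; rewrite -[X in (_ <= X)%N]addn0 => /(_ holes) pM.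
      have : M \subset stab (nsum n Z) by rewrite (sub_stab_grp _ gM) pM.
      move/subset_trans/(_ ap)/subset_leq_card; rewrite cards1.
      by rewrite leqNgt M1.
    - move=> [x Lx]; exfalso; have := nsum_kneser Zn0 ap.
      have := subset_leq_card (sub n).
      have := card_gen1 (ltnW E2) (killE x); rewrite -Lx -/L.
      have := leq_mul (leqnn n) Z1; move: En.
      by move: (n * #|Z|)%N #|L| #|nsum n Z| => a b c; clear; lia.
    - by case.
  rewrite -nsumSr in BL.
  have eqL : #|nsum j.+1 Z|.+1 = #|L|.
    have : (#|nsum j.+1 Z| < #|L|)%N by rewrite proper_card // properEneq notL // sub.
    by move: BL; clear; clia.
  have jE : j.+1 = n.
    apply/eqP; rewrite eqn_leq jn leqNgt; apply/negP => lt_jn.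
    have /eqP := notL _ lt_jn; apply; rewrite nsumSr -[RHS]translate0 -[0]addr0.
    by apply: (sumset_full gL); rewrite ?translate0 ?sub ?sub_gen //; move: eqL Z1; clear; clia.
  by split=> //; rewrite -jE.
have [[j [jn small]]|none] := classic (exists j, (0 < j < n)%N /\
    (#|nsum j.+1 Z| < #|nsum j Z| + #|Z|)%N); last first.
  left; have grow j : (0 < j <= n)%N -> (j * #|Z| <= #|nsum j Z|)%N.
    elim: j => // -[|j] IH /andP [_ jn]; first by rewrite mul1n nsum1.
    rewrite mulSn addnC; apply: leq_trans (leq_add (IH _) (leqnn _)) _; first by rewrite /= ltnW.
    by rewrite leqNgt; apply/negP => s; apply: none; exists j.+1; rewrite jn; split.
  by apply: grow; rewrite n0 leqnn.
have [jE cL] := near _ jn small.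
have grow i k : (0 < i)%N -> (i + k < n)%N -> (#|nsum i Z| + k * #|Z| <= #|nsum (i + k) Z|)%N.
  move=> i0; elim: k => [|k IH]; first by rewrite !addn0.
  rewrite addnS => lt_n; rewrite mulSn addnCA addnC.
  apply: leq_trans (leq_add (IH (ltnW lt_n)) (leqnn _)) _.
  rewrite leqNgt; apply/negP => s.
  have [] := near (i + k)%N _ s; first by rewrite addn_gt0 i0 /= ltnW.
  by move=> iE; rewrite iE ltnn in lt_n.
have [|big] := leqP (n * #|Z|) #|nsum n Z|; [by left|right].
have [g Lg gn] : exists2 g, g \in L & g \notin nsum n Z.
  by apply/subsetPn; apply: contra (notL n (leqnn n)) => sL; rewrite eqEsubset sub sL.
have nE : nsum n Z = L :\ g.
  apply/eqP; rewrite eqEcard subsetD1 sub gn /=.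
  by move: cL; rewrite (cardsD1 g L) Lg; clear; clia.
have cZ : #|[set g - z | z in Z]| = #|Z|.
  by rewrite card_in_imset // => a b _ _ /addrI /oppr_inj.
(* As [g] is missed by nZ, the set g - Z avoids (n - 1)Z; with the lower bounds on growth this
   forces all sizes to be exact multiples of |Z|. *)
have pre : (#|nsum j Z| + #|Z| <= #|L|)%N.
  rewrite -cZ -cardsUI [X in (_ + X)%N](_ : _ = 0%N) ?addn0; last first.
    apply/eqP; rewrite cards_eq0; apply/eqP/setP => x; rewrite in_setI in_set0.
    apply/negP => /andP [xj /imsetP [z Zz xE]]; move/negP: gn; apply.
    by rewrite -jE nsumS; have H := mem_sumset Zz xj; rewrite xE in H *; zmem_from H.
  apply: subset_leq_card; rewrite subUset sub /=; apply/subsetP => _ /imsetP [z Zz ->].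
  by rewrite grpB // (subsetP (sub_gen Z)).
have j0 : (0 < j)%N by case/andP: jn.
have mulE : (n * #|Z| = j * #|Z| + #|Z|)%N by rewrite -jE mulSn addnC.
have jN : (j * #|Z| <= #|nsum j Z|)%N.
  have := grow 1%N j.-1 (leqnn _); rewrite nsum1 -mulSn add1n prednK // -jE ltnS; exact.
split=> //; last by exists g.
- by rewrite -/L; move: pre jN big cL mulE; clear; clia.
- move=> i /andP [i0 lt_in].
  have lo : (i * #|Z| <= #|nsum i Z|)%N.
    by have := grow 1%N i.-1 (leqnn _); rewrite nsum1 -mulSn add1n prednK //; apply.
  have le_ij : (i <= j)%N by rewrite -ltnS jE.
  have := grow i (j - i)%N i0; rewrite subnKC // -jE ltnS => /(_ (leqnn _)).
  have : (i * #|Z| + (j - i) * #|Z| = j * #|Z|)%N by rewrite -mulnDl subnKC.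
  by move: lo pre big cL mulE; clear; clia.
Qed.

End Exponent.

Section Progressions.
Variable G : finZmodType.
Implicit Types (A B W Z : {set G}) (x y z t : G).

Lemma pair_growth A x : A != set0 -> (#|A| < #|gen [set x]|)%N ->
  (#|A| < #|A :+: [set 0%R; x]|)%N.
Proof.
move=> A0 lt_A; have sub : A \subset A :+: [set 0; x].
  by apply: subset_sumsetr; rewrite !inE eqxx.
rewrite ltn_neqAle subset_leq_card // andbT; apply: contraL lt_A => /eqP cE.
have AE : A = A :+: [set 0; x] by apply/eqP; rewrite eqEcard sub cE leqnn.
rewrite -leqNgt; apply: leq_trans (card_stab_le A0); apply: subset_leq_card.
apply: gen_min; first exact: subgrp_stab.
rewrite sub1set; apply: stabP => a Aa; rewrite AE addrC.
by apply: mem_sumset; rewrite // !inE eqxx orbT.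
Qed.

Lemma card_add_nsum_pair B x j : B != set0 ->
  (minn #|gen [set x]| (#|B| + j) <= #|B :+: nsum j [set 0%R; x]|)%N.
Proof.
move=> B0; elim: j => [|j IH]; first by rewrite nsum0 sumsetC sum0set addn0 geq_minr.
rewrite nsumSr sumsetA; set C := B :+: _ in IH *.
have C0 : C != set0.
  by apply: sumset_neq0 => //; apply: nsum_neq0; apply/set0Pn; exists 0; rewrite !inE eqxx.
have [lt_C|ge_C] := ltnP #|C| #|gen [set x]|.
  by have := pair_growth C0 lt_C; move: IH lt_C; clear; clia.
have := leq_card_sumset C (_ : [set 0; x] != set0); rewrite -/C.
have -> : [set 0; x] != set0 by apply/set0Pn; exists 0; rewrite !inE eqxx.
by move=> /(_ isT); move: ge_C; clear; clia.
Qed.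

Lemma nsum_pairP x j y : y \in nsum j [set 0; x] -> exists2 i, (i <= j)%N & y = x *+ i.
Proof.
elim: j y => [|j IH] y; first by rewrite nsum0 => /set1P ->; exists 0%N.
rewrite nsumS => /sumsetP [a [b [aU /IH [i ij ->] ->]]].
move: aU; rewrite !inE => /orP [] /eqP ->; last by exists i.+1; rewrite ?mulrS.
by exists i; rewrite ?add0r // leqW.
Qed.

(* A set which grows by one under x has a single point not preceded by
   another one, and the points outside the run started there would form whole
   cosets. *)
Lemma progression A x a : A != set0 -> A \subset a +: gen [set x] ->
    #|A :+: [set 0%R; x]| = (#|A| + 1)%N ->
  exists t, t +: nsum #|A|.-1 [set 0; x] \subset A.
Proof.
move=> A0 sA cA; set W := gen [set x]; have gW : subgrp W := subgrp_gen _.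
have AE : A :+: [set 0; x] = A :|: (x +: A).
  by rewrite sumsetUr !sumset1 translate0.
have c1 : #|A :\: (x +: A)| = 1%N.
  by move: cA; rewrite AE cardsU cardsD card_translate;
    have := subset_leq_card (subsetIl A (x +: A)); clear; clia.
have /cards1P [t tE] : #|A :\: (x +: A)| == 1%N by apply/eqP.
have [At tx] : t \in A /\ t - x \notin A.
  by have := set11 t; rewrite -tE in_setD mem_translate => /andP [].
have prev b : b \in A -> b != t -> b - x \in A.
  move=> Ab bt; apply: contraR bt => nb.
  by rewrite -in_set1 -tE in_setD mem_translate Ab nb.
have exj : exists j, t + x *+ j \notin A.
  apply: NNPP => no; have all j : t + x *+ j \in A.
    by apply: contraT => nj; case: no; exists j.
  have [o [o0 xo _ _ _]] := gen1_exists x.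
  move/negP: tx; apply; have := all o.-1; rewrite (_ : t + _ = t - x) //.
  by congr (_ + _); apply/eqP; rewrite -addr_eq0 -mulrSr prednK ?xo.
case: (ex_minnP exj) => j jA j_min.
pose C := [set t + x *+ i | i : 'I_j].
have AC : A \subset C.
  rewrite -finset.setD_eq0; apply/eqP; have [//|/set0Pn [b bD]] := eqVneq (A :\: C) set0.
  have : W \subset stab (A :\: C).
    apply: gen_min; first exact: subgrp_stab.
    rewrite sub1set -(grpN (subgrp_stab _)); apply: stabP => c.
    rewrite !in_setD => /andP [cC Ac].
    have ct : c != t.
      apply: contra cC => /eqP ->; apply/imsetP.
      have j0 : (0 < j)%N by rewrite lt0n; apply/eqP => j0; rewrite j0 mulr0n addr0 At in jA.
      by exists (Ordinal j0); rewrite //= mulr0n addr0.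
    rewrite addrC (prev c Ac ct) andbT; apply: contra cC => /imsetP [i _ cE].
    have cE' : c = t + x *+ i.+1 by rewrite -[c](subrK x) cE -addrA mulrSr.
    have ij : (i.+1 < j)%N.
      rewrite ltn_neqAle ltn_ord andbT; apply/eqP => ij.
      by move: jA; rewrite -ij -cE' Ac.
    by apply/imsetP; exists (Ordinal ij).
  rewrite (sub_stab_grp _ gW) => /eqP per.
  have Ab : b \in A by case/setDP: bD.
  have tW : t - b \in W.
    have in_W c : c \in A -> c - a \in W by move=> Ac; rewrite -mem_translate (subsetP sA).
    by have H := grpB gW (in_W t At) (in_W b Ab); zmem_from H.
  have := mem_sumset bD tW; rewrite per addrC subrK in_setD => /andP [/imsetP []].
  have j0 : (0 < j)%N by rewrite lt0n; apply/eqP => j0; rewrite j0 mulr0n addr0 At in jA.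
  by exists (Ordinal j0); rewrite //= mulr0n addr0.
have cj : (#|A| <= j)%N.
  by apply: leq_trans (subset_leq_card AC) (leq_trans (leq_imset_card _ _) _); rewrite card_ord.
exists t; apply/subsetP => y; rewrite mem_translate => /nsum_pairP [i le_i yE].
have lt_j : (i < j)%N.
  apply: leq_trans cj; apply: leq_ltn_trans le_i _; by rewrite prednK // card_gt0.
rewrite -[y](subrK t) yE addrC; apply: contraT => /j_min.
by rewrite leqNgt lt_j.
Qed.

Lemma card_progression_add A B x a : A != set0 -> B != set0 -> A \subset a +: gen [set x] ->
    #|A :+: [set 0%R; x]| = (#|A| + 1)%N ->
  (minn #|gen [set x]| (#|A| + #|B| - 1) <= #|A :+: B|)%N.
Proof.
move=> A0 B0 sA cA; have [t tA] := progression A0 sA cA.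
have A1 : (0 < #|A|)%N by rewrite card_gt0.
apply: (@leq_trans #|(t +: nsum #|A|.-1 [set 0; x]) :+: B|); last first.
  by apply: subset_leq_card; apply: sumsetSl.
rewrite sumset_translate card_translate sumsetC.
by apply: leq_trans (card_add_nsum_pair _ _ B0); move: A1; clear; clia.
Qed.

Lemma gen_two Z y z : 0 \in Z -> Z \subset [set y; z] -> gen Z \subset gen [set z - y].
Proof.
move=> Z0 sZ; have gW := subgrp_gen [set z - y].
have zy : z - y \in gen [set z - y] by rewrite -sub1set sub_gen.
apply: gen_min => //; apply: (subset_trans sZ); rewrite subUset !sub1set.
have := subsetP sZ 0 Z0; rewrite !inE => /orP [] /eqP E.
  by rewrite -E subr0 (grp0 (subgrp_gen _)) -sub1set sub_gen.
have yz : y = - (z - y) by rewrite -E sub0r opprK.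
by rewrite {1}yz grpN // zy /= -{1}E (grp0 gW).
Qed.

Lemma card3_pair Z : 0 \in Z -> #|Z| = 3%N -> exists x y, Z = [set 0; x; y].
Proof.
move=> Z0 Z3; have : #|Z :\ 0| == 2%N by have := cardsD1 0 Z; rewrite Z0 Z3 => -[E]; apply/eqP/esym.
by case/cards2P => x [y [_ E]]; exists x, y; rewrite -(setD1K Z0) E setUA.
Qed.

Lemma card_nsum2_elementary Z : (forall z, z \in Z -> z *+ 2 = 0) -> 0 \in Z -> #|Z| = 3%N ->
  (#|nsum 2 Z| <= 4)%N.
Proof.
move=> kill Z0 Z3; have [x [y ZE]] := card3_pair Z0 Z3.
have x2 : x + x = 0 by rewrite -mulr2n kill // ZE !inE eqxx orbT.
have y2 : y + y = 0 by rewrite -mulr2n kill // ZE !inE eqxx !orbT.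
have : nsum 2 Z \subset [set 0; x; y] :|: [set x + y].
  rewrite nsumS nsum1 ZE; apply/subsetP => _ /sumsetP [a [b [aZ bZ ->]]]; move: aZ bZ.
  rewrite !inE -!orbA => /or3P [] /eqP -> /or3P [] /eqP ->;
    by rewrite ?x2 ?y2 ?addr0 ?add0r ?eqxx ?orbT // addrC eqxx ?orbT.
move/subset_leq_card => /leq_trans; apply.
by rewrite -ZE (leq_trans (leq_card_setU _ _)) // Z3 cards1.
Qed.

End Progressions.

Lemma card_disjoint3 (T : finType) (X Y V : {set T}) :
    #|X :&: Y| = 0%N -> #|X :&: V| = 0%N -> #|Y :&: V| = 0%N ->
  (#|X| + #|Y| + #|V| <= #|X :|: Y :|: V|)%N.
Proof.
move=> XY XV YV; have := leq_card_setU (X :&: V) (Y :&: V); rewrite -setIUl XV YV => -[XYV _].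
by rewrite cardsU (cardsU X); move: XY XYV; lia.
Qed.

Lemma card_setD2 (T : finType) (A : {set T}) a b : (#|A| <= #|A :\: [set a; b]| + 2)%N.
Proof.
rewrite cardsD; have := subset_leq_card (subsetIr A [set a; b]).
by rewrite cards2; case: (_ != _); lia.
Qed.

(** * No exotic set when n exceeds E *)

Section ExoticAbsurd.
Variables (G : finZmodType) (E n : nat) (Z : {set G}).
Hypotheses (E2 : (2 <= E)%N) (killE : forall x : G, x *+ E = 0).
Hypotheses (Z0 : 0 \in Z) (Z1 : (1 < #|Z|)%N) (exo : exotic n Z) (En : (E < n)%N).
Implicit Types (A B M P U W : {set G}) (a b c g x y z : G).

Let L : {set G} := gen Z.
Let gL : subgrp L. Proof. exact: subgrp_gen. Qed.
Let sZL : Z \subset L. Proof. exact: sub_gen. Qed.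
Let Zn0 : Z != set0. Proof. by apply/set0Pn; exists 0. Qed.
Let cL : #|L| = (n * #|Z|)%N. Proof. by case: exo. Qed.
Let n3 : (3 <= n)%N. Proof. exact: leq_ltn_trans E2 En. Qed.

Let far W z1 z2 z : Prop := [/\ z \in Z, z \notin z1 +: W & z \notin z2 +: W].

(** If g - z were u + w with u in (n - 1)Z and w in W, then z + w would be in [Z] and g = (z + w) +
    u in nZ. *)
Lemma far_missed W g z : nsum n Z = L :\ g -> z +: W \subset Z -> z \in Z ->
  g - z \notin nsum n.-1 Z :+: W.
Proof.
move=> nE zW Zz; apply/negP => /sumsetP [u [w [un Ww gE]]].
have : g \in nsum n Z.
  have zwZ : z + w \in Z by rewrite (subsetP zW) // mem_translate addrC addKr.
  have H := mem_sumset zwZ un; rewrite -nsumS prednK ?(leq_trans _ n3) // in H.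
  have gE' : g = z + w + u by rewrite -[g](subrK z) gE; zmod.
  by rewrite gE'.
by rewrite nE in_setD1 eqxx.
Qed.

(** Modulo [P] the points g - z with z far avoid (n - 1)Z by [far_missed], and at most two classes
    of [Z], those of [z1] and [z2], are not far. *)
Lemma far_count (Q : finZmodType) (p : {additive G -> Q}) P W z1 z2 :
    (forall x, (p x == 0) = (x \in P)) -> subgrp W -> subgrp P -> W \subset P ->
    (nsum n.-1 Z :+: W) :+: P = nsum n.-1 Z :+: W ->
    (forall z, far W z1 z2 z -> z +: W \subset Z) ->
  (#|p @: nsum n.-1 Z| + #|p @: Z| <= #|p @: L| + 2)%N.
Proof.
move=> p_ker gW gP sWP perP full; have [_ _ _ [g Lg nE]] := exo.
pose D := [set p g - q | q in (p @: Z) :\: [set p z1; p z2]].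
have cD : (#|p @: Z| <= #|D| + 2)%N.
  rewrite [#|D|]card_in_imset; last by move=> q r _ _ /addrI /oppr_inj.
  exact: card_setD2.
have dis : [disjoint p @: nsum n.-1 Z & D].
  rewrite -setI_eq0; apply/eqP/setP => q; rewrite in_setI in_set0; apply/negP.
  move=> /andP [/imsetP [u un ->] /imsetP [_ /setDP [/imsetP [z Zz ->]]]].
  rewrite !inE negb_or !(quo_eq p_ker) => /andP [z1P z2P] /eqP.
  rewrite -raddfB (quo_eq p_ker) => uP.
  have fz : far W z1 z2 z.
    split=> //; rewrite mem_translate.
      by apply: contra z1P; apply: (subsetP sWP).
    by apply: contra z2P; apply: (subsetP sWP).
  move/negP: (far_missed nE (full z fz) Zz); apply; rewrite -perP.
  have uA : u \in nsum n.-1 Z :+: W by rewrite (subsetP (subset_sumsetr _ (grp0 gW))).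
  have uP' : g - z - u \in P by rewrite -(grpN gP); zmem_from uP.
  by have H := mem_sumset uA uP'; zmem_from H.
have sub : (p @: nsum n.-1 Z) :|: D \subset p @: L.
  rewrite subUset imsetS ?nsum_sub_gen //=.
  apply/subsetP => _ /imsetP [_ /setDP [/imsetP [z Zz -> _ ->]]].
  by rewrite -raddfB imset_f // grpB // (subsetP sZL).
move: (subset_leq_card sub) cD; rewrite cardsU (disjoint_setI0 dis) cards0.
by clear; clia.
Qed.

(* The elements g - z, z in a full coset of W, are not in (n - 1)Z + W, whose
   size modulo its stabilizer P is bounded below by Kneser's theorem. *)
Lemma third_coset W z1 z2 c : subgrp W -> W \subset L ->
    (forall z, far W z1 z2 z -> z +: W \subset Z) -> far W z1 z2 c ->
    let P := stab (nsum n.-1 Z :+: W) in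
  [/\ subgrp P, W \subset P, P \subset L, P != L & (#|Z :+: P| <= #|Z| + #|P|)%N].
Proof.
move=> gW sWL full farc P; set A := nsum n.-1 Z :+: W in P *.
have gP : subgrp P := subgrp_stab A.
have sWP : W \subset P by rewrite -{1}(stab_grp gW) stab_sumsetr.
have A0 : A != set0.
  by apply: sumset_neq0; [exact: nsum_neq0|apply/set0Pn; exists 0; apply: grp0].
have sAL : A \subset L by rewrite sumset_sub_grp // nsum_sub_gen.
have sPL : P \subset L := stab_sub_grp gL A0 sAL.
have [_ _ _ [g Lg nE]] := exo; have Zc : c \in Z by case: farc.
split=> //.
  apply/eqP => PL; move/negP: (far_missed nE (full c farc) Zc); apply.
  have AL : A = L by apply: (periodic_sub_eq gL A0 sAL); rewrite -PL.
  by rewrite -/A AL grpB // (subsetP sZL).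
have [Q [p [p_surj p_ker]]] := quotient_exists gP.
have perA : A :+: P = A := sumset_stab A.
have := far_count p_ker gW gP sWP perA full.
have pA : p @: A = nsum n.-1 (p @: Z).
  rewrite quo_sumset -quo_nsum; have -> : p @: W = [set 0].
    apply/eqP; rewrite eqEsubset sub1set; apply/andP; split.
      by apply/subsetP => _ /imsetP [w Ww ->]; rewrite inE p_ker (subsetP sWP).
    by rewrite -(raddf0 p) imset_f ?grp0.
  by rewrite sumsetC sum0set.
have ap : stab (nsum n.-1 (p @: Z)) \subset [set 0].
  by rewrite -pA (stab_quo p_surj p_ker (erefl P)).
have pZ0 : p @: Z != set0 by apply/set0Pn; exists (p 0); apply: imset_f.
have := nsum_kneser pZ0 ap; rewrite -quo_nsum => kn count.
have cardL : #|L| = (#|P| * #|p @: L|)%N.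
  apply: (card_periodic p_surj p_ker); apply/eqP.
  by rewrite eqEsubset subset_sumsetr ?grp0 // andbT sumset_sub_grp.
rewrite (card_sumset_quo p_surj p_ker).
have k0 : (0 < #|p @: Z|)%N by rewrite card_gt0.
have big : (n * (#|p @: Z| - 1) <= #|p @: L|)%N.
  move: kn count n3 k0; move: #|p @: Z| #|p @: L| #|p @: nsum _ _| => k o u.
  case: (n) => // m; case: k => // k; rewrite /= subn1 /= => kn count _ _.
  by move: kn count; rewrite mulnS mulSn; move: (m * k)%N => mk; clear; lia.
have := leq_mul (leqnn #|P|) big; rewrite -cardL cL mulnCA leq_pmul2l; last first.
  exact: leq_trans n3.
move: k0; case: #|p @: Z| => // k _; rewrite subn1 /= mulnS.
by clear; clia.
Qed.

(** Take [M] largest with these properties. If any two cosets together held more than |M| points of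
    [Z], nZ would be periodic. So two cosets carry all the holes. Without a third coset, gen Z
    modulo [M] is cyclic and too small. With one, [third_coset] and maximality make (n - 1)Z
    aperiodic modulo [M], and [nsum_dichotomy] for n - 1 >= E leaves only n = 3, E = 2 with three
    classes, where 2Z modulo [M] has at most four elements instead of five or more. *)
Lemma no_qualifying M : subgrp M -> (1 < #|M|)%N -> M \subset L -> M != L ->
  (#|Z :+: M| <= #|Z| + #|M|)%N -> False.
Proof.
pose qual M := [/\ subgrp M, (1 < #|M|)%N, M \subset L, M != L &
  (#|Z :+: M| <= #|Z| + #|M|)%N].
move=> gM0 M01 sM0 M0L qM0.
have exq : exists M, qual M by exists M.
have bnd M1 : qual M1 -> (#|M1| <= #|G|)%N by move=> _; apply: max_card.
have {M gM0 M01 sM0 M0L qM0 bnd exq} [M [[gM M1 sML ML qM] maxM]] := ex_max_nat exq bnd.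
have [_ apn _ [g Lg nE]] := exo.
have [[a [b [Za Zb ba small]]]|none] := classic (exists a b, [/\ a \in Z, b \in Z, b - a \notin M &
    (#|Z :&: (a +: M)| + #|Z :&: (b +: M)| <= #|M|)%N]); last first.
  have pairs y z : y \in Z -> z \in Z -> z - y \notin M -> (y + z) +: M \subset nsum 2 Z.
    move=> Zy Zz zy; apply: pair_full => //; rewrite ltnNge; apply/negP => s.
    by apply: none; exists y, z.
  have per : nsum n Z :+: M = nsum n Z.
    apply: periodic_nsum => // y => [z Zy Zz zy|Zy].
      by have := pairs y z Zy Zz zy; rewrite nsumS nsum1.
    have [b Zb by_M] := outer_coset gM Z0 sML ML Zy.
    (* One sum y + b absorbs [M], and E - 1 more copies of [b] cancel its b-part. This takes E + 1
       terms, whence the need for E < n. *)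
    have := absorb (mulrn_nsum (n - E.+1) Zy) (absorb (mulrn_nsum E.-1 Zb) (pairs _ _ Zy Zb by_M)).
    have -> : y *+ (n - E.+1) + (b *+ E.-1 + (y + b)) = y *+ n.
      have -> : b *+ E.-1 = - b.
        by apply/eqP; rewrite -addr_eq0 -mulrSr prednK ?killE // ltnW.
      by rewrite -{2}(subnK En) mulrnDr mulrS killE; zmod.
    have -> : (n - E.+1 + (E.-1 + 2) = n)%N by move: E2 En; clear; lia.
    by [].
  have : M \subset stab (nsum n Z) by rewrite (sub_stab_grp _ gM) per.
  by move/subset_trans/(_ apn)/subset_leq_card; rewrite cards1 leqNgt M1.
have dis := disjoint_cosets gM ba.
have two_N : (#|M| + #|Z| <= #|Z :+: M|)%N.
  by have := pair_holes gM Za Zb ba; move: small; clear; clia.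
have full z : far M a b z -> z +: M \subset Z.
  move=> [Zz za zb].
  have sA : (a +: M) :|: (b +: M) :|: (z +: M) \subset Z :+: M.
    by rewrite !subUset !subset_sumsetl.
  have disz : [disjoint (a +: M) :|: (b +: M) & z +: M].
    by rewrite -setI_eq0 setIUl !disjoint_setI0 ?setU0 ?disjoint_cosets // -mem_translate.
  have := holes_sub sA gM; rewrite !setIUr cardsU (disjoint_setI0 disz) cards0 subn0.
  rewrite cardsU (disjoint_setI0 dis) cards0 subn0 !card_translate => holes.
  have cU (X Y : {set G}) : (#|X :|: Y| <= #|X| + #|Y|)%N := leq_card_setU X Y.
  have cz : (#|M| <= #|Z :&: (z +: M)|)%N.
    move: holes small qM (cU (Z :&: (a +: M)) (Z :&: (b +: M))).
    move: (cU ((Z :&: (a +: M)) :|: (Z :&: (b +: M))) (Z :&: (z +: M))).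
    by clear; clia.
  have : Z :&: (z +: M) == z +: M by rewrite eqEcard subsetIr card_translate.
  by move/eqP <-; apply: subsetIl.
have [Q [p [p_surj p_ker]]] := quotient_exists gM.
have cardL : #|L| = (#|M| * #|p @: L|)%N.
  apply: (card_periodic p_surj p_ker); apply/eqP.
  by rewrite eqEsubset subset_sumsetr ?grp0 // andbT sumset_sub_grp.
have cardZM := card_sumset_quo p_surj p_ker Z.
have killQ (q : Q) : q *+ E = 0.
  by have [x <-] := p_surj q; rewrite -raddfMn killE raddf0.
have k1 : (1 < #|p @: Z|)%N.
  have : [set p a; p b] \subset p @: Z by rewrite subUset !sub1set !imset_f.
  move/subset_leq_card; apply: leq_trans; rewrite cards2 eq_sym (quo_eq p_ker) ba //.
have [[c farc]|no_c] := classic (exists c, far M a b c); last first.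
  have cover : p @: Z \subset [set p a; p b].
    apply/subsetP => _ /imsetP [z Zz ->]; rewrite !inE; apply: contraT; rewrite negb_or !(quo_eq p_ker).
    by move=> /andP [za zb]; case: no_c; exists z; split; rewrite // mem_translate.
  have pZ0 : 0 \in p @: Z by rewrite -(raddf0 p) imset_f.
  have := subset_leq_card (gen_two pZ0 cover); rewrite -quo_gen -/L => /leq_trans.
  move=> /(_ _ (card_gen1 (ltnW E2) (killQ _))) LE.
  have MN : (#|M| <= #|Z|)%N.
    have : (2 * #|M| <= #|Z :+: M|)%N by rewrite cardZM mulnC leq_mul2l k1 orbT.
    by move: qM; clear; clia.
  have := leq_mul MN LE; rewrite -cardL cL.
  rewrite mulnC leq_pmul2l ?(ltnW Z1) // leqNgt En //.
have [gP sMP sPL PL qP] := third_coset gM sML full farc.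
have PM : stab (nsum n.-1 Z :+: M) = M.
  apply/esym/eqP; rewrite eqEcard sMP maxM //; split=> //.
  exact: leq_trans M1 (subset_leq_card sMP).
have perM : (nsum n.-1 Z :+: M) :+: M = nsum n.-1 Z :+: M by rewrite -sumsetA (grp_sumset gM).
have count := far_count p_ker gM gM (subxx M) perM full.
have ap : stab (nsum n.-1 (p @: Z)) \subset [set 0].
  rewrite -quo_nsum; have -> : p @: nsum n.-1 Z = p @: (nsum n.-1 Z :+: M).
    apply/setP => q; apply/imsetP/imsetP => [[x xn ->]|[x]].
      by exists x => //; rewrite (subsetP (subset_sumsetr _ (grp0 gM))).
    rewrite (mem_sumset_quo p_ker) => /imsetP [y yn E1] ->; exists y => //.
  by rewrite (stab_quo p_surj p_ker (esym PM)).
have En1 : (E <= n.-1)%N by move: En; clear; lia.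
have pZ0 : 0 \in p @: Z by rewrite -(raddf0 p) imset_f.
have M0 : (0 < #|M|)%N := ltnW M1.
have size_o : (#|p @: L| + n <= n * #|p @: Z|)%N.
  rewrite -(leq_pmul2l M0) mulnDr -cardL cL mulnCA -cardZM [(_ * n)%N]mulnC.
  by rewrite -mulnDr leq_pmul2l ?(leq_trans _ n3) // addnC.
have nk : (n * #|p @: Z| = n.-1 * #|p @: Z| + #|p @: Z|)%N.
  by rewrite -{1}(prednK (leq_trans (isT : 0 < 3)%N n3)) mulSn addnC.
have := nsum_dichotomy E2 killQ pZ0 k1 En1 ap; rewrite -quo_nsum => -[big|].
  move: big count size_o n3; rewrite nk.
  by move: #|p @: Z| #|p @: L| #|p @: nsum _ _| (n.-1 * _)%N => k o u w; clear; lia.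
rewrite /exotic -!quo_nsum -quo_gen -/L => -[cLbar _ _ [h Lh hE]].
have u1 : #|p @: L| = #|p @: nsum n.-1 Z|.+1 by rewrite (cardsD1 h) Lh hE.
have [n_3 k_3] : n = 3%N /\ #|p @: Z| = 3%N.
  move: cLbar u1 count size_o n3; rewrite nk.
  by move: #|p @: Z| #|p @: L| #|p @: nsum _ _| (n.-1 * _)%N => k o u w; clear; lia.
have E_2 : E = 2%N by move: E2 En1; rewrite n_3; clear; lia.
have kill2 q : q \in p @: Z -> q *+ 2 = 0 by rewrite -E_2.
have := card_nsum2_elementary kill2 pZ0 k_3; rewrite -quo_nsum.
by move: u1; rewrite cLbar k_3 n_3 => -[<-].
Qed.

Let c2 : #|nsum 2 Z| = (2 * #|Z|)%N.
Proof. by case: exo => _ _ sizes _; rewrite sizes. Qed.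

Lemma exotic_noncyclic x : L != gen [set x].
Proof.
apply/eqP => Lx; have := card_gen1 (ltnW E2) (killE x); rewrite -Lx cL.
have := leq_mul (leqnn n) (ltnW Z1); rewrite muln1; move: En.
by move: (n * #|Z|)%N => a; clear; lia.
Qed.

(* Since the index of <x> is at most E < n, the order of x exceeds |Z|. *)
Lemma rows_bound W (Q : finZmodType) (p : {additive G -> Q}) (q : Q) : subgrp W -> W \subset L ->
    (forall q, exists x, p x = q) -> (forall x, (p x == 0) = (x \in W)) ->
    p @: L \subset gen [set q] ->
  [/\ #|L| = (#|W| * #|p @: L|)%N, (#|p @: L| <= E)%N & (#|Z| < #|W|)%N].
Proof.
move=> gW sWL p_surj p_ker sq.
have cardL : #|L| = (#|W| * #|p @: L|)%N.
  apply: (card_periodic p_surj p_ker); apply/eqP.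
  by rewrite eqEsubset subset_sumsetr ?grp0 // andbT sumset_sub_grp.
have killQ (r : Q) : r *+ E = 0.
  by have [x <-] := p_surj r; rewrite -raddfMn killE raddf0.
have oE : (#|p @: L| <= E)%N.
  exact: leq_trans (subset_leq_card sq) (card_gen1 (ltnW E2) (killQ q)).
split=> //; rewrite ltnNge; apply/negP => WZ.
have := leq_mul WZ oE; rewrite -cardL cL mulnC leq_pmul2l ?(ltnW Z1) //.
by rewrite leqNgt En.
Qed.

(** The two rows [A] and [B] of [Z] are progressions, so A + A, A + B and B + B, which lie in
    different cosets of [W], have together at least 3|Z| - 3 elements unless one of them fills its
    coset; that case is excluded by |Z| < |W|. But |2Z| = 2|Z|. *)
Lemma two_rows x z1 z2 : let W := gen [set x] in W \subset L ->
    z1 \in Z -> z2 \in Z -> z2 - z1 \notin W -> Z \subset (z1 +: W) :|: (z2 +: W) ->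
    (forall i, i = z1 \/ i = z2 ->
      #|(Z :&: (i +: W)) :+: [set 0; x]| = (#|Z :&: (i +: W)| + 1)%N) ->
  (#|Z| <= 3)%N.
Proof.
move=> W sWL Zz1 Zz2 z21 cover grow; have gW : subgrp W := subgrp_gen _.
have [Q [p [p_surj p_ker]]] := quotient_exists gW.
have pcover : p @: Z \subset [set p z1; p z2].
  apply/subsetP => _ /imsetP [z Zz ->]; rewrite !inE !(quo_eq p_ker) -!mem_translate.
  by rewrite -in_setU (subsetP cover).
have pZ0 : 0 \in p @: Z by rewrite -(raddf0 p) imset_f.
have sgen := gen_two pZ0 pcover; rewrite -quo_gen -/L in sgen.
have [cardL oE NW] := rows_bound gW sWL p_surj p_ker sgen.
have WE : (#|W| <= E)%N := card_gen1 (ltnW E2) (killE x).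
have two : (z2 - z1) *+ 2 \notin W.
  apply/negP => W2; have q2 : (p z2 - p z1) *+ 2 = 0.
    by rewrite -raddfB -raddfMn; apply/eqP; rewrite p_ker.
  have := card_gen1 (isT : 0 < 2)%N q2; move/(leq_trans (subset_leq_card sgen)) => o2.
  have := leq_mul WE o2; rewrite -cardL cL.
  have := leq_mul (leqnn n) Z1; move: En E2; move: (n * #|Z|)%N => w; clear; lia.
set A := Z :&: (z1 +: W); set B := Z :&: (z2 +: W).
have A0 : A != set0 by apply/set0Pn; exists z1; rewrite in_setI Zz1 mem_translate subrr grp0.
have B0 : B != set0 by apply/set0Pn; exists z2; rewrite in_setI Zz2 mem_translate subrr grp0.
have cA : #|A :+: [set 0; x]| = (#|A| + 1)%N by apply: grow; left.
have cB : #|B :+: [set 0; x]| = (#|B| + 1)%N by apply: grow; right.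
have sA : A \subset z1 +: W := subsetIr _ _.
have sB : B \subset z2 +: W := subsetIr _ _.
have cZ : (#|Z| <= #|A| + #|B|)%N.
  by apply: leq_trans (leq_card_setU _ _); apply: subset_leq_card; rewrite -setIUr subsetIidl.
have sub_row (X Y : {set G}) y z : X \subset y +: W -> Y \subset z +: W -> X :+: Y \subset (y + z) +: W.
  move=> sX sY; apply: subset_trans (sumsetSS sX sY) _.
  by rewrite sumset_translate translate_sumset (grp_sumset gW) translateD.
have dis (X Y : {set G}) y z : X \subset y +: W -> Y \subset z +: W ->
    z - y \notin W -> #|X :&: Y| = 0%N.
  move=> sX sY zy; have d := disjoint_cosets gW zy.
  by apply/eqP; rewrite cards_eq0 -subset0 -(disjoint_setI0 d) setISS.
have sAA := sub_row _ _ _ _ sA sA; have sAB := sub_row _ _ _ _ sA sB.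
have sBB := sub_row _ _ _ _ sB sB.
have d1 : #|(A :+: A) :&: (A :+: B)| = 0%N.
  by apply: (dis _ _ _ _ sAA sAB); apply: contra z21 => H; zmem_from H.
have d2 : #|(A :+: A) :&: (B :+: B)| = 0%N.
  by apply: (dis _ _ _ _ sAA sBB); apply: contra two => H; zmem_from H.
have d3 : #|(A :+: B) :&: (B :+: B)| = 0%N.
  by apply: (dis _ _ _ _ sAB sBB); apply: contra z21 => H; zmem_from H.
have sum2 : (#|A :+: A| + #|A :+: B| + #|B :+: B| <= #|nsum 2 Z|)%N.
  have sAZ : A \subset Z := subsetIl _ _; have sBZ : B \subset Z := subsetIl _ _.
  apply: (@leq_trans #|(A :+: A) :|: (A :+: B) :|: (B :+: B)|).
    exact: card_disjoint3.
  by apply: subset_leq_card; rewrite nsumS nsum1 !subUset !sumsetSS.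
have g1 := card_progression_add A0 A0 sA cA.
have g2 := card_progression_add A0 B0 sA cA.
have g3 := card_progression_add B0 B0 sB cB.
have A1 : (0 < #|A|)%N by rewrite card_gt0.
have B1 : (0 < #|B|)%N by rewrite card_gt0.
move: sum2 g1 g2 g3 cZ NW A1 B1; rewrite c2 -/W.
by move: #|A| #|B| #|W| #|Z| #|A :+: A| #|A :+: B| #|B :+: B|; clear; lia.
Qed.

(** Write U = {0, a, b} and W = <a>. Adding b reaches a new coset of [W], so Z + {0, a} gains at
    most two points over [Z]. Each coset gains at least one, so [Z] meets at most two, exactly two
    as [L] is not cyclic, and [two_rows] applies. *)
Lemma three_element U : gen U = L -> #|U| = 3%N -> 0 \in U -> (#|Z :+: U| <= #|Z| + 3)%N ->
  (#|Z| <= 3)%N.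
Proof.
move=> gU U3 U0 ZU; have [a [b UE]] := card3_pair U0 U3.
pose W := gen [set a]; have gW : subgrp W := subgrp_gen _.
have UL : U \subset L by rewrite -gU sub_gen.
have sWL : W \subset L.
  by apply: gen_min => //; apply: subset_trans UL; rewrite UE sub1set !inE eqxx orbT.
have [Q [p [p_surj p_ker]]] := quotient_exists gW.
have sa : a \in W by rewrite -sub1set sub_gen.
have pU : p @: L \subset gen [set p b].
  rewrite -gU quo_gen; apply: gen_min; first exact: subgrp_gen.
  have g0 := grp0 (subgrp_gen [set p b]).
  have gb : p b \in gen [set p b] by rewrite -sub1set sub_gen.
  apply/subsetP => _ /imsetP [u Uu ->]; move: Uu; rewrite UE !inE -orbA.
  case/or3P => /eqP -> //; first by rewrite raddf0.
  by move: sa; rewrite -p_ker => /eqP ->.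
have [cardL oE NW] := rows_bound gW sWL p_surj p_ker pU.
pose R := p @: Z; pose z q := #|part p Z q|; pose c q := #|part p (Z :+: [set 0; a]) q|.
have sUa : [set 0; a] \subset W by rewrite subUset !sub1set grp0.
have cZ : #|Z| = (\sum_(q in R) z q)%N.
  by apply: (card_parts p_ker); apply: subset_sumsetr; apply: grp0.
have cZa : #|Z :+: [set 0; a]| = (\sum_(q in R) c q)%N.
  by apply: (card_parts p_ker); apply: sumsetS.
have grow q : q \in R -> (z q < c q)%N.
  move=> Rq; rewrite /c (part_sumset p_ker) //; apply: pair_growth; first exact: part_neq0.
  by apply: leq_ltn_trans NW; apply: subset_leq_card; apply/subsetP => x; rewrite inE => /andP [].
have [z0 Zz0 out] : exists2 z0, z0 \in Z & p (z0 + b) \notin R.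
  apply: NNPP => no; have all x : x \in Z -> p (x + b) \in R.
    by move=> Zx; apply: contraT => nx; case: no; exists x.
  have sR : gen [set p b] \subset stab R.
    apply: gen_min; first exact: subgrp_stab.
    rewrite sub1set; apply: stabP => _ /imsetP [x Zx ->].
    by rewrite -raddfD addrC all.
  have R0 : R != set0 by apply/set0Pn; exists (p 0); apply: imset_f.
  have := leq_trans (subset_leq_card (subset_trans pU sR)) (card_stab_le R0).
  move=> /leq_trans /(_ (leq_imset_card _ _)) oN.
  have := leq_mul (card_gen1 (ltnW E2) (killE a)) oN; rewrite -/W -cardL cL.
  by rewrite leq_pmul2r ?(ltnW Z1) // leqNgt En.
have le2 : (#|Z :+: [set 0%R; a]| < #|Z :+: U|)%N.
  apply: proper_card; apply/properP; split.
    by apply: sumsetS; rewrite UE subsetUl.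
  exists (z0 + b); first by rewrite mem_sumset // UE !inE eqxx orbT.
  apply: contra out => H; rewrite -(mem_sumset_quo p_ker).
  exact: subsetP (sumsetS Z sUa) _ H.
have sum_grow : (#|Z| + #|R| <= \sum_(q in R) c q)%N.
  by rewrite cZ -sum1_card -big_split /=; apply: leq_sum => q Rq; rewrite addn1 grow.
have R2 : #|R| = 2%N.
  have R1 : (1 < #|R|)%N.
    rewrite ltnNge; apply/negP => R1; have /negP := exotic_noncyclic a; apply.
    rewrite eqEsubset sWL andbT gen_sub //; apply/subsetP => x Zx.
    rewrite -p_ker -(raddf0 p); apply/eqP.
    by apply: (card_le1_eqP R1); apply: imset_f.
  by move: ZU le2 sum_grow R1; rewrite -cZa; clear; clia.
have /cards2P [q1 [q2 [q12 RE]]] : #|R| == 2%N by apply/eqP.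
have Rq1 : q1 \in R by rewrite RE !inE eqxx.
have Rq2 : q2 \in R by rewrite RE !inE eqxx orbT.
have sum_R (f : Q -> nat) : (\sum_(q in R) f q = f q1 + f q2)%N.
  by rewrite RE big_setU1 ?big_set1 // inE.
have [e1 e2] : c q1 = (z q1 + 1)%N /\ c q2 = (z q2 + 1)%N.
  move: le2 ZU (grow _ Rq1) (grow _ Rq2); rewrite cZ cZa !sum_R.
  by move: (z q1) (z q2) (c q1) (c q2); clear => *; split; clia.
case/imsetP: (Rq1) => z1 Zz1 q1E; case/imsetP: (Rq2) => z2 Zz2 q2E.
apply: (two_rows sWL Zz1 Zz2).
- by rewrite -(quo_eq p_ker) -q1E -q2E eq_sym.
- apply/subsetP => x Zx; rewrite in_setU !mem_translate -!(quo_eq p_ker) -q1E -q2E.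
  by have := imset_f p Zx; rewrite -/R RE !inE.
- move=> i iz; have -> : Z :&: (i +: W) = part p Z (p i) by rewrite (part_coset p_ker).
  rewrite -(part_sumset p_ker) //.
  by case: iz => ->; rewrite -?q1E -?q2E.
Qed.

Lemma exotic_card_gt3 : (3 < #|Z|)%N.
Proof.
rewrite ltnNge; apply/negP => Z_le3; have [Z2|Z_ne2] := eqVneq #|Z| 2%N.
  have /cards2P [a [b [_ ZE]]] : #|Z| == 2%N by apply/eqP.
  have sZ : Z \subset [set a; b] by rewrite ZE.
  have sg := gen_two Z0 sZ; have := subset_leq_card sg.
  move/leq_trans/(_ (card_gen1 (ltnW E2) (killE _))); rewrite -/L cL.
  by have := leq_mul (leqnn n) Z1; move: En; move: (n * #|Z|)%N => w; clear; lia.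
have Z3 : #|Z| = 3%N.
  by apply/eqP; rewrite eqn_leq Z_le3 ltn_neqAle eq_sym Z_ne2.
have [x [y ZE]] := card3_pair Z0 Z3.
pose W := gen [set x]; have gW : subgrp W := subgrp_gen _.
have Zx : x \in Z by rewrite ZE !inE eqxx orbT.
have Zy : y \in Z by rewrite ZE !inE eqxx orbT.
have xW : x \in W by rewrite -sub1set sub_gen.
have sxZ : [set 0; x] \subset Z by rewrite ZE subsetUl.
have sWL : W \subset L by apply: gen_min; rewrite // sub1set (subsetP sZL).
have [Q [p [p_surj p_ker]]] := quotient_exists gW.
have pL : p @: L \subset gen [set p y].
  rewrite quo_gen; apply: gen_min; first exact: subgrp_gen.
  have g0 := grp0 (subgrp_gen [set p y]).
  have gy : p y \in gen [set p y] by rewrite -sub1set sub_gen.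
  apply/subsetP => _ /imsetP [u Uu ->]; move: Uu; rewrite ZE !inE -orbA.
  case/or3P => /eqP -> //; first by rewrite raddf0.
  by move: xW; rewrite -p_ker => /eqP ->.
have [cardL oE NW] := rows_bound gW sWL p_surj p_ker pL.
have pLE : p @: L = gen [set p y].
  apply/eqP; rewrite eqEsubset pL gen_sub ?quo_subgrp // sub1set imset_f //.
  exact: subsetP sZL _ Zy.
have [o [o0 yo cardo in_gen inj]] := gen1_exists (p y).
rewrite pLE cardo in cardL oE.
have WE : (#|W| <= E)%N := card_gen1 (ltnW E2) (killE x).
have [_ apn sizes [g Lg nE]] := exo.
have [r ro gr] : exists2 r, (r < o)%N & p g = p y *+ r.
  by apply: in_gen; rewrite -pLE imset_f.
(* Otherwise r copies of y and n - r terms from {0, x} reach the missed point [g]. *)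
have rW : (n - r + 1 < #|W|)%N.
  rewrite ltnNge; apply/negP => W_le.
  have gyW : g - y *+ r \in W by rewrite -(quo_eq p_ker) raddfMn gr.
  rewrite addn1 in W_le; move: gyW; rewrite /W -(nsum_pair_full W_le) => H.
  have rn : (r <= n)%N by move: ro oE En; clear; lia.
  have := mem_sumset (mulrn_nsum r Zy) (subsetP (nsum_mono _ sxZ) _ H).
  by rewrite -nsumD subnKC // addrC subrK nE in_setD1 eqxx.
have [W4 o4] : (4 <= #|W| /\ 4 <= o)%N by move: rW ro oE WE En; clear => *; split; clia.
(* Four rows of 3Z in distinct cosets of [W], with at least 4, 3, 2 and 1 elements: more than the
   3|Z| = 9 allowed. *)
pose T (i : 'I_4) := (y *+ i) +: nsum (3 - i) [set 0; x].
have cT (i : 'I_4) : (4 - i <= #|T i|)%N.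
  rewrite card_translate; apply: leq_trans (card_nsum_pair _ _).
  by move: W4 (ltn_ord i); rewrite -/W; clear; clia.
have sT (i : 'I_4) : T i \subset nsum 3 Z.
  have i3 : (i <= 3)%N by rewrite -ltnS.
  rewrite -[X in nsum X _](subnKC i3) nsumD.
  apply: subset_trans (subset_sumsetl _ (mulrn_nsum i Zy)).
  by rewrite translateS nsum_mono.
have dT i j u : u \in T i -> u \in T j -> i = j.
  have pT k : u \in T k -> p u = p y *+ k.
    rewrite mem_translate => H; apply/eqP; rewrite -raddfMn (quo_eq p_ker).
    apply: subsetP _ _ H; rewrite /W -gen_set2; exact: nsum_sub_gen.
  move=> /pT E1 /pT E3; apply: val_inj; apply: inj; rewrite ?(leq_trans (ltn_ord _)) //.
  by rewrite -E1.
have := sum_card_disjoint sT dT; rewrite sizes; last exact: leq_trans (leq_trans W4 WE) (ltnW En).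
rewrite Z3; have : (\sum_(i < 4) (4 - i) <= \sum_i #|T i|)%N by apply: leq_sum => i _.
rewrite 4!big_ord_recl big_ord0 /= => /leq_trans H /H.
by [].
Qed.

(** As |2Z| = 2|Z|, the pair (Z, Z) is critical with mu = 1, and each outcome of
    [critical_structure] is excluded. If [Z] has two defective cosets, a third coset gives by
    [third_coset] a subgroup for [no_qualifying]; without one, [two_rows] contradicts |Z| > 3. *)
Lemma exotic_absurd : False.
Proof.
have small := exotic_card_gt3; have [cardL apn sizes _] := exo.
have BL : (#|Z :+: Z| + 2 <= #|L|)%N.
  rewrite -{1 2}(nsum1 Z) -nsumD c2 cL.
  by apply: leq_trans (leq_mul n3 (leqnn #|Z|)); rewrite mulSn addnC leq_add2r.
have ZZ : (#|Z :+: Z| + 1 <= #|Z| + #|Z| + 1)%N.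
  by rewrite -{1 2}(nsum1 Z) -nsumD c2 mul2n addnn.
case: (critical_structure Z0 Z1 (leqnn 1) sZL Z1 BL ZZ).
- move=> [M [gM M1 sM ML holes]].
  by apply: (no_qualifying gM M1 sM ML); rewrite addn1 addn1 ltnS in holes.
- by move=> [x Lx]; have := exotic_noncyclic x; rewrite /L Lx eqxx.
- case=> _ [[x [z1 [z2 [sWL WL x0 [Zz1 Zz2 z21 full grow]]]]]|].
    have gW := subgrp_gen [set x].
    have [[c farc]|no_c] := classic (exists c, [/\ c \in Z, c \notin z1 +: gen [set x] &
        c \notin z2 +: gen [set x]]).
      have full' z : [/\ z \in Z, z \notin z1 +: gen [set x] & z \notin z2 +: gen [set x]] ->
        z +: gen [set x] \subset Z by case; apply: full.
      have [gP sWP sPL PL qP] := third_coset gW sWL full' farc.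
      apply: (no_qualifying gP _ sPL PL qP).
      apply: leq_trans (subset_leq_card sWP).
      have := subset_leq_card (sub_gen [set 0; x]); rewrite gen_set2; apply: leq_trans.
      by rewrite cards2 eq_sym x0.
    have : (#|Z| <= 3)%N; last by rewrite leqNgt small.
    apply: (two_rows sWL Zz1 Zz2 z21) => [|i /grow [] //].
    apply/subsetP => z Zz; rewrite in_setU; apply: contraT; rewrite negb_or => /andP [f1 f2].
    by case: no_c; exists z.
  move=> [U [gU U3 U0 ZU]].
  by have := three_element gU U3 U0 ZU; rewrite leqNgt small.
Qed.

End ExoticAbsurd.

(** * Terms of large multiplicity *)

Lemma add_nsum_sums (G : finZmodType) n (v : G -> nat) (t u : G) : (0 < v t)%N ->
  u \in nsum n [set g | (n < v g)%N] -> t + u \in sums n.+1 v.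
Proof.
set Z := [set g | _] => vt /mem_nsum_ord [f [fZ ->]].
apply/sumsP; exists (fun i => if unlift ord0 i is Some j then f j else t); split=> [g|].
  have [gZ|gZ] := boolP (g \in Z).
    move: gZ; rewrite in_set => lt_n; apply: leq_trans lt_n.
    by apply: leq_trans (max_card _) _; rewrite card_ord.
  have sub : [set i : 'I_n.+1 | (if unlift ord0 i is Some j then f j else t) == g] \subset
      [set i | (i == ord0) && (t == g)].
    apply/subsetP => i; rewrite !in_set; case: unliftP => [j ->|->] /eqP E; last by rewrite E !eqxx.
    by move: gZ; rewrite -E fZ.
  apply: leq_trans (subset_leq_card sub) _.
  have [<-|tg] := eqVneq t g.
    apply: leq_trans vt; rewrite -(cards1 (@ord0 n)); apply: subset_leq_card.
    by apply/subsetP => i; rewrite in_set in_set1 => /andP [].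
  rewrite (_ : [set i | _] = set0) ?cards0 //; apply/setP => i; rewrite !in_set.
  by rewrite andbF.
rewrite big_ord_recl unlift_none; congr (_ + _); apply: eq_bigr => i _.
by rewrite liftK.
Qed.

Section Frequent.
Variables (G : finZmodType) (n h : nat) (v : G -> nat).
Implicit Types (K : {set G}) (x y z g : G).
Let Z : {set G} := [set g | (n <= v g)%N].
Let X := sums n v.
Let e := eout v Z.

(** At most e <= n - 2 chosen terms lie outside [Z], so two of them lie in [Z] and can be exchanged
    to absorb an element of [K]. *)
Lemma sums_pair_periodic K : (e + 2 <= n)%N ->
    (forall y z k, y \in Z -> z \in Z -> k \in K -> y + z + k \in Z :+: Z) ->
  K \subset stab X.
Proof.
move=> en pairs; apply/subsetP => k Kk; apply: stabP => x /sumsP [f [f_le ->]].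
have : (1 < #|~: [set i | f i \notin Z]|)%N.
  have := cardsC [set i | f i \notin Z]; rewrite card_ord.
  have := card_outside f_le (subxx Z); rewrite -/e; move: en.
  by clear; lia.
case/card_gt1P => i [j [iZ jZ ij]]; rewrite !in_setC !in_set !negbK in iZ jZ.
have Zi : f i \in Z by rewrite in_set.
have Zj : f j \in Z by rewrite in_set.
have /sumsetP [z [z' [Zz Zz' E]]] := pairs _ _ k Zi Zj Kk.
have -> : k + \sum_l f l = \sum_l (if l == i then z else if l == j then z' else f l).
  rewrite (bigD1 i) //= (bigD1 j) /=; last by rewrite eq_sym.
  rewrite [RHS](bigD1 i) //= [X in _ = _ + X](bigD1 j) /=; last by rewrite eq_sym.
  rewrite !eqxx [j == i]eq_sym (negPf ij).
  have -> : \sum_(l | (l != i) && (l != j)) (if l == i then z else if l == j then z' else f l) =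
      \sum_(l | (l != i) && (l != j)) f l.
    by apply: eq_bigr => l /andP [/negPf -> /negPf ->].
  move: (\sum_(l | _) _) => s.
  have -> : k + (f i + (f j + s)) = f i + f j + k + s by zmod.
  by rewrite E -addrA.
apply: (sums_mix f_le) => l; case: ifP => _; first by right.
by case: ifP => _; [right|left].
Qed.

(** Here [h] stands for |H|. The aperiodic bound taken h times and the upper bound combine to h <=
    (h - 1)(n - e), so n - e >= 2; if n|Z| <= |X|, the upper bound would give n <= e. *)
Lemma frequent_bounds : (0 < n)%N -> (2 <= h)%N -> (0 < #|Z|)%N -> stab X \subset [set 0] ->
    (h * #|X| + n <= n * #|Z| * h + e)%N ->
  [/\ (n * #|Z| + e < #|X| + n)%N, (e + 2 <= n)%N & (#|X| < n * #|Z|)%N].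
Proof.
move=> n0 h2 Z1 ap up.
have [z Zz] : exists z, z \in Z by apply/set0Pn; rewrite -card_gt0.
have nv : (n <= \sum_g v g)%N.
  by rewrite (bigD1 z) //=; move: Zz; rewrite in_set => Zz; apply: leq_trans Zz (leq_addr _ _).
have := card_sums_aperiodic nv ap; rewrite sum_minn_split -/Z -/(eout v Z) -/e -/X mulnC => lo.
have step : (h * (n * #|Z| + e + 1) <= h * (#|X| + n))%N by rewrite leq_mul2l addn1 lo orbT.
have [k hE] : exists k, h = k.+2 by exists h.-2; move: h2; case: (h) => [|[]].
have en : (e + 2 <= n)%N.
  move: step up; rewrite hE !mulnDr !muln1 [(n * _ * _)%N]mulnC.
  move: (k.+2 * (n * #|Z|))%N (k.+2 * #|X|)%N => a b s1 s2.
  have : (k.+2 * e + k.+2 + n <= k.+2 * n + e)%N by move: s1 s2; clear; lia.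
  rewrite !mulSn => s3; rewrite leqNgt; apply/negP => lt_n.
  have : (k * n <= k * e.+1)%N by rewrite leq_mul2l; apply/orP; right; move: lt_n; clear; lia.
  by rewrite mulnS; move: s3 lt_n; move: (k * n)%N (k * e)%N => a1 b1; clear; lia.
split=> //; rewrite ltnNge; apply/negP => big.
have : (h * (n * #|Z|) <= h * #|X|)%N by rewrite leq_mul2l big orbT.
by move: up en; rewrite [(n * _ * _)%N]mulnC; move: (h * (n * _))%N (h * _)%N => a b; clear; lia.
Qed.

(** [full_nsum_bound] excludes nZ = L. Modulo the stabilizer [K] of nZ, [nsum_dichotomy] and
    [exotic_absurd] leave only an exotic set with n = E. If [K] were nontrivial, Z + K would have so
    few holes that pairs of elements of [Z] absorb [K], making [X] periodic. So [K] is trivial, X =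
    nZ has n|Z| - 1 elements, and the upper bound gives n <= h. *)
Lemma frequent_exponent E : (0 < n)%N -> (2 <= h)%N -> stab X \subset [set 0] ->
    (h * #|X| + n <= n * #|Z| * h + e)%N -> (2 <= E)%N -> (forall x : G, x *+ E = 0) ->
    (E <= n)%N -> 0 \in Z -> (1 < #|Z|)%N ->
  n = E /\ (n <= h)%N.
Proof.
move=> n0 h2 ap up E2 killE En Z0 Z1.
have [lo en small] := frequent_bounds n0 h2 (ltnW Z1) ap up.
have sub : nsum n Z \subset X := nsum_sub_sums n v.
set L := gen Z; have gL : subgrp L := subgrp_gen Z; have sZL : Z \subset L := sub_gen Z.
have Zn0 : Z != set0 by apply/set0Pn; exists 0.
set K := stab (nsum n Z); have gK : subgrp K := subgrp_stab _.
have sKL : K \subset L := stab_sub_grp gL (nsum_neq0 n Zn0) (nsum_sub_gen n Z).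
have KL : K != L.
  apply/eqP => KL.
  have nL : nsum n Z = L.
    by apply: (periodic_sub_eq gL (nsum_neq0 n Zn0) (nsum_sub_gen n Z)); rewrite -KL.
  by have := full_nsum_bound Z0 Z1 ap en nL; rewrite mulnC leqNgt small.
have [Q [p [p_surj p_ker]]] := quotient_exists gK.
have killQ (q : Q) : q *+ E = 0.
  by have [x <-] := p_surj q; rewrite -raddfMn killE raddf0.
have pZ0 : 0 \in p @: Z by rewrite -(raddf0 p) imset_f.
have apQ : stab (nsum n (p @: Z)) \subset [set 0].
  by rewrite -quo_nsum (stab_quo p_surj p_ker (erefl K)).
have k1 : (1 < #|p @: Z|)%N.
  rewrite ltnNge; apply/negP => k1; move/negP: KL; apply.
  rewrite eqEsubset sKL /= gen_sub //; apply/subsetP => z Zz.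
  by rewrite -p_ker -(raddf0 p); apply/eqP; apply: (card_le1_eqP k1); apply: imset_f.
have cN : #|nsum n Z| = (#|K| * #|p @: nsum n Z|)%N.
  by apply: (card_periodic p_surj p_ker); rewrite sumset_stab.
have cZK := card_sumset_quo p_surj p_ker Z.
have ZZK : (#|Z| <= #|Z :+: K|)%N by apply: leq_card_sumset; apply/set0Pn; exists 0; apply: grp0.
have XN := leq_ltn_trans (subset_leq_card sub) small.
have [big|exo] := nsum_dichotomy E2 killQ pZ0 k1 En apQ.
  have := leq_mul (leqnn #|K|) big; rewrite -quo_nsum -cN mulnCA -cZK => big'.
  have := leq_mul (leqnn n) ZZK; move: XN big'.
  by move: (n * #|Z|)%N (n * #|Z :+: K|)%N => a b; clear; clia.
have nE : n = E.
  apply/eqP; rewrite eqn_leq En andbT leqNgt; apply/negP => lt_E.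
  exact: (exotic_absurd E2 killQ pZ0 k1 exo lt_E).
split=> //.
have [cL _ sizes [g Lg gE]] := exo.
have cn : (#|p @: nsum n Z| + 1 = n * #|p @: Z|)%N.
  by rewrite quo_nsum gE -cL (cardsD1 g (gen (p @: Z))) Lg addnC.
have K0 : (0 < #|K|)%N by rewrite card_gt0; apply/set0Pn; exists 0; apply: grp0.
have holes : (n * (#|Z :+: K| - #|Z|) < #|K|)%N.
  have : (#|nsum n Z| + #|K| = n * #|Z :+: K|)%N.
    by rewrite cZK mulnCA -cn mulnDr muln1 -cN.
  rewrite mulnBr; move: XN K0; move: (n * #|Z|)%N (n * #|Z :+: K|)%N => a b; clear; clia.
have [d dE] : exists d, #|Z :+: K| = (#|Z| + d)%N by exists (#|Z :+: K| - #|Z|)%N; rewrite subnKC.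
rewrite dE addKn in holes.
have [K1|K1] := leqP #|K| 1; last first.
  exfalso; have : K \subset stab X.
    apply: sums_pair_periodic => // y z k Zy Zz Kk.
    have full : (#|K| < #|Z :&: (y +: K)| + #|Z :&: (z +: K)|)%N.
      have one u : u \in Z -> (#|K| <= #|Z :&: (u +: K)| + d)%N.
        move=> Zu; have := holes_sub (subset_sumsetl K Zu) gK.
        by rewrite card_translate dE addnC -addnA leq_add2l addnC.
      have n2 := leq_mul (leq_trans E2 En) (leqnn d).
      have := leq_add (one y Zy) (one z Zz); move: holes n2.
      by move: (n * d)%N => w; clear; clia.
    have := pair_full gK full; rewrite nsumS nsum1 => /subsetP; apply.
    by rewrite mem_translate addrC addKr.
  move/subset_trans/(_ ap)/subset_leq_card; rewrite cards1.
  by rewrite leqNgt K1.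
have KE : K = [set 0].
  by apply/esym/eqP; rewrite eqEcard sub1set grp0 // cards1.
have p_inj x : (p x == 0) = (x == 0) by rewrite p_ker KE in_set1.
have card_p (A : {set G}) : #|p @: A| = #|A|.
  apply: card_imset => x y /eqP; rewrite (quo_eq p_ker) KE in_set1 subr_eq0.
  by move/eqP.
have d0 : d = 0%N by move: dE; rewrite cZK KE cards1 mul1n card_p; clear; clia.
have XE : X = nsum n Z.
  apply/esym/eqP; rewrite eqEcard sub /=; move: small cn.
  by rewrite !card_p; move: (n * _)%N => w; clear; clia.
have cL' : #|L| = (n * #|Z|)%N by rewrite -card_p quo_gen cL card_p.
have [g0 Lg0 g0n] : exists2 g0, g0 \in L & g0 \notin X.
  apply/subsetPn; apply/negP => /subset_leq_card.
  by rewrite cL' leqNgt small.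
(* With a term t outside [Z], the set (n - 1)Z, of size |L| - |Z|, would have to avoid g0 - z for
   the |Z| + 1 elements z of [Z] and t. *)
have e0 : e = 0%N.
  apply/eqP; rewrite sum_nat_eq0; apply/forall_inP => t tZ; rewrite -leqn0 leqNgt; apply/negP => vt.
  have addt u : u \in nsum n.-1 Z -> t + u \in X.
    move=> un; have := @add_nsum_sums G n.-1 v t u vt.
    by rewrite (prednK n0); apply.
  have addz z u : z \in t |: Z -> u \in nsum n.-1 Z -> z + u \in X.
    rewrite in_setU1 => /orP [/eqP ->|Zz] un; first exact: addt.
    by rewrite XE -(prednK n0) nsumS mem_sumset.
  have zL z : z \in t |: Z -> z \in L.
    move=> tz; have := addz z 0 tz (nsum_0in _ Z0); rewrite addr0 XE.
    exact: subsetP (nsum_sub_gen _ _) z.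
  pose D := [set g0 - z | z in t |: Z].
  have cD : #|D| = (#|Z| + 1)%N.
    rewrite [#|D|]card_in_imset; first by rewrite cardsU1 tZ addnC.
    by move=> a b _ _ /addrI /oppr_inj.
  have dis : #|nsum n.-1 Z :&: D| = 0%N.
    apply/eqP; rewrite cards_eq0; apply/eqP/setP => x; rewrite in_setI in_set0.
    apply/negP => /andP [xn /imsetP [z tz xE]]; move/negP: g0n; apply.
    by have H := addz z x tz xn; rewrite xE in H; zmem_from H.
  have : (#|nsum n.-1 Z :|: D| <= #|L|)%N.
    apply: subset_leq_card; rewrite subUset nsum_sub_gen; apply/subsetP => _ /imsetP [z tz ->].
    by rewrite grpB // zL.
  rewrite cardsU dis subn0 cD cL' -card_p quo_nsum sizes; last first.
    by rewrite prednK // leqnn andbT -ltnS prednK // (leq_trans E2).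
  rewrite card_p -[in X in (_ <= X)%N](prednK n0) mulSn; move: (n.-1 * _)%N => w.
  by clear; clia.
(* With |X| = n|Z| - 1 the upper bound reads h(n|Z| - 1) + n <= n|Z|h. *)
move: up; rewrite XE e0 addn0; have : (#|nsum n Z| + 1 = n * #|Z|)%N by rewrite -!card_p.
move=> <-; rewrite mulnDl mul1n [(h * _)%N]mulnC leq_add2l; exact.
Qed.

End Frequent.

Section Shift.
Variables (G : finZmodType) (n : nat).
Implicit Types (v : G -> nat) (x z g : G).

Lemma sums_shift_sub v z x : x \in sums n (fun g => v (g + z)) -> x + z *+ n \in sums n v.
Proof.
case/sumsP => f [f_le ->]; apply/sumsP; exists (fun i => f i + z); split=> [g|].
  have := f_le (g - z); rewrite subrK; apply: leq_trans; apply: subset_leq_card.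
  by apply/subsetP => i; rewrite !in_set => /eqP <-; rewrite addrK.
by rewrite big_split /= sumr_const card_ord.
Qed.

Lemma sums_shift v z : sums n (fun g => v (g + z)) = (- (z *+ n)) +: sums n v.
Proof.
apply/setP => x; rewrite mem_translate opprK; apply/idP/idP; first exact: sums_shift_sub.
move=> H; have := @sums_shift_sub (fun g => v (g + z)) (- z) (x + z *+ n).
rewrite mulNrn addrK; apply.
rewrite (_ : sums n _ = sums n v) //; apply/setP => y; apply/sumsP/sumsP => -[f [f_le yE]];
  exists f; split=> // g; have := f_le g; by rewrite ?subrK // -?addrA ?[z - z]subrr
    ?addr0 ?addNr ?addr0.
Qed.

Lemma frequent_shift v z :
  [set g | (n <= v (g + z)%R)%N] = (- z) +: [set g | (n <= v g)%N].
Proof. by apply/setP => g; rewrite mem_translate opprK !in_set. Qed.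

Lemma eout_shift v z (Z : {set G}) : eout (fun g => v (g + z)) ((- z) +: Z) = eout v Z.
Proof.
rewrite /eout [RHS](reindex_inj (addIr z)) /=; apply: eq_bigl => g.
by rewrite mem_translate opprK.
Qed.

End Shift.

Lemma few_frequent (G : finZmodType) (n h E : nat) (v : G -> nat)
    (Z := [set g | (n <= v g)%N]) : (0 < n)%N -> (2 <= h)%N ->
    stab (sums n v) \subset [set 0] ->
    (h * #|sums n v| + n <= n * #|Z| * h + eout v Z)%N ->
    (0 < E)%N -> (forall x : G, x *+ E = 0) ->
    [\/ (E < n)%N, (h < E <= n)%N, (E <= n)%N /\ #|G| = (2 * E)%N | (#|G| - 1 <= n)%N] ->
  (#|Z| <= 1)%N.
Proof.
move=> n0 h2; rewrite /Z {Z}.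
wlog Z0 : v / 0 \in [set g | (n <= v g)%N] => [wl|].
  have [->|/set0Pn [z Zz]] := eqVneq [set g | (n <= v g)%N] set0; first by rewrite cards0.
  have := wl (fun g => v (g + z)); rewrite frequent_shift eout_shift sums_shift.
  rewrite stab_translate !card_translate; apply.
  by rewrite mem_translate opprK add0r.
set Z := [set g | _] in Z0 *; set X := sums n v => ap up E0 killE cond.
rewrite leqNgt; apply/negP => Z1.
have [lo en small] := frequent_bounds n0 h2 (ltnW Z1) ap up.
rewrite -/Z -/X in lo en small.
have XG : (#|X| < #|G|)%N.
  rewrite ltnNge; apply/negP => big.
  have XT : X = [set: G] by apply/eqP; rewrite eqEcard subsetT cardsT.
  have : [set: G] \subset [set 0] by move: ap; rewrite -/X XT (stab_grp (subgrp_setT G)).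
  move/subset_leq_card; rewrite cards1 cardsT.
  by move/(leq_trans (leq_trans Z1 (max_card _))).
have n2 := leq_mul (leqnn n) Z1.
have E2 : (2 <= E)%N.
  rewrite ltn_neqAle E0 andbT; apply/eqP => E1; move: Z1; rewrite ltnNge => /negP; apply.
  rewrite -(cards1 (0 : G)); apply: subset_leq_card; apply/subsetP => x _.
  by rewrite in_set1 -[x]mulr1n E1 killE.
have nh : (E <= n)%N -> n = E /\ (n <= h)%N.
  by move=> En; apply: (frequent_exponent n0 h2 ap up E2 killE En Z0 Z1).
case: cond => [En|/andP [hE En]|[En cG]|Gn].
- by have [nE _] := nh (ltnW En); rewrite nE ltnn in En.
- by have [nE nh'] := nh En; rewrite nE in nh'; move: (leq_trans hE nh'); rewrite ltnn.
(* If |Z| >= 3 the lower bound gives |X| > 2n = |G|. If Z = {0, x}, the group <x> has order at most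
   n, so nZ is the whole of <x>, against [full_nsum_bound]. *)
- have [nE _] := nh En; have [Z3|Z2] := ltnP 2 #|Z|.
    have := leq_mul (leqnn n) Z3; move: lo XG; rewrite cG -nE mulnC [(n * 3)%N]mulnC.
    by move: (#|Z| * n)%N => w; clear; clia.
  have /cards2P [a [b [_ ZE]]] : #|Z| == 2%N by rewrite eqn_leq Z2 Z1.
  have : exists x, Z = [set 0; x].
    move: Z0; rewrite ZE !inE => /orP [] /eqP E1; first by exists b; rewrite E1.
    by exists a; rewrite E1 setUC.
  move=> [x Zx]; have le_n : (#|gen [set x]| <= n.+1)%N.
    by apply: leqW; rewrite nE; apply: card_gen1.
  have := full_nsum_bound Z0 Z1 ap en; rewrite -/Z Zx (nsum_pair_full le_n) gen_set2 => /(_ erefl).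
  by rewrite -Zx mulnC leqNgt small.
(* From |Z| >= 2 the lower bound gives |X| > n >= |G| - 1, although [X] is not all of G. *)
- by move: XG lo n2 Gn; move: (n * #|Z|)%N => w; clear; clia.
Qed.

(** * The main dichotomy *)

Lemma coset_setpartition (G : finZmodType) (n l : nat) (v : G -> nat) (K : {set G}) (a : G)
    (e := eout v (a +: K)) (B : 'I_(n - e) -> {set G}) :
    subgrp K -> (1 < #|K|)%N -> (e <= n)%N ->
    cfg (vres v (a +: K)) B -> tot B = (n - e + #|K| - 1)%N -> \Sum_i B i = (a *+ (n - e)) +: K ->
    ((e + 1) * #|K| + n <= l)%N -> (l <= \sum_g minn n (v g))%N ->
  exists A : 'I_n -> {set G},
    [/\ cfg v A, tot A = l, \Sum_i A i = sums n v,
        forall g, g \notin a +: K -> occ A g = v g &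
      [/\ forall i, (a +: K) :&: A i != set0,
          forall i : 'I_n, (i < n - e)%N -> A i \subset a +: K,
          forall i : 'I_n, (n - e <= i)%N -> #|A i :\: (a +: K)| = 1%N &
          \Sum_(i : 'I_n | (i < n - e)%N) A i = (a *+ (n - e)) +: K]].
Proof.
move=> gK K1 en; have : (n = n - e + e)%N by rewrite subnK.
move: (n - e)%N B => nu B nE cB tB BE l_ge l_le; rewrite {}nE in l_ge l_le *.
exact: structured_setpartition gK erefl K1 cB tB BE l_ge l_le.
Qed.

Section Main.
Variables (G : finZmodType) (n l E : nat) (v : G -> nat).
Let Y := sums n v.
Let H := stab Y.
Hypotheses (n0 : (0 < n)%N) (nl : (n <= l)%N) (l_le : (l <= \sum_g minn n (v g))%N).

Let gH : subgrp H. Proof. exact: subgrp_stab. Qed.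

Lemma sums_main_coset : (0 < E)%N -> (forall x : G, x *+ E \in H) -> (1 < #|H|)%N ->
    [\/ (E < n)%N, (#|H| < E <= n)%N, (E <= n)%N /\ #|G| = (#|H| * (2 * E))%N |
        (#|G| <= #|H| * n.+1)%N] ->
    (#|Y| + n <= l)%N ->
  exists a, ((eout v (a +: H) + 1) * #|H| <= #|Y|)%N.
Proof.
move=> E0 killE H1 cond big.
have [Q [p [p_surj p_ker]]] := quotient_exists gH.
have cY : #|Y| = (#|H| * #|p @: Y|)%N by apply: (card_periodic p_surj p_ker); apply: sumset_stab.
have cG : #|G| = (#|H| * #|Q|)%N.
  have := card_periodic p_surj p_ker (A := [set: G]); rewrite cardsT => ->; last first.
    by apply/eqP; rewrite -subTset subset_sumsetr ?grp0 // .
  congr (_ * _)%N; rewrite -cardsT; congr #|pred_of_set _|; apply/setP => q; rewrite in_setT.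
  by have [x <-] := p_surj q; rewrite imset_f ?in_setT.
have killQ (q : Q) : q *+ E = 0.
  by have [x <-] := p_surj q; rewrite -raddfMn; apply/eqP; rewrite p_ker.
pose w := vmap p v; have wE : sums n w = p @: Y by apply: sums_vmap.
have ap : stab (sums n w) \subset [set 0] by rewrite wE (stab_quo p_surj p_ker (erefl H)).
pose Z := [set q | (n <= w q)%N].
have eE : eout w Z = (\sum_(g | p g \notin Z) v g)%N.
  have := @sum_vmap_cond _ _ p v (~: Z); rewrite /eout.
  by under eq_bigl do rewrite in_setC; under [RHS]eq_bigl do rewrite in_setC.
have up : (#|H| * #|sums n w| + n <= n * #|Z| * #|H| + eout w Z)%N.
  rewrite wE -cY; apply: leq_trans big _; apply: leq_trans l_le _.
  rewrite (bigID (fun g => p g \in Z)) /= leq_add //.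
    apply: leq_trans (card_vmap_fibre p_surj p_ker v n Z) _.
    by rewrite mulnA [(#|Z| * n)%N]mulnC.
  by rewrite eE; apply: leq_sum => g _; apply: geq_minr.
have nw : (n <= \sum_q w q)%N.
  rewrite (sum_vmap p); apply: leq_trans nl (leq_trans l_le _).
  by apply: leq_sum => g _; apply: geq_minr.
have := card_sums_aperiodic nw ap; rewrite (sum_minn_split n w) -/Z -/(eout w Z) => lo.
have H0 : (0 < #|H|)%N := ltnW H1.
have : (#|Z| <= 1)%N.
  apply: (few_frequent n0 H1 ap up E0 killQ).
  case: cond => [lt|lt|[le cG']|le]; [by constructor 1|by constructor 2|constructor 3|constructor 4].
    by split=> //; apply/eqP; rewrite -(eqn_pmul2l H0) -cG cG'.
  by move: le; rewrite cG leq_pmul2l // => le; rewrite leq_subLR add1n.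
rewrite leq_eqVlt ltnS leqn0 => /orP [/cards1P [q0 ZE]|/eqP Z0]; last first.
  move: lo up; rewrite Z0 muln0 !mul0n add0n.
  have := leq_mul H1 (leqnn #|sums n w|); move: (#|H| * _)%N => s; clear; clia.
have [a pa] := p_surj q0; exists a.
have -> : eout v (a +: H) = eout w Z.
  rewrite eE; apply: eq_bigl => g.
  by rewrite ZE in_set1 mem_translate -(quo_eq p_ker) pa.
rewrite cY -wE mulnC leq_pmul2l //.
by move: lo; rewrite ZE cards1 mul1n; clear; clia.
Qed.

Theorem setpartition_dichotomy : H = [set 0] \/ H = [set: G] \/
    [/\ (0 < E)%N, forall x : G, x *+ E \in H &
      [\/ (E < n)%N, (#|H| < E <= n)%N, (E <= n)%N /\ #|G| = (#|H| * (2 * E))%N |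
          (#|G| <= #|H| * n.+1)%N]] ->
  exists A : 'I_n -> {set G}, [/\ cfg v A, tot A = l &
    (minn #|G| (l - n + 1) <= #|\Sum_i A i|)%N \/
    exists (K : {set G}) (a : G),
    [/\ [/\ subgrp K, (1 < #|K|)%N, K \subset H & H != [set: G]],
        \Sum_i A i = Y /\ (forall g, g \notin a +: K -> occ A g = v g),
        (#|Y| + n <= l)%N /\ (#|Y| + #|H| <= #|G|)%N,
        ((eout v (a +: H) + 1) * #|H| <= #|Y|)%N /\ ((eout v (a +: K) + 1) * #|K| <= #|Y|)%N &
        let e := eout v (a +: K) in
        [/\ forall i, (a +: K) :&: A i != set0,
          forall i : 'I_n, (i < n - e)%N -> A i \subset a +: K,
          forall i : 'I_n, (n - e <= i)%N -> #|A i :\: (a +: K)| = 1%N &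
          \Sum_(i : 'I_n | (i < n - e)%N) A i = (a *+ (n - e)) +: K]]].
Proof.
move=> cond; have [A [cA tA PT]] := partition_theorem (cfg_exists nl l_le).
have done : (minn #|G| (l - n + 1) <= #|\Sum_i A i|)%N \/
    [/\ \Sum_i A i = Y, (#|Y| + n <= l)%N & (#|Y| < #|G|)%N].
  case: PT => [lt|E1]; first by left; rewrite geq_min; apply/orP; right; move: lt nl; clear; clia.
  rewrite E1 -/Y; have [big|small] := leqP #|G| #|Y|; first by left; rewrite geq_min big.
  have [lt|le] := ltnP l (#|Y| + n); last by right.
  by left; rewrite geq_min; apply/orP; right; move: lt nl; clear; clia.
case: done => [i|[AY big YG]]; first by exists A; split=> //; left.
have nv : (n <= \sum_g v g)%N.
  by apply: leq_trans nl (leq_trans l_le _); apply: leq_sum => g _; apply: geq_minr.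
have Y0 : Y != set0 := sums_neq0 nv.
have HT : H != [set: G].
  apply/eqP => HT; move: YG; rewrite ltnNge => /negP; apply.
  rewrite -cardsT -HT; exact: card_stab_le.
have H1 : (1 < #|H|)%N.
  rewrite ltnNge; apply/negP => H1; have HE : H = [set 0].
    by apply/esym/eqP; rewrite eqEcard sub1set grp0 // cards1.
  have ap : stab (sums n v) \subset [set 0] by rewrite -/Y -/H HE.
  have := card_sums_aperiodic nv ap; rewrite -/Y ltnNge => /negP; apply.
  exact: leq_trans big l_le.
have [a0 a0P] : exists a, ((eout v (a +: H) + 1) * #|H| <= #|Y|)%N.
  case: cond => [HE|[HE|[E0 kill cond]]].
  - by move: H1; rewrite HE cards1.
  - by rewrite HE eqxx in HT.
  - exact: sums_main_coset.
(* Keeping alpha in a0 + H ensures alpha + H = a0 + H, so the bound on e_H survives the minimization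
   of |K|. *)
pose good (Ka : {set G} * G) := [/\ subgrp Ka.1, Ka.1 \subset H, Ka.2 \in a0 +: H &
  ((eout v (Ka.2 +: Ka.1) + 1) * #|Ka.1| <= #|Y|)%N].
have [|[K a] [[/= gK KH aH K_le] minK]] := @ex_min_nat _ good (fun Ka => #|Ka.1|).
  by exists (H, a0); split=> //=; rewrite mem_translate subrr grp0.
have minK' (K1 : {set G}) a1 : subgrp K1 -> K1 \subset K -> a1 \in a +: K ->
    ((eout v (a1 +: K1) + 1) * #|K1| <= #|sums n v|)%N -> (#|K| <= #|K1|)%N.
  move=> gK1 sK1 a1K K1_le; apply: (minK (K1, a1)); split=> //=.
    exact: subset_trans sK1 KH.
  rewrite -(mem_coset_eq gH aH); apply: subsetP a1K.
  by rewrite translateS.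
have [K1 en] := core_bounds gK K_le big l_le.
have [B [cB tB BE]] := core_full gK K_le big l_le minK'.
have l_ge : ((eout v (a +: K) + 1) * #|K| + n <= l)%N.
  by apply: leq_trans big; rewrite leq_add2r.
have [A' [cA' tA' A'Y occA' str]] :=
  coset_setpartition gK K1 (leq_trans (leq_addr 2 _) en) cB tB BE l_ge l_le.
exists A'; split=> //; right; exists K, a; split=> //.
- split=> //; have [Q [p [p_surj p_ker]]] := quotient_exists gH.
  have cY : #|Y| = (#|H| * #|p @: Y|)%N by apply: (card_periodic p_surj p_ker); apply: sumset_stab.
  have cG : #|G| = (#|H| * #|p @: [set: G]|)%N.
    rewrite -(card_periodic p_surj p_ker (A := [set: G])) ?cardsT //.
    by apply/eqP; rewrite -subTset subset_sumsetr ?grp0.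
  move: YG; rewrite cG cY addnC -mulnS ltn_pmul2l ?(ltnW H1) //.
  by rewrite leq_pmul2l ?(ltnW H1).
- by split=> //; rewrite (mem_coset_eq gH aH).
Qed.

End Main.

(** * Multisets and quotient groups *)

Section Sequences.
Variable G : finZmodType.
Implicit Types (S T : {mset G}) (s : seq G) (g x : G).

Lemma count_mset S (P : pred G) : count P S = (\sum_(g | P g) S g)%N.
Proof.
rewrite -sum1_count (partition_big id P) //=; apply: eq_bigr => g Pg.
rewrite -count_mem_mset -sum1_count; apply: eq_bigl => x.
by rewrite /=; case: eqP => [->|_]; rewrite ?Pg ?andbF.
Qed.

Lemma size_mset S : size S = (\sum_g S g)%N.
Proof. by rewrite -count_predT count_mset. Qed.

Lemma num_outside_eout S (A : {set G}) : num_outside S A = eout S A.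
Proof. exact: count_mset. Qed.

Lemma subsums_sums n S : subsums n S = sums n S.
Proof.
have multE (T : n.-tuple G) g : mult (tnth T) g = count_mem g T.
  rewrite /mult -sum1_card -sum1_count big_tuple; apply: eq_bigl => i.
  by rewrite in_set.
apply/setP => x; apply/imsetP/sumsP.
  move=> [T]; rewrite inE => /msubsetP sT ->; exists (tnth T); split=> [g|].
    by rewrite multE -mset_seqE.
  by rewrite big_tuple.
move=> [f [f_le ->]]; exists [tuple f i | i < n].
  rewrite inE; apply/msubsetP => g; rewrite mset_seqE -multE.
  apply: leq_trans (f_le g); rewrite leq_eqVlt; apply/orP; left; apply/eqP.
  by apply: eq_card => i; rewrite !in_set tnth_mktuple.
by rewrite big_tuple; apply: eq_bigr => i _; rewrite tnth_mktuple.
Qed.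

Lemma setpart_seqE n (A : 'I_n -> {set G}) g : setpart_seq A g = occ A g.
Proof.
rewrite mset_seqE count_flatten sumnE big_map big_image occE /=; apply: eq_bigr => i _.
by rewrite count_uniq_mem ?enum_uniq // mem_enum.
Qed.

Lemma size_setpart_seq n (A : 'I_n -> {set G}) : size (setpart_seq A) = tot A.
Proof. by rewrite size_mset tot_occ; apply: eq_bigr => g _; rewrite setpart_seqE. Qed.

Lemma size_le_min_sum n S S' : S' `<=` S -> (max_mult S' <= n)%N ->
  (size S' <= \sum_g minn n (S g))%N.
Proof.
move=> /msubsetP sS mS; rewrite size_mset; apply: leq_sum => g _.
by rewrite leq_min sS andbT (leq_trans _ mS) // /max_mult (bigD1 g) //= leq_maxl.
Qed.

End Sequences.

Section Quotients.
Variables (G : finZmodType) (H : {group G}).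
Let Q := ([set: G] / H)%g.

Let norm_all : [set: G] \subset 'N(H)%g.
Proof. exact: sub_abelian_norm (zmod_abelian _) (subsetT H). Qed.

Lemma card_quotient_setT : (#|G| = #|H| * #|Q|)%N.
Proof. by rewrite card_quotient // Lagrange ?subsetT // cardsT. Qed.

Lemma quotient_exponent x : x *+ exponent Q \in H.
Proof.
have Nx (y : G) : y \in 'N(H)%g by rewrite (subsetP norm_all) ?in_setT.
rewrite -zmodXgE; apply: coset_idr => //.
by rewrite morphX // expg_exponent // mem_quotient ?in_setT.
Qed.

(** After division by |H| the two bounds are (e + 2)|H| <= |G| and (e + 1)|H| + n <= l. *)
Lemma eout_rat_bound (e l n y : nat) : (n <= l)%N ->
    ((e + 1) * #|H| <= y)%N -> (y + n <= l)%N -> (y + #|H| <= #|G|)%N ->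
  e%:R <= Num.min (#|Q|%:R - 2) ((l%:R - n%:R) / #|H|%:R - 1) :> rat.
Proof.
move=> nl ey yl yG; have H0 : (0 < #|H|)%N := cardG_gt0 H.
rewrite le_min !lerBrDr; apply/andP; split.
  rewrite -natrD ler_nat -(leq_pmul2l H0) -card_quotient_setT; apply: leq_trans yG.
  by apply: leq_trans (leq_add ey (leqnn _)); rewrite mulnC addn2 addn1 mulSn addnC.
rewrite ler_pdivlMr ?ltr0n // -natrB // natr1 -natrM ler_nat.
by rewrite leq_subRL // addnC (leq_trans _ yl) // leq_add2r -addn1.
Qed.

Lemma isog_C2_Ce_card (e : nat) : (0 < e)%N -> isog_C2_Ce Q e -> #|Q| = (2 * e)%N.
Proof.
by move=> e0 /card_isog ->; rewrite cardsX !card_Zp.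
Qed.

End Quotients.

Theorem theorem1p1 (G : finZmodType) (n : nat) (S S' : {mset G}) :
  let H : {group G} := [group of stab (subsums n S)] in
  let Q := ([set: G] / H)%g in
  (1 <= n)%N ->
  S' `<=` S ->
  (max_mult S' <= n <= size S')%N ->
  [\/ H :=: [set 0],
      H :=: [set: G] |
   [\/ (exponent Q + 1 <= n)%N,
       (#|H| < exponent Q <= n)%N,
       (exponent Q <= n)%N /\ isog_C2_Ce Q (exponent Q) |
       (exponent Q - 1 <= n)%N /\ cyclic Q]] ->
  exists A : 'I_n -> {set G},
    [/\ is_setpartition A,
        setpart_seq A `<=` S,
        size (setpart_seq A) = size S' &
        (minn #|G| (size S' - n + 1) <= #|\sumset_(i < n) A i|
           <= #|subsums n S|)%N
        \/
        exists (K : {group G}) (alpha : G),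
          let eH := num_outside S (translate alpha H) in
          let eK := num_outside S (translate alpha K) in
          [/\ [/\ K :!=: [set 0], K \subset H & H \proper [set: G]],
              subsums n S = \sumset_(i < n) A i /\
              {subset S `\` setpart_seq A <= translate alpha K},
              [/\ ((eH + 1) * #|H| <= #|subsums n S|)%N,
                  eH%:R <= Num.min (#|Q|%:R - 2)
                    (((size S')%:R - n%:R) / #|H|%:R - 1) :> rat,
                  ((eK + 1) * #|K| <= #|subsums n S|)%N &
                  eK%:R <= Num.min (#|([set: G] / K)%g|%:R - 2)
                    (((size S')%:R - n%:R) / #|K|%:R - 1) :> rat],
              [/\ forall i : 'I_n, translate alpha K :&: A i != set0,
                  forall i : 'I_n,
                    (i < n - eK)%N -> A i \subset translate alpha K &
                  forall i : 'I_n,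
                    (n - eK <= i)%N -> #|A i :\: translate alpha K| = 1%N] &
              \sumset_(i < n | (i < n - eK)%N) A i
                = translate (alpha *+ (n - eK)) K]].

Proof.
move=> H Q n0 sS /andP [mS nS] cond.
have YE := subsums_sums n S.
have HE : stab (sums n S) = H :> {set G} by rewrite -YE.
have cG := card_quotient_setT H.
(* Hypotheses 3 and 4 are used through the order of [Q] alone, which is 2 exp(Q) in the former and
   exp(Q) <= n + 1 in the latter. *)
have cond' : stab (sums n S) = [set 0] \/ stab (sums n S) = [set: G] \/
    [/\ (0 < exponent Q)%N, forall x : G, x *+ exponent Q \in stab (sums n S) &
      [\/ (exponent Q < n)%N, (#|stab (sums n S)| < exponent Q <= n)%N,
          (exponent Q <= n)%N /\ #|G| = (#|stab (sums n S)| * (2 * exponent Q))%N |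
          (#|G| <= #|stab (sums n S)| * n.+1)%N]].
  have cH : #|stab (sums n S)| = #|H| by rewrite HE.
  have memH y : (y \in stab (sums n S)) = (y \in H) by rewrite HE.
  case: cond => [Htriv|Hfull|cond]; [by left; rewrite HE|by right; left; rewrite HE|right; right].
  rewrite cH; have e0 : (0 < exponent Q)%N := exponent_gt0 _.
  split=> // [x|]; first by rewrite memH; apply: quotient_exponent.
  case: cond => [lt|lt|[le iso]|[le cyc]]; [constructor 1|by constructor 2|constructor 3|constructor 4].
  - by rewrite -addn1.
  - by split=> //; rewrite cG (isog_C2_Ce_card e0 iso).
  - rewrite cG leq_mul2l -(exponent_cyclic cyc); apply/orP; right.
    by move: le; rewrite leq_subLR add1n.
have [A [[A0 A_le] tA out]] := setpartition_dichotomy n0 nS (size_le_min_sum sS mS) cond'.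
rewrite -YE in out.
exists A; split=> //.
- by apply/msubsetP => g; rewrite setpart_seqE.
- by rewrite size_setpart_seq.
case: out => [i|[K [a [[gK K1 KH HT] [AY occA] [big bigH] [eH eK] [A1 A2 A3 A4]]]]].
  left; apply/andP; split; first exact: i.
  by rewrite YE; apply: subset_leq_card; apply: cfg_sub_sums.
right; have /subgrpP [K0 KD] := gK.
have gsK : group_set K by apply/group_setP; split.
exists (Group gsK), a; rewrite /= !num_outside_eout.
split.
- split; first by apply/eqP => KE; rewrite KE cards1 in K1.
    exact: KH.
  by rewrite properT.
- split; first exact: esym AY.
  move=> g; rewrite in_msetB setpart_seqE => lt_g; apply: contraLR lt_g => /occA ->.
  by rewrite ltnn.
- split.
  + exact: eH.
  + exact: (eout_rat_bound (H := H) nS eH big bigH).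
  + by [].
  + apply: (eout_rat_bound (H := Group gsK) nS eK big).
    by apply: leq_trans bigH; rewrite leq_add2l subset_leq_card.
- by split.
- exact: A4.
Qed.
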